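(* Let $P\subset(\mathbb{R}^m)^*$ be a polytope with $m+k+1$ facets obtained by cutting the standard simplex $\Delta_m\subset(\mathbb{R}^m)^*$ by means of $k$ hyperplanes parallel to facets of $\Delta_m$. Then the manifold $M_P$ corresponding to $P$ is the blow-up at $k$ points of $\mathbb{HP}^m$. Moreover $M_P$ admits a $4$-plectic form.
   Context: A $4$-plectic form on a real $4m$-dimensional manifold is a closed $4$-form $\psi$ that is non-degenerate, i.e. $v\mapsto\iota_v\psi$ has trivial kernel. $\mathbb{HP}^m$ is the quaternionic projective space. $Sp(1)$ is the group of unit quaternions. The standard simplex $\Delta_m$ has primitive outward-pointing facet normals $-e_1,\ldots,-e_m,\,e_1+\cdots+e_m$. Construction of $M_P$. Let $P=\{x\in(\mathbb{R}^m)^*: \langle x,v_i\rangle\le\lambda_i,\ i=1,\ldots,d\}$ be a Delzant polytope (a convex polytope with $m$ edges at each vertex, the edges at each vertex being directed by a $\mathbb{Z}$-basis of $\mathbb{Z}^m$) with $d$ facets and primitive outward-pointing normals $v_i\in\mathbb{Z}^m$. The map $\pi:\mathbb{R}^d\to\mathbb{R}^m$, $e_i\mapsto v_i$, induces a surjection of tori $T^d\to T^m$ with kernel $N\cong(S^1)^{d-m}$ and Lie algebra $\mathfrak{n}=\ker\pi\subset\mathbb{R}^d$, with inclusion $i:\mathfrak{n}\to\mathbb{R}^d$. $N$ acts on $\mathbb{H}^d$ as a subgroup of $T^d\subset Sp(1)^d$ by coordinatewise multiplication. This action extends to $\widehat N=Sp(1)^{d-m}$ when there is an action of the form $(h_1,\ldots,h_{d-m})(q_1,\ldots,q_d)=(h_{k_1}^{\alpha_1}q_1h_{j_1}^{\beta_1},\ldots,h_{k_d}^{\alpha_d}q_dh_{j_d}^{\beta_d})$,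 with $\alpha_\ell\in\{0,1\}$, $\beta_\ell\in\{0,-1\}$, which, for some identification $N\cong(S^1)^{d-m}\subset Sp(1)^{d-m}$ (with $S^1\subset\mathbb{C}\subset\mathbb{H}$), restricts on $\mathbb{C}^d\subset\mathbb{H}^d$ to the action of $N$ (this is possible for the polytopes considered here). Let $\sigma(q_1,\ldots,q_d)=-\frac14(|q_1|^4,\ldots,|q_d|^4)+(\lambda_1,\ldots,\lambda_d)$ and $Z=(i^*\circ\sigma)^{-1}(0)$, where $i^*:(\mathbb{R}^d)^*\to\mathfrak{n}^*$ is the dual of the inclusion. $\widehat N$ acts freely on the compact set $Z$ and $M_P=Z/\widehat N$, a compact manifold of real dimension $4m$. Blow-up of a $4m$-dimensional manifold $M$ at a point $p$: topologically, remove an open ball centered at $p$ and collapse the boundary sphere $S^{4m-1}$ along the fibres of the Hopf fibration $S^3\to S^{4m-1}\to\mathbb{HP}^{m-1}$ (so the result is a connected sum of $M$ with a copy of $\mathbb{HP}^m$, suitably oriented).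
   Formalization: The pieces of the simplex cut off by the k hyperplanes are assumed pairwise disjoint; without this the claim fails (m=3, cuts x_1≤c_1, x_2≤c_2 with c_1+c_2<1 give a cube whose M_P has a nonzero degree-4 class of square zero, unlike any blow-up of HP^3). *)

(* Defs.v *)
(* MathComp and MathComp-Analysis, over an arbitrary R : realType *)
From HB Require Import structures.
From mathcomp Require Import all_boot all_order all_algebra generic_quotient.
From mathcomp Require Import all_classical all_reals all_analysis.

Set Implicit Arguments.
Unset Strict Implicit.
Unset Printing Implicit Defensive.

Import Order.TTheory GRing.Theory Num.Theory.
Import numFieldNormedType.Exports.

Local Open Scope classical_set_scope.
Local Open Scope ring_scope.

(* A quaternion a + bi + cj + dk is the row (a, b, c, d) and a vector of H^n is
   a matrix of 'M[R]_(n, 4), one quaternion per row; this is also the model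
   space R^(4n) of a 4n-dimensional manifold. *)
Section Quaternions.
Variable R : realType.
Implicit Types p q h : 'rV[R]_4.

Definition qone : 'rV[R]_4 := delta_mx 0 0.

Definition qconj q : 'rV[R]_4 := \row_i (if i == 0 then q 0 i else - q 0 i).

Definition qmul p q : 'rV[R]_4 :=
  let a i := p 0 i in let b i := q 0 i in
  \row_i [:: a 0 * b 0 - a 1 * b 1 - a 2 * b 2 - a 3 * b 3;
             a 0 * b 1 + a 1 * b 0 + a 2 * b 3 - a 3 * b 2;
             a 0 * b 2 - a 1 * b 3 + a 2 * b 0 + a 3 * b 1;
             a 0 * b 3 + a 1 * b 2 - a 2 * b 1 + a 3 * b 0]`_i.

(* the squared Euclidean norm; the library norm on matrices is the sup norm *)
Definition sqnorm n l (x : 'M[R]_(n, l)) : R := \sum_i \sum_j x i j ^+ 2.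

Definition lscale n h (q : 'M[R]_(n, 4)) : 'M[R]_(n, 4) :=
  \matrix_i qmul h (row i q).

Definition cmul n (s q : 'M[R]_(n, 4)) : 'M[R]_(n, 4) :=
  \matrix_i qmul (row i s) (row i q).

(* C^n inside H^n, with C = {a + bi} *)
Definition complexes n : set 'M[R]_(n, 4) :=
  [set q | forall i, q i 2 = 0 /\ q i 3 = 0].

Definition Sp1 n : set 'M[R]_(n, 4) :=
  [set h | forall i, sqnorm (row i h) = 1].

Definition torus n : set 'M[R]_(n, 4) := @Sp1 n `&` @complexes n.

(* the point exp(2 pi i x) of S^1 *)
Definition qcis (x : R) : 'rV[R]_4 :=
  \row_i [:: cos (2 * pi * x); sin (2 * pi * x); 0; 0]`_i.

End Quaternions.

Section Polytopes.
Variables (R : realType) (m : nat).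
Implicit Types (P F : set 'cV[R]_m).

Definition polyhedron d (v : 'M[int]_(d, m)) (lam : 'cV[R]_d) : set 'cV[R]_m :=
  [set x | forall i, (map_mx intr v *m x) i 0 <= lam i 0].

Definition face P F : Prop := exists (a : 'rV[R]_m) (b : R),
  (forall x, P x -> (a *m x) 0 0 <= b) /\
  F = P `&` [set x | (a *m x) 0 0 = b].

(* F contains r + 1 affinely independent points *)
Definition aff_dim_ge F r : Prop := exists X : 'M[R]_(m, r.+1),
  (forall j, F (col j X)) /\
  \rank (col_mx X (const_mx 1 : 'rV[R]_r.+1)) = r.+1.

Definition aff_dim F r : Prop := aff_dim_ge F r /\ ~ aff_dim_ge F r.+1.

Definition facet P F : Prop := face P F /\ aff_dim F m.-1.

Definition edge P F : Prop := face P F /\ aff_dim F 1.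

Definition ray (x b : 'cV[R]_m) : set 'cV[R]_m :=
  [set x + t *: b | t in [set t : R | 0 <= t]].

(* The sets P `&` ray x b_i are pairwise distinct edges, since the b_i are
   linearly independent: there are exactly m edges at the vertex x. *)
Definition delzant P : Prop :=
  [/\ exists d (v : 'M[int]_(d, m)) (lam : 'cV[R]_d), P = polyhedron v lam,
      bounded_set P, aff_dim P m &
      forall x, face P [set x] -> exists2 B : 'M[int]_m, B \in unitmx &
        [set E | edge P E /\ E x] =
        [set E | exists i, E = P `&` ray x (col i (map_mx intr B))]].

End Polytopes.

(* rows: -e_1, ..., -e_m, e_1 + ... + e_m *)
Definition simplex_normals m : 'M[int]_(m + 1, m) :=
  col_mx (- 1%:M) (const_mx 1).

Definition simplex_offsets (R : realType) m : 'cV[R]_(m + 1) :=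
  col_mx 0 1%:M.

(* Quotient of the subspace Z of E by the relation "orb x = orb y"; when orb
   maps a point to its orbit under a group, this is the orbit space of Z. *)
Section OrbitSpace.
Variables (E : topologicalType) (Z : set E) (orb : E -> set E).

Definition orbit_rel : rel Z :=
  fun x y => `[< orb (set_val x) = orb (set_val y) >].

Lemma orbit_rel_refl : reflexive orbit_rel.
Proof. by move=> x; apply/asboolP. Qed.

Lemma orbit_rel_sym : symmetric orbit_rel.
Proof. by move=> x y; apply/asboolP/asboolP => ->. Qed.

Lemma orbit_rel_trans : transitive orbit_rel.
Proof. by move=> y x z /asboolP xy /asboolP yz; apply/asboolP; rewrite xy. Qed.

Canonical orbit_equiv :=
  EquivRel orbit_rel orbit_rel_refl orbit_rel_sym orbit_rel_trans.

Definition orbit_space : Type := quotient_topology {eq_quot orbit_equiv}%qT.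

HB.instance Definition _ := Topological.on orbit_space.

Definition orbit_proj (z : Z) : orbit_space :=
   (\pi_orbit_space z)%qT.

End OrbitSpace.

Section Smooth.
Variable R : realType.

(* of class C^k on the open set U: for k > 0 all directional derivatives exist
   and are of class C^(k-1); meant for finite-dimensional V *)
Fixpoint Ck (V W : normedModType R) (k : nat) (U : set V) (f : V -> W) : Prop :=
  if k is k'.+1 then
    (forall x v, U x -> derivable f x v) /\ (forall v, Ck k' U ('D_v f))
  else forall x, U x -> {for x, continuous f}.

Definition smooth_on (V W : normedModType R) (U : set V) (f : V -> W) : Prop :=
  forall k, Ck k U f.

Record chart (X : Type) (F : Type) := Chart {
  cdom : set X;
  cfwd : X -> F;
  cbwd : F -> X }.

Definition cimg (X F : Type) (c : chart X F) : set F := cfwd c @` cdom c.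

Definition top_chart (X F : topologicalType) (c : chart X F) : Prop :=
  [/\ open (cdom c), open (cimg c),
      forall x, cdom c x -> cbwd c (cfwd c x) = x,
      forall x, cdom c x -> {for x, continuous (cfwd c)} &
      forall y, cimg c y -> {for y, continuous (cbwd c)}].

Definition transition (X F : Type) (c c' : chart X F) : F -> F :=
  cfwd c' \o cbwd c.

Definition overlap (X F : Type) (c c' : chart X F) : set F :=
  cfwd c @` (cdom c `&` cdom c').

Definition smooth_manifold (X : topologicalType) (F : normedModType R)
    (A : set (chart X F)) : Prop :=
  [/\ hausdorff_space X, @second_countable X,
      A `<=` @top_chart X F,
      forall x, exists2 c, A c & cdom c x &
      forall c c', A c -> A c' -> smooth_on (overlap c c') (transition c c')].

(* The maximal atlas of the quotient smooth structure on Z / ~ for a submanifold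
   Z of V, i.e. of the one for which Z -> Z / ~ is a smooth submersion.  A chart
   c of Z / ~ belongs to it iff c and its inverse are smooth, that is: c composed
   with the projection is smooth on Z (locally extends to a smooth map on V), and
   its inverse locally lifts to smooth maps into Z. *)
Definition quotient_charts (V F : normedModType R) (Z : set V)
    (orb : V -> set V) : set (chart (orbit_space Z orb) F) :=
  [set c | [/\ top_chart c,
    forall z : Z, cdom c (orbit_proj orb z) ->
      exists (O : set V) (g : V -> F),
        [/\ open O, O (set_val z), smooth_on O g &
            forall z' : Z, O (set_val z') -> cdom c (orbit_proj orb z') ->
              g (set_val z') = cfwd c (orbit_proj orb z')] &
    forall y, cimg c y ->
      exists (O : set F) (s : F -> V),
        [/\ open O, O y, smooth_on O s &
            forall y', O y' -> cimg c y' -> exists2 z : Z,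
              set_val z = s y' & orbit_proj orb z = cbwd c y']]].

(* A field of p-forms assigns to a chart and a point of its image a function of
   p vectors of the model space. *)
Definition form_field (X F : Type) (p : nat) : Type :=
  chart X F -> F -> ('I_p -> F) -> R.

Definition alternating_form (F : lmodType R) p (w : ('I_p -> F) -> R) : Prop :=
  (forall (v : 'I_p -> F) (i : 'I_p) (a : R) (x y : F),
     w [eta v with i |-> a *: x + y] =
     a * w [eta v with i |-> x] + w [eta v with i |-> y]) /\
  (forall (v : 'I_p -> F) (i j : 'I_p), i != j -> v i = v j -> w v = 0).

Definition differential_form (X : topologicalType) (F : normedModType R)
    (A : set (chart X F)) p (omega : form_field X F p) : Prop :=
  [/\ forall c y, A c -> cimg c y -> alternating_form (omega c y),
      forall c v, A c -> smooth_on (cimg c) (fun y => omega c y v) &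
      forall c c' y v, A c -> A c' -> overlap c c' y ->
        omega c y v = omega c' (transition c c' y)
                        (fun i => 'D_(v i) (transition c c') y)].

(* the exterior derivative in the chart c *)
Definition ext_der (X : topologicalType) (F : normedModType R) p
    (omega : form_field X F p) (c : chart X F) (y : F) (v : 'I_p.+1 -> F) : R :=
  \sum_(i < p.+1) (-1) ^+ i * 'D_(v i) (fun y' => omega c y' (v \o lift i)) y.

Definition closed_form (X : topologicalType) (F : normedModType R)
    (A : set (chart X F)) p (omega : form_field X F p) : Prop :=
  forall c y v, A c -> cimg c y -> ext_der omega c y v = 0.

Definition interior_product (F : Type) p (u : F) (w : ('I_p.+1 -> F) -> R) :
    ('I_p -> F) -> R :=
  fun v => w (fun i => if unlift ord0 i is Some j then v j else u).

Definition nondegenerate (X : topologicalType) (F : normedModType R)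
    (A : set (chart X F)) p (omega : form_field X F p.+1) : Prop :=
  forall c y u, A c -> cimg c y ->
    interior_product u (omega c y) = (fun=> 0) -> u = 0.

Definition plectic_form (X : topologicalType) (F : normedModType R)
    (A : set (chart X F)) p (omega : form_field X F p.+1) : Prop :=
  [/\ differential_form A omega, closed_form A omega & nondegenerate A omega].

End Smooth.

Section QuaternionicToric.
Variable R : realType.

(* N, the kernel of the map of tori T^d -> T^m induced by e_i |-> v_i *)
Definition torus_kernel m d (v : 'M[int]_(d, m)) : set 'M[R]_(d, 4) :=
  [set t | exists2 xi : 'rV[R]_d,
     (forall j, (xi *m map_mx intr v) 0 j \is a Num.int) &
     forall l, row l t = qcis (xi 0 l)].

(* The exponents: alpha_l = 1 iff lexp l, and beta_l = -1 iff rexp l. *)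
Record extension d n := Extension {
  lidx : 'I_d -> 'I_n;
  ridx : 'I_d -> 'I_n;
  lexp : 'I_d -> bool;
  rexp : 'I_d -> bool }.

(* for h in Sp(1)^n, where the inverse is the conjugate *)
Definition ext_act d n (e : extension d n) (h : 'M[R]_(n, 4))
    (q : 'M[R]_(d, 4)) : 'M[R]_(d, 4) :=
  \matrix_l qmul
    (qmul (if lexp e l then row (lidx e l) h else qone R) (row l q))
    (if rexp e l then qconj (row (ridx e l) h) else qone R).

(* phi is the identification (S^1)^n -> N; its inverse is continuous because
   (S^1)^n is compact. *)
Definition extends_torus_action m d n (v : 'M[int]_(d, m))
    (e : extension d n) : Prop :=
  exists phi : 'M[R]_(n, 4) -> 'M[R]_(d, 4),
    [/\ set_bij (@torus R n) (torus_kernel v) phi,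
        {within @torus R n, continuous phi},
        forall s t, torus s -> torus t -> phi (cmul s t) = cmul (phi s) (phi t) &
        forall s z, torus s -> complexes z -> ext_act e s z = cmul (phi s) z].

Definition sigma d (lam : 'cV[R]_d) (q : 'M[R]_(d, 4)) : 'cV[R]_d :=
  \col_l (- 4^-1 * sqnorm (row l q) ^+ 2 + lam l 0).

(* i^*(sigma q) = 0 says that sigma q vanishes on n = ker pi. *)
Definition level_set m d (v : 'M[int]_(d, m)) (lam : 'cV[R]_d) :
    set 'M[R]_(d, 4) :=
  [set q | forall xi : 'rV[R]_d,
     xi *m map_mx intr v = 0 -> xi *m sigma lam q = 0].

Definition ext_orbit d n (e : extension d n) (q : 'M[R]_(d, 4)) :
    set 'M[R]_(d, 4) :=
  [set ext_act e h q | h in @Sp1 R n].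

Definition toric_manifold m d n (v : 'M[int]_(d, m)) (lam : 'cV[R]_d)
    (e : extension d n) : topologicalType :=
  orbit_space (level_set v lam) (ext_orbit e).

Definition toric_charts m d n (v : 'M[int]_(d, m)) (lam : 'cV[R]_d)
    (e : extension d n) : set (chart (toric_manifold v lam e) 'M[R]_(m, 4)) :=
  @quotient_charts R _ 'M[R]_(m, 4) (level_set v lam) (ext_orbit e).

End QuaternionicToric.

Arguments toric_charts {R m d n} v lam e.

Section BlowUp.
Variable R : realType.

Definition unit_sphere n : set 'M[R]_(n, 4) := [set q | sqnorm q = 1].

Definition scalar_orbit n (q : 'M[R]_(n, 4)) : set 'M[R]_(n, 4) :=
  [set lscale h q | h in [set h | sqnorm h = 1]].

(* HP^m = S^(4m+3) / Sp(1) *)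
Definition HP m : topologicalType :=
  orbit_space (@unit_sphere m.+1) (@scalar_orbit m.+1).

Definition HP_charts m : set (chart (HP m) 'M[R]_(m, 4)) :=
  @quotient_charts R _ 'M[R]_(m, 4) (@unit_sphere m.+1) (@scalar_orbit m.+1).

Definition homeomorphic (X Y : topologicalType) : Prop :=
  exists (f : X -> Y) (g : Y -> X),
    [/\ continuous f, continuous g, cancel f g & cancel g f].

Section Collapse.
Variables (X : topologicalType) (m k : nat).
Variable c : 'I_k -> chart X 'M[R]_(m, 4).

Definition coord_ball j : set X :=
  [set x | cdom (c j) x /\ sqnorm (cfwd (c j) x) < 1].

Definition coord_cball j : set X :=
  [set x | cdom (c j) x /\ sqnorm (cfwd (c j) x) <= 1].

Definition coord_sphere j : set X :=
  [set x | cdom (c j) x /\ sqnorm (cfwd (c j) x) = 1].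

(* the Hopf fibre of x if x lies on one of the spheres, and {x} otherwise *)
Definition hopf_fibre (x : X) : set X :=
  [set x' | x' = x \/
    exists2 j, coord_sphere j x /\ coord_sphere j x' &
      scalar_orbit (cfwd (c j) x) (cfwd (c j) x')].

Definition collapse : topologicalType :=
  orbit_space (~` \bigcup_j coord_ball j) hopf_fibre.

End Collapse.

(* B is a blow-up of the manifold X, with maximal atlas A, at the points p_j.
   The coordinates identifying a neighbourhood of p_j with an open subset of H^m
   may preserve or reverse orientation. *)
Definition blow_up (X : topologicalType) m k (A : set (chart X 'M[R]_(m, 4)))
    (p : 'I_k -> X) (B : topologicalType) : Prop :=
  exists c : 'I_k -> chart X 'M[R]_(m, 4),
    [/\ forall j, A (c j),
        forall j, cdom (c j) (p j) /\ cfwd (c j) (p j) = 0,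
        forall j, [set y | sqnorm y <= 1] `<=` cimg (c j),
        forall i j, i != j -> coord_cball c i `&` coord_cball c j = set0 &
        homeomorphic B (collapse c)].

End BlowUp.

(* Main.v *)
(* By the count of facets, every cut is w_j = - (normal of the facet i_j) with
   distinct i_j, and with the offsets c_j in (0, 1) and c_i + c_j > 1 for i <> j.
   The level set is then given by sum_l |q_l|^4 = 4 and
   |q_(i_j)|^4 + |t_j|^4 = 4 c_j, where t_j is the coordinate of the j-th cut.

   An extension of the torus action is a directed graph on the k + 1 factors
   Sp(1) and one vertex None carrying the trivial group: the coordinate a is an
   edge on which h acts by q |-> h_src q h_tgt^-1.  Comparison with the kernel
   torus determines this graph: all uncut simplex coordinates are edges from x
   to y, and the pair of edges (i_j, t_j) is, for its own vertex z_j, either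
   x -> z_j <- y or y <- z_j -> x.  At a vertex of the polytope the nonzero
   coordinates form a spanning tree, along which the group can be used to make
   them real positive; this gives slices and hence charts.

   Blow-up: rescaling the points of the unit sphere with |q_(i_j)|^2 <= c_j, and
   taking t_j real nonnegative, gives a map to the level set.  Where all t_j are
   nonzero the orbits of the images are those of the left action of Sp(1); where
   t_j = 0 the direction of q_(i_j) relative to the other coordinates is lost,
   which is the collapse of a Hopf fibre.  The collapsed space is compact and the
   toric manifold Hausdorff, so the induced bijection is a homeomorphism.

   4-plectic form: for m >= 2 any compact 4m-manifold carries one.  Take
   omega = sum_s eta_s dF_s1 ^ .. ^ dF_s4 over all quadruples of coordinate
   functions cut off by bumps.  Degeneracy of omega at a point, in a unit
   direction, amounts to C(4m-1, 3) equations on eta, and there are only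
   8m < C(4m-1, 3) parameters for the point and the direction; a count on
   a fine grid yields an eta outside all these graphs.  For m = 1 the
   determinant form in the two slice charts is invariant under the transition
   u |-> (4 - |u|^4)^(1/4) conj(u) / |u|, whose Jacobian determinant is 1. *)
From HB Require Import structures.
Require Import Defs.
From mathcomp Require Import all_boot all_order all_algebra.
From mathcomp Require Import all_classical all_reals all_analysis.
From mathcomp Require Import ring lra zify.

Set Implicit Arguments.
Unset Strict Implicit.
Unset Printing Implicit Defensive.

Import Order.TTheory GRing.Theory Num.Theory.
Import numFieldNormedType.Exports.

Local Open Scope classical_set_scope.
Local Open Scope ring_scope.

(** * Calculus in several variables *)

(** [Ck] only speaks of iterated directional derivatives, so differentiability, the chain rule and
    the symmetry of second derivatives are derived from it, mostly by restriction to lines. No chart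
    needs an inverse function theorem: each is a pair of explicit smooth maps, an invariant [g] and
    a section [s]. A 4-form assembled with constant coefficients from functions on the whole space
    is closed and compatible with changes of chart at once, so nondegeneracy is the only issue. If
    the direction v is normalised by v_i = 1, the equation omega(v, e_B) = 0 can be solved for the
    coefficient of dx_i ^ dx_B; this turns degeneracy into lying on a graph, and a pigeonhole
    argument then replaces measure theory. For m = 1 there is one such equation against 8
    parameters. The claim concerns every extension, hence the classification of graphs; it rests on
    elements of order two and circle subgroups of the kernel torus. If the trivial vertex [None] is
    some z_j, the Hopf fibration at the ball j comes from multiplication on the side opposite to
    that at the other balls, which a conjugated chart repairs. *)

Section Lines.
Variables (R : realType) (V W : normedModType R).
Implicit Types (f : V -> W) (p v : V) (t c : R).

(** The two difference quotients are the same function, so a directional derivative becomes a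
    derivative on [R]; the mean value theorem and the chain rule are imported along lines in this
    way. *)
Lemma line_quotient f p v t c :
  (fun h => h^-1 *: (((fun s : R => f (p + s *: v)) \o shift t) (h *: c) -
                      f (p + t *: v))) =
  (fun h => h^-1 *: ((f \o shift (p + t *: v)) (h *: (c *: v)) -
                      f (p + t *: v))).
Proof.
apply/funext => h /=; congr (_ *: (f _ - _)).
by rewrite scalerDl scalerA addrCA.
Qed.

Lemma derivable_line f p v t c :
  derivable f (p + t *: v) (c *: v) <->
  derivable (fun s : R => f (p + s *: v)) t c.
Proof. by rewrite /derivable line_quotient. Qed.

Lemma derive_line f p v t c :
  'D_c (fun s : R => f (p + s *: v)) t = 'D_(c *: v) f (p + t *: v).
Proof. by rewrite /derive line_quotient. Qed.

(** Homogeneity in the direction is needed before [f] is known to be differentiable: on the line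
    through [p] derivability is differentiability, and the differential there is linear. *)
Lemma is_derive_scale f p v c :
  derivable f p v -> is_derive p (c *: v) f (c *: 'D_v f p).
Proof.
move=> dfv; have pE : p = p + 0 *: v by rewrite scale0r addr0.
have /derivable1_diffP dg : derivable (fun s : R => f (p + s *: v)) 0 1.
  by apply/derivable_line; rewrite scale1r -pE.
have E e : 'D_(e *: v) f p = e *: 'd (fun s : R => f (p + s *: v)) 0 1.
  rewrite [in LHS]pE -derive_line deriveE // -[in LHS](mulr1 e).
  by rewrite -[e * 1]/(e *: (1 : R)) linearZ.
apply: DeriveDef; last by rewrite E -[in RHS](scale1r v) E scale1r.
by rewrite pE; apply/derivable_line/diff_derivable.
Qed.

End Lines.

Lemma MVT_line (R : realType) (V : normedModType R) (f : V -> R) p v :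
  (forall t : R, 0 <= t <= 1 -> derivable f (p + t *: v) v) ->
  exists2 t : R, 0 <= t <= 1 & f (p + v) - f p = 'D_v f (p + t *: v).
Proof.
move=> df.
have dg (t : R) : 0 <= t <= 1 ->
    is_derive t (1 : R) (fun s : R => f (p + s *: v)) ('D_v f (p + t *: v)).
  move=> t01; apply: DeriveDef; last by rewrite derive_line scale1r.
  by apply/derivable_line; rewrite scale1r; exact: df.
have [|||t] := @MVT_segment R (fun s : R => f (p + s *: v))
    (fun t : R => 'D_v f (p + t *: v)) 0 1.
- exact: ler01.
- by move=> t; rewrite in_itv /= => /andP[t0 t1]; apply: dg; rewrite !ltW.
- apply: derivable_within_continuous => t; rewrite in_itv /= => t01.
  by have [] := dg t t01.
- rewrite in_itv /= scale1r scale0r addr0 subr0 mulr1 => t01 E.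
  by exists t.
Qed.

Section Differentiability.
Variables (R : realType) (a b : nat).
Notation V := 'M[R]_(a, b).
Implicit Types (U : set V) (f : V -> R).

(** Along growing lists [r] without repetition these matrices form the staircase from 0 to [h] that
    switches on one entry at a time. *)
Definition mx_restrict (r : seq ('I_a * 'I_b)) (h : V) : V :=
  \sum_(ij <- r) h ij.1 ij.2 *: delta_mx ij.1 ij.2.

Lemma mx_restrictE r h i j : uniq r ->
  mx_restrict r h i j = if (i, j) \in r then h i j else 0.
Proof.
rewrite /mx_restrict; elim: r => [|[i' j'] r IH] /=.
  by rewrite big_nil mxE.
case/andP=> nin ur; rewrite big_cons !mxE (IH ur) inE xpair_eqE /=.
have [/andP[/eqP -> /eqP ->]|] := boolP ((i == i') && (j == j')).
  by rewrite (negPf nin) mulr1 addr0.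
by rewrite mulr0 add0r.
Qed.

Lemma mx_restrict_full h : mx_restrict (index_enum ('I_a * 'I_b)%type) h = h.
Proof.
by apply/matrixP => i j; rewrite mx_restrictE ?index_enum_uniq // mem_index_enum.
Qed.

Lemma mx_norm_le (h : V) (e : R) : 0 <= e ->
  (forall i j, `|h i j| <= e) -> `|h| <= e.
Proof.
move=> e0 he; rewrite [`|h|]/Num.Def.normr /= mx_normrE.
by apply: bigmax_le => // -[i j] _; exact: he.
Qed.

Lemma mx_norm_ge (h : V) i j : `|h i j| <= `|h|.
Proof.
rewrite [leRHS]/Num.Def.normr /= mx_normrE.
exact: (le_bigmax _ (fun ij : 'I_a * 'I_b => `|h ij.1 ij.2|) (i, j)).
Qed.

(** The increment is split along the staircase of [mx_restrict]; each stair is a mean value of one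
    partial derivative, which is close to its value at [x]. *)
Lemma C1_increment U f x : open U -> U x ->
  (forall y v, U y -> derivable f y v) ->
  (forall v y, U y -> {for y, continuous ('D_v f)}) ->
  forall e : R, 0 < e -> \forall h \near (0 : V),
    `|f (x + h) - f x -
      \sum_(ij : 'I_a * 'I_b) h ij.1 ij.2 * 'D_(delta_mx ij.1 ij.2) f x|
    <= e * `|h|.
Proof.
move=> oU Ux df cf e e0.
set N := (size (index_enum ('I_a * 'I_b)%type))%:R : R.
(* Each of the [N] stairs may err by [e / (N + 1)]; the summand 1 covers empty matrices. *)
have eN : 0 < e / (N + 1) by rewrite divr_gt0 // ltr_wpDl ?ler0n.
have /nbhs_ballP[d /= d0 dball] : \forall y \near x, U y /\
    forall ij : 'I_a * 'I_b, `|'D_(delta_mx ij.1 ij.2) f x -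
       'D_(delta_mx ij.1 ij.2) f y| < e / (N + 1).
  near=> y; split.
    by near: y; move: oU; rewrite openE; exact.
  move=> ij; move: ij; near: y; apply: filter_forall => ij.
  by have /cvgrPdist_lt := cf (delta_mx ij.1 ij.2) x Ux; exact.
near=> h.
have hd : `|h| < d by near: h; exact: (@nbhs0_lt R V).
have step r : uniq r -> `|f (x + mx_restrict r h) - f x -
      \sum_(ij <- r) h ij.1 ij.2 * 'D_(delta_mx ij.1 ij.2) f x|
    <= (size r)%:R * (e / (N + 1)) * `|h|.
  elim: r => [_|[i j] r IH /= /andP[nin ur]].
    by rewrite /mx_restrict !big_nil addr0 !subrr normr0 mul0r mul0r.
  have {}IH := IH ur.
  have rE : mx_restrict ((i, j) :: r) h =
      mx_restrict r h + h i j *: delta_mx i j.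
    by rewrite /mx_restrict big_cons addrC.
  set q := x + mx_restrict r h.
  (* In the sup norm no point of the staircase is further from [x] than the norm of [h]. *)
  have inball (t : R) : 0 <= t <= 1 ->
      ball x d (q + t *: (h i j *: delta_mx i j)).
    case/andP=> t0 t1; rewrite -ball_normE /= /q opprD addrA.
    rewrite opprD addrA subrr add0r -opprD normrN.
    apply: le_lt_trans hd; apply: mx_norm_le => // i' j'.
    rewrite !mxE mx_restrictE //.
    have [/andP[/eqP -> /eqP ->]|_] := boolP ((i' == i) && (j' == j)).
      rewrite (negPf nin) add0r mulr1 normrM ger0_norm //.
      by apply: le_trans (mx_norm_ge h i j); rewrite ler_piMl.
    rewrite !mulr0 addr0; case: ifP => _; first exact: mx_norm_ge.
    by rewrite normr0.
  have [|t t01 tE] := @MVT_line R _ f q (h i j *: delta_mx i j).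
    by move=> t t01; apply: df; case: (dball _ (inball t t01)).
  have [Ut /(_ (i, j)) /= Dt] := dball _ (inball t t01).
  have := is_derive_scale (h i j)
    (df (q + t *: (h i j *: delta_mx i j)) (delta_mx i j) Ut).
  move=> [_ sE]; rewrite sE in tE.
  have {}tE : f (q + h i j *: delta_mx i j) - f q =
    h i j * 'D_(delta_mx i j) f (q + t *: (h i j *: delta_mx i j)) := tE.
  rewrite big_cons rE addrA -/q /=.
  have -> : f (q + h i j *: delta_mx i j) - f x -
     (h i j * 'D_(delta_mx i j) f x +
      \sum_(j0 <- r) h j0.1 j0.2 * 'D_(delta_mx j0.1 j0.2) f x) =
     (f q - f x - \sum_(j0 <- r) h j0.1 j0.2 * 'D_(delta_mx j0.1 j0.2) f x) +
     h i j * ('D_(delta_mx i j) f (q + t *: (h i j *: delta_mx i j)) -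
              'D_(delta_mx i j) f x).
    rewrite mulrBr -tE.
    by move: (\sum_(_ <- _) _) => S; ring.
  apply: le_trans (ler_normD _ _) _.
  rewrite -addn1 natrD mulrDl mulrDl mul1r lerD // normrM mulrC.
  apply: ler_pM => //; last exact: mx_norm_ge.
  by rewrite distrC ltW.
have := step _ (index_enum_uniq ('I_a * 'I_b)%type).
rewrite mx_restrict_full -/N.
move=> /le_trans; apply; rewrite ler_wpM2r //.
have N0 : 0 <= N by rewrite /N ler0n.
move: (N) N0 => M M0.
have -> : M * (e / (M + 1)) = (M * e) / (M + 1) by rewrite mulrA.
by rewrite ler_pdivrMr; nra.
Unshelve. all: by end_near. Qed.

Lemma C1_differentiable U f x : open U -> U x ->
  (forall y v, U y -> derivable f y v) ->
  (forall v y, U y -> {for y, continuous ('D_v f)}) ->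
  differentiable f x.
Proof.
move=> oU Ux df cf.
pose L (h : V) : R :=
  \sum_(ij : 'I_a * 'I_b) h ij.1 ij.2 * 'D_(delta_mx ij.1 ij.2) f x.
have Llin : linear L.
  move=> c u v; rewrite /L scaler_sumr -big_split /=; apply: eq_bigr => ij _.
  by rewrite !mxE mulrDl -mulrA.
pose LL := HB.pack_for {linear V -> R} L
  (GRing.isLinear.Build _ _ _ _ L Llin).
have Lc : continuous LL.
  move=> y; apply: differentiable_continuous.
  rewrite /LL /= /L.
  rewrite (_ : (fun _ => _) = \sum_(ij : 'I_a * 'I_b)
    (fun h : V => h ij.1 ij.2 * 'D_(delta_mx ij.1 ij.2) f x)); last first.
    by apply/funext => h; rewrite fct_sumE.
  elim/big_ind: _ => [|u w du dw|ij _]; first exact: differentiable_cst.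
    exact: differentiableD.
  by apply: differentiableM => //; exact: differentiable_coord.
have E : f \o shift x = cst (f x) + (LL : V -> R) +o_ (0 : V) id.
  apply/(@eqaddoP R V R V) => e e0; rewrite near_simpl.
  have := C1_increment oU Ux df cf e0; apply: filterS => h.
  rewrite -![(_ + _ : _ -> _) _]/(_ + _) -![(- _ : _ -> _) _]/(- _) /=.
  by rewrite opprD addrA [h + x]addrC.
apply/diff_locallyP; have := diff_unique Lc E => dE.
by split; rewrite dE.
Qed.

End Differentiability.

Section CkBasics.
Variables (R : realType) (V W : normedModType R).
Implicit Types (f g : V -> W) (U : set V).

Lemma Ck_subset k U U' f : U' `<=` U -> Ck k U f -> Ck k U' f.
Proof.
move=> sU; elim: k f => [|k IH] f /=; first by move=> cf x /sU; exact: cf.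
by case=> df Df; split=> [x v /sU|v]; [exact: df|exact: IH].
Qed.

Lemma Ck_ext k U f g : open U -> (forall x, U x -> f x = g x) ->
  Ck k U f -> Ck k U g.
Proof.
move=> oU; have nU x : U x -> nbhs x U by move: oU; rewrite openE; exact.
elim: k f g => [|k IH] f g fg /=.
  move=> cf x Ux; rewrite /prop_for /continuous_at -(fg _ Ux).
  apply: cvg_trans (cf x Ux); apply: near_eq_cvg.
  by apply: filterS (nU x Ux) => y Uy; rewrite fg.
have fgn x : U x -> \forall y \near x, f y = g y.
  by move=> Ux; apply: filterS (nU x Ux) => y Uy; rewrite fg.
case=> df Df; split=> [x v Ux|v].
  by apply: near_eq_derivable (df x v Ux); exact: fgn.
apply: IH (Df v) => x Ux; apply: near_eq_derive; exact: fgn.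
Qed.

(** The conditions in [Ck] are imposed point by point and refer to neighbourhoods in the whole of
    [V], so covering sets [O] of any kind suffice. *)
Lemma Ck_local k U f : (forall x, U x -> exists2 O, O x & Ck k O f) -> Ck k U f.
Proof.
elim: k f => [|k IH] f /= H; first by move=> x /H[B Bx]; apply.
split=> [x v /H[B Bx [df _]] |v]; first exact: df.
by apply: IH => x /H[B Bx [_ Df]]; exists B.
Qed.

Lemma smooth_on_subset U U' f : U' `<=` U -> smooth_on U f -> smooth_on U' f.
Proof. by move=> sU sf k; apply: Ck_subset (sf k). Qed.

Lemma smooth_on_ext U f g : open U -> (forall x, U x -> f x = g x) ->
  smooth_on U f -> smooth_on U g.
Proof. by move=> oU fg sf k; apply: Ck_ext (sf k). Qed.

Lemma smooth_on_local U f :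
  (forall x, U x -> exists2 O, O x & smooth_on O f) -> smooth_on U f.
Proof. by move=> H k; apply: Ck_local => x /H[B Bx sf]; exists B. Qed.

Lemma smooth_on_derivable U f x v : smooth_on U f -> U x -> derivable f x v.
Proof. by move=> /(_ 1%N)[df _]; exact: df. Qed.

Lemma smooth_on_derive U f v : smooth_on U f -> smooth_on U ('D_v f).
Proof. by move=> sf k; have [_ H] := sf k.+1; exact: H. Qed.

Lemma smooth_on_continuous U f x :
  smooth_on U f -> U x -> {for x, continuous f}.
Proof. by move=> /(_ 0%N) H Ux; exact: H. Qed.

(** Induction on the order never leaves a family of continuous functions that is stable under
    directional derivatives. Constants, coordinates, real powers and the flat functions are treated
    this way. *)
Lemma smooth_on_family U (F : set (V -> W)) : open U ->
  (forall f, F f -> forall x, U x -> {for x, continuous f}) ->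
  (forall f v, F f -> exists2 g, F g & forall x, U x -> is_derive x v f (g x)) ->
  forall f, F f -> smooth_on U f.
Proof.
move=> oU cF dF f Ff k; elim: k f Ff => [|k IH] f Ff /=; first exact: cF.
split=> [x v Ux|v]; first by have [g _ /(_ x Ux)[]] := dF f v Ff.
have [g Fg dg] := dF f v Ff; apply: Ck_ext (IH g Fg) => //.
by move=> x Ux; have [_ ->] := dg x Ux.
Qed.

Lemma smooth_on_cst U (c : W) : open U -> smooth_on U (cst c).
Proof.
move=> oU; apply: (smooth_on_family oU (F := range cst)) => //.
  by move=> _ [d _ <-] x _; exact: cst_continuous.
move=> _ v [d _ <-]; exists (cst 0) => [|x _]; first by exists 0.
exact: is_derive_cst.
Qed.

Lemma Ck_add k U f g : open U -> Ck k U f -> Ck k U g -> Ck k U (f \+ g).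
Proof.
move=> oU; elim: k f g => [|k IH] f g /=.
  by move=> cf cg x Ux; apply: continuousD; [exact: cf|exact: cg].
case=> df Df [dg Dg]; split=> [x v Ux|v].
  by apply: derivableD; [exact: df|exact: dg].
apply: Ck_ext (IH _ _ (Df v) (Dg v)) => // x Ux /=.
by rewrite deriveD //; [exact: df|exact: dg].
Qed.

Lemma Ck_sum k U (I : Type) (r : seq I) (F : I -> V -> W) : open U ->
  (forall i, Ck k U (F i)) -> Ck k U (fun x => \sum_(i <- r) F i x).
Proof.
move=> oU CF; elim: r => [|i r IH].
  apply: Ck_ext (@smooth_on_cst U 0 oU k) => // x _.
  by rewrite big_nil.
apply: Ck_ext (Ck_add oU (CF i) IH) => // x _ /=.
by rewrite big_cons.
Qed.

Lemma smooth_on_add U f g : open U ->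
  smooth_on U f -> smooth_on U g -> smooth_on U (fun x => f x + g x).
Proof. by move=> oU sf sg k; exact: Ck_add. Qed.

Lemma smooth_on_sum U (I : Type) (r : seq I) (F : I -> V -> W) : open U ->
  (forall i, smooth_on U (F i)) -> smooth_on U (fun x => \sum_(i <- r) F i x).
Proof. by move=> oU sF k; apply: Ck_sum => // i; exact: sF. Qed.

End CkBasics.

Section RealValued.
Variables (R : realType) (V : normedModType R).
Implicit Types (f g : V -> R) (U : set V).

(** The factors are assumed smooth, not of class C^k: the product rule keeps one factor
    undifferentiated, and smoothness spares lowering its class in the induction. *)
Lemma smooth_on_mul U f g : open U ->
  smooth_on U f -> smooth_on U g -> smooth_on U (fun x => f x * g x).
Proof.
move=> oU + + k; elim: k f g => [|k IH] f g sf sg /=.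
  move=> x Ux; apply: (@continuousM R V f g).
    exact: smooth_on_continuous sf Ux.
  exact: smooth_on_continuous sg Ux.
split=> [x v Ux|v].
  apply: (@derivableM R V f g).
    exact: smooth_on_derivable sf Ux.
  exact: smooth_on_derivable sg Ux.
have := Ck_add oU (IH f _ sf (smooth_on_derive v sg))
  (IH g _ sg (smooth_on_derive v sf)).
apply: Ck_ext => // x Ux /=.
rewrite -[RHS]/('D_v (f * g) x) deriveM //.
  exact: smooth_on_derivable sf Ux.
exact: smooth_on_derivable sg Ux.
Qed.

Lemma smooth_on_opp U f : open U ->
  smooth_on U f -> smooth_on U (fun x => - f x).
Proof.
move=> oU sf; have := smooth_on_mul oU (smooth_on_cst (-1 : R) oU) sf.
by apply: smooth_on_ext => // x _; rewrite /cst mulN1r.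
Qed.

Lemma smooth_on_sub U f g : open U ->
  smooth_on U f -> smooth_on U g -> smooth_on U (fun x => f x - g x).
Proof. by move=> oU sf sg; apply: smooth_on_add => //; exact: smooth_on_opp. Qed.

Lemma smooth_on_prod U (I : Type) (r : seq I) (F : I -> V -> R) : open U ->
  (forall i, smooth_on U (F i)) -> smooth_on U (fun x => \prod_(i <- r) F i x).
Proof.
move=> oU sF; elim: r => [|i r IH].
  apply: smooth_on_ext (smooth_on_cst (1 : R) oU) => // x _.
  by rewrite big_nil.
apply: smooth_on_ext (smooth_on_mul oU (sF i) IH) => // x _.
by rewrite big_cons.
Qed.

Lemma smooth_on_exp U f n : open U ->
  smooth_on U f -> smooth_on U (fun x => f x ^+ n).
Proof.
move=> oU sf; have := smooth_on_prod (index_enum 'I_n) oU (fun=> sf).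
by apply: smooth_on_ext => // x _; rewrite prodr_const card_ord.
Qed.

(** The inner map is derivable in one direction only; on the line it is differentiable, and the
    chain rule for differentials applies there. *)
Lemma is_derive_chain (W : normedModType R) (W' : normedModType R)
    (f : V -> W) (g : W -> W') x v :
  derivable f x v -> differentiable g (f x) ->
  is_derive x v (g \o f) ('d g (f x) ('D_v f x)).
Proof.
move=> df dg; have xE : x = x + 0 *: v by rewrite scale0r addr0.
have /derivable1_diffP dl : derivable (fun s : R => f (x + s *: v)) 0 1.
  by apply/derivable_line; rewrite scale1r -xE.
have dg' : differentiable g (f (x + 0 *: v)) by rewrite -xE.
have dgl := differentiable_comp dl dg'.
apply: DeriveDef.
  rewrite xE -[v in derivable _ _ v](scale1r v).
  by apply/(derivable_line (g \o f)); exact: diff_derivable.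
rewrite -[v in LHS](scale1r v) {1}xE -(derive_line (g \o f)) deriveE //.
rewrite (diff_comp dl dg') /= -xE; congr ('d g _ _).
by rewrite -deriveE // derive_line scale1r -xE.
Qed.

(* For the induction the composite carries a smooth factor [h]. *)
Lemma smooth_on_comp_real U (D : set R) (phi : R -> R) f : open U ->
  smooth_on D phi -> smooth_on U f -> (forall x, U x -> D (f x)) ->
  smooth_on U (fun x => phi (f x)).
Proof.
move=> oU sphi sf UD.
suff H k : forall phi : R -> R, smooth_on D phi -> forall h : V -> R, smooth_on U h ->
    Ck k U (fun x => phi (f x) * h x).
  move=> k; apply: Ck_ext (H k phi sphi _ (smooth_on_cst (1 : R) oU)) => // x _.
  by rewrite mulr1.
elim: k => [|k IH] {sphi}phi sphi h sh.
  move=> x Ux; apply: (@continuousM R V (phi \o f) h).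
    apply: continuous_comp; first exact: smooth_on_continuous sf Ux.
    exact: smooth_on_continuous sphi (UD x Ux).
  exact: smooth_on_continuous sh Ux.
have dphi x v : U x ->
    is_derive x v (phi \o f) ('D_1 phi (f x) * 'D_v f x).
  move=> Ux; have dp : differentiable phi (f x).
    by apply/derivable1_diffP; exact: smooth_on_derivable sphi (UD x Ux).
  have [H1 H2] := is_derive_chain (smooth_on_derivable (v := v) sf Ux) dp.
  apply: DeriveDef => //; rewrite H2 [X in _ = X * _](deriveE _ dp).
  move: ('D_v f x) => z; rewrite -[z in LHS](mulr1 z) [RHS]mulrC.
  by rewrite -[z * 1]/(z *: (1 : R)) linearZ.
split=> [x v Ux|v].
  apply: (@derivableM R V (phi \o f) h); first by have [] := dphi x v Ux.
  exact: smooth_on_derivable sh Ux.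
have := Ck_add oU (IH _ sphi _ (smooth_on_derive v sh))
  (IH _ (smooth_on_derive (1 : R) sphi) _
     (smooth_on_mul oU sh (smooth_on_derive v sf))).
apply: Ck_ext => // x Ux /=.
have [H1 H2] := dphi x v Ux.
rewrite -[RHS]/('D_v ((phi \o f) * h) x) deriveM //; last first.
  exact: smooth_on_derivable sh Ux.
rewrite H2 -[(phi \o f) x *: _]/(phi (f x) * _) -[h x *: _]/(h x * _).
ring.
Qed.

End RealValued.

Section MatrixValued.
Variables (R : realType) (V : normedModType R) (a b : nat).
Variable F : V -> 'M[R]_(a, b).

Lemma Ck_mx k (O : set V) : open O ->
  Ck k O F <-> forall i j, Ck k O (fun x => F x i j).
Proof.
move=> oO; elim: k F => [|k IH] G /=; split.
- move=> cG i j x Ox; apply: (@continuous_comp _ _ _ G (fun M : 'M[R]_(a, b) => M i j)).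
    exact: cG.
  exact: coord_continuous.
- move=> cG x Ox; apply/cvg_ballP => e e0; near=> y; split=> // i j.
  move: i j; near: y; apply: filter_forall => i; apply: filter_forall => j.
  by have /cvg_ballP/(_ e e0) := cG i j x Ox.
- case=> dG /(_ _)/IH DG i j; split=> [x v Ox|v].
    by have /derivable_mxP := dG x v Ox; exact.
  apply: Ck_ext (DG v i j) => // x Ox.
  by rewrite derive_mx ?mxE //; exact: dG.
- move=> DG; have dG x v : O x -> derivable G x v.
    by move=> Ox; apply/derivable_mxP => i j; have [+ _] := DG i j; exact.
  split=> // v; apply/IH => i j; have [_ /(_ v)] := DG i j.
  by apply: Ck_ext => // x Ox; rewrite derive_mx ?mxE //; exact: dG.
Unshelve. all: by end_near. Qed.

Lemma smooth_on_mx (O : set V) : open O ->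
  smooth_on O F <-> forall i j, smooth_on O (fun x => F x i j).
Proof.
move=> oO; split=> [sF i j k|sF k]; first by have /(Ck_mx k oO) := sF k; exact.
by apply/Ck_mx => // i j; exact: sF.
Qed.

End MatrixValued.

Section MatrixCalculus.
Variables (R : realType) (a b : nat).
Notation V := 'M[R]_(a, b).
Implicit Types (U : set V) (f g : V -> R).

Lemma smooth_on_differentiable U f x :
  open U -> smooth_on U f -> U x -> differentiable f x.
Proof.
move=> oU sf Ux; apply: (C1_differentiable oU Ux) => [y v Uy|v y Uy].
  exact: smooth_on_derivable sf Uy.
exact: smooth_on_continuous (smooth_on_derive v sf) Uy.
Qed.

Lemma smooth_on_coord U i j : open U -> smooth_on U (fun x => x i j).
Proof.
move=> oU; pose F := [set f | f = (fun x : V => x i j)] `|` range (@cst V R).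
apply: (smooth_on_family oU (F := F)); last by left.
  move=> _ [->|[d _ <-]] x _; [exact: coord_continuous|exact: cst_continuous].
move=> _ v [->|[d _ <-]].
  exists (cst (v i j)) => [|x _]; first by right; exists (v i j).
  have dx := differentiable_coord x i j.
  have := diff_derivable (v := v) dx.
  move=> ?; apply: DeriveDef => //; rewrite /derive /=.
  apply: lim_near_cst => //; near=> h.
  rewrite !mxE addrK scalerA mulVf ?scale1r //.
  by near: h; exact: nbhs_dnbhs_neq.
exists (cst 0) => [|x _]; first by right; exists 0.
exact: is_derive_cst.
Unshelve. all: by end_near. Qed.

Lemma diff_mx_sum g y u : differentiable g y ->
  'd g y u = \sum_(ij : 'I_a * 'I_b) u ij.1 ij.2 *
               'D_(delta_mx ij.1 ij.2) g y.
Proof.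
move=> dg; rewrite {1}(matrix_sum_delta u) (pair_bigA _ (fun i j => _ *: _)) /=.
by rewrite linear_sum; apply: eq_bigr => ij _; rewrite linearZ deriveE.
Qed.

(** As in one variable a smooth factor [h] is carried along: derivatives of [g (F x) * h x] are sums
    of terms of this same shape. *)
Lemma smooth_on_comp (V' : normedModType R) (O : set V') U g (F : V' -> V) :
  open O -> open U -> smooth_on U g -> smooth_on O F ->
  (forall x, O x -> U (F x)) -> smooth_on O (fun x => g (F x)).
Proof.
move=> oO oU sg sF OU.
have sFij i j : smooth_on O (fun x => F x i j).
  by move: i j; apply/(smooth_on_mx F oO).
suff H k : forall g : V -> R, smooth_on U g -> forall h : V' -> R, smooth_on O h ->
    Ck k O (fun x => g (F x) * h x).
  move=> k; apply: Ck_ext (H k g sg _ (smooth_on_cst (1 : R) oO)) => // x _.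
  by rewrite mulr1.
elim: k => [|k IH] {sg}g sg h sh.
  move=> x Ox; apply: (@continuousM R V' (g \o F) h).
    apply: continuous_comp; first exact: smooth_on_continuous sF Ox.
    exact: smooth_on_continuous sg (OU x Ox).
  exact: smooth_on_continuous sh Ox.
have dgF x v : O x -> is_derive x v (g \o F)
    (\sum_(ij : 'I_a * 'I_b) 'D_v (fun x => F x ij.1 ij.2) x *
      'D_(delta_mx ij.1 ij.2) g (F x)).
  move=> Ox; have dg := smooth_on_differentiable oU sg (OU x Ox).
  have dF := smooth_on_derivable (v := v) sF Ox.
  have [H1 H2] := is_derive_chain dF dg.
  apply: DeriveDef => //; rewrite H2 diff_mx_sum //.
  by apply: eq_bigr => ij _; rewrite derive_mx // mxE.
split=> [x v Ox|v].
  apply: (@derivableM R V' (g \o F) h); first by have [] := dgF x v Ox.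
  exact: smooth_on_derivable sh Ox.
have S := @Ck_sum R V' R k O _ (index_enum ('I_a * 'I_b)%type) _ oO (fun ij =>
  IH _ (smooth_on_derive (delta_mx ij.1 ij.2) sg) _
    (smooth_on_mul oO sh (smooth_on_derive v (sFij ij.1 ij.2)))).
have := Ck_add oO (IH _ sg _ (smooth_on_derive v sh)) S.
apply: Ck_ext => // x Ox /=.
have [H1 H2] := dgF x v Ox.
rewrite -[RHS]/('D_v ((g \o F) * h) x) deriveM //; last first.
  exact: smooth_on_derivable sh Ox.
rewrite H2 -[(g \o F) x *: _]/(g (F x) * _) -[h x *: _]/(h x * _).
congr (_ + _); rewrite mulr_sumr; apply: eq_bigr => ij _.
ring.
Qed.

Lemma smooth_on_comp_mx (c d : nat) (V' : normedModType R) (O : set V') U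
    (G : V -> 'M[R]_(c, d)) (F : V' -> V) :
  open O -> open U -> smooth_on U G -> smooth_on O F ->
  (forall x, O x -> U (F x)) -> smooth_on O (fun x => G (F x)).
Proof.
move=> oO oU sG sF OU; apply/(smooth_on_mx _ oO) => i j.
apply: (smooth_on_comp oO oU (g := fun x => G x i j)) sF OU.
by move: i j; apply/(smooth_on_mx G oU).
Qed.

Lemma is_derive_translate f y v w : derivable f (y + w) v ->
  is_derive y v (fun z => f (z + w)) ('D_v f (y + w)).
Proof.
have E : (fun h => h^-1 *: (((fun z => f (z + w)) \o shift y) (h *: v) -
            f (y + w))) =
         (fun h => h^-1 *: ((f \o shift (y + w)) (h *: v) - f (y + w))).
  by apply/funext => h /=; rewrite addrA.
by move=> d; apply: DeriveDef; rewrite /derivable /derive E.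
Qed.

(** The mean value theorem twice: for the difference of [f] and its translate by [s *: v] along
    [s *: u], then for ['D_u f] along [s *: v]. *)
Lemma second_difference U f x u v (s : R) : smooth_on U f ->
  (forall t t' : R, 0 <= t <= 1 -> 0 <= t' <= 1 ->
     U (x + t *: (s *: u) + t' *: (s *: v))) ->
  exists t t' : R, [/\ 0 <= t <= 1, 0 <= t' <= 1 &
    f (x + s *: u + s *: v) - f (x + s *: u) - f (x + s *: v) + f x =
    s ^+ 2 * 'D_v ('D_u f) (x + t *: (s *: u) + t' *: (s *: v))].
Proof.
move=> sf xU.
have i0 : 0 <= (0 : R) <= 1 by rewrite lexx ler01.
have i1 : 0 <= (1 : R) <= 1 by rewrite lexx ler01.
have U0 (t : R) : 0 <= t <= 1 -> U (x + t *: (s *: u)).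
  by move=> t01; have := xU t 0 t01 i0; rewrite scale0r addr0.
have U1 (t : R) : 0 <= t <= 1 -> U (x + t *: (s *: u) + s *: v).
  by move=> t01; have := xU t 1 t01 i1; rewrite scale1r.
have dF (t : R) : 0 <= t <= 1 -> is_derive (x + t *: (s *: u)) (s *: u)
    ((fun z => f (z + s *: v)) - f)
    ('D_(s *: u) f (x + t *: (s *: u) + s *: v) -
     'D_(s *: u) f (x + t *: (s *: u))).
  move=> t01; apply: (@is_deriveB R V R).
    exact: (is_derive_translate (smooth_on_derivable sf (U1 t t01))).
  exact: (derivableP (smooth_on_derivable sf (U0 t t01))).
have [|t t01 E] := @MVT_line R V ((fun z => f (z + s *: v)) - f) x (s *: u).
  by move=> t t01; have [] := dF t t01.
have [|t' t'01 E'] := @MVT_line R V ('D_u f) (x + t *: (s *: u)) (s *: v).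
  move=> t' t'01.
  exact: smooth_on_derivable (smooth_on_derive u sf) (xU t t' t01 t'01).
exists t, t'; split=> //.
have [_ dE] := dF t t01; rewrite dE in E.
have sc y w g : smooth_on U g -> U y -> 'D_(s *: w) g y = s * 'D_w g y.
  by move=> sg Uy; have [_ ->] := is_derive_scale s (smooth_on_derivable (v := w) sg Uy).
rewrite (sc _ u f sf (U1 t t01)) (sc _ u f sf (U0 t t01)) -mulrBr E' in E.
rewrite (sc _ v _ (smooth_on_derive u sf) (xU t t' t01 t'01)) in E.
rewrite expr2 -mulrA -E -![(_ - _ : _ -> _) _]/(_ - _) /=.
by move: (f _) (f _) (f _) (f _) => a1 a2 a3 a4; ring.
Qed.

(** Both mean value formulas concern one and the same second difference, so [A] at one point equals
    [B] at another, both arbitrarily close to [x]; continuity does the rest. *)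
Lemma second_difference_symmetric U f x u v (A B : V -> R) : open U -> U x ->
  {for x, continuous A} -> {for x, continuous B} ->
  (forall s : R, (forall t t' : R, 0 <= t <= 1 -> 0 <= t' <= 1 ->
       U (x + t *: (s *: v) + t' *: (s *: u))) ->
    exists t t' : R, [/\ 0 <= t <= 1, 0 <= t' <= 1 &
      f (x + s *: v + s *: u) - f (x + s *: v) - f (x + s *: u) + f x =
      s ^+ 2 * A (x + t *: (s *: v) + t' *: (s *: u))]) ->
  (forall s : R, (forall t t' : R, 0 <= t <= 1 -> 0 <= t' <= 1 ->
       U (x + t *: (s *: u) + t' *: (s *: v))) ->
    exists t t' : R, [/\ 0 <= t <= 1, 0 <= t' <= 1 &
      f (x + s *: u + s *: v) - f (x + s *: u) - f (x + s *: v) + f x =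
      s ^+ 2 * B (x + t *: (s *: u) + t' *: (s *: v))]) ->
  A x = B x.
Proof.
move=> oU Ux cA cB dA dB.
apply/eqP; rewrite -subr_eq0 -normr_le0.
apply/ler_addgt0Pr => e e0; rewrite add0r; have e20 : 0 < e / 2 by rewrite divr_gt0.
have /nbhs_ballP[r /= r0 rball] : \forall y \near x,
    [/\ U y, `|A x - A y| < e / 2 & `|B x - B y| < e / 2].
  have nU : \forall y \near x, U y by move: oU; rewrite openE; exact.
  have /cvgrPdist_lt/(_ _ e20) nA := cA.
  have /cvgrPdist_lt/(_ _ e20) nB := cB.
  by apply: filterS3 nU nA nB => y Uy Ay By; split.
have N0 : 0 < `|u| + `|v| + 1 by rewrite ltr_wpDl // addr_ge0.
(* Small enough for the parallelogram with sides [s *: u] and [s *: v] to stay in the ball; the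
   summand 1 covers [u = v = 0]. *)
pose s := r / (`|u| + `|v| + 1).
have s0 : 0 < s by rewrite divr_gt0.
have sE : s * (`|u| + `|v| + 1) = r by rewrite divfK // gt_eqF.
clearbody s; have inball (t t' : R) w w' : `|w| + `|w'| = `|u| + `|v| ->
    0 <= t <= 1 -> 0 <= t' <= 1 ->
    ball x r (x + t *: (s *: w) + t' *: (s *: w')).
  move=> ww /andP[t0 t1] /andP[t'0 t'1]; rewrite -ball_normE /= -addrA opprD addrA.
  rewrite subrr add0r normrN; apply: le_lt_trans (ler_normD _ _) _.
  rewrite !normrZ (ger0_norm t0) (ger0_norm t'0) (gtr0_norm s0).
  have le1 : t * (s * `|w|) <= s * `|w| by rewrite ler_piMl // mulr_ge0 // ltW.
  have le2 : t' * (s * `|w'|) <= s * `|w'| by rewrite ler_piMl // mulr_ge0 // ltW.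
  apply: le_lt_trans (lerD le1 le2) _; rewrite -mulrDr ww.
  by rewrite -sE ltr_pM2l // ltrDl.
have [|t [t' [t01 t'01 E]]] := dB s.
  by move=> t t' t01 t'01; have [] := rball _ (inball t t' u v erefl t01 t'01).
have [|q [q' [q01 q'01 E']]] := dA s.
  move=> t1 t1' t01' t'01'.
  by have [] := rball _ (inball t1 t1' v u (addrC _ _) t01' t'01').
have [_ _ B1] := rball _ (inball t t' u v erefl t01 t'01).
have [_ A1 _] := rball _ (inball q q' v u (addrC _ _) q01 q'01).
have s20 : s ^+ 2 != 0 by rewrite expf_neq0 // gt_eqF.
have EE : B (x + t *: (s *: u) + t' *: (s *: v)) =
          A (x + q *: (s *: v) + q' *: (s *: u)).
  apply: (mulfI s20); rewrite -E -E' [x + s *: v + s *: u]addrAC.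
  by move: (f _) (f _) (f _) (f _) => a1 a2 a3 a4; ring.
rewrite EE in B1; move: A1 B1.
move: (A x) (B x) (A _) => a1 a2 a3.
by rewrite !ltr_norml ler_norml; lra.
Qed.

Lemma smooth_on_schwarz U f x u v : open U -> smooth_on U f -> U x ->
  'D_u ('D_v f) x = 'D_v ('D_u f) x.
Proof.
move=> oU sf Ux.
exact: (@second_difference_symmetric U f x u v _ _ oU Ux
  (smooth_on_continuous (smooth_on_derive u (smooth_on_derive v sf)) Ux)
  (smooth_on_continuous (smooth_on_derive v (smooth_on_derive u sf)) Ux)
  (fun s => @second_difference U f x v u s sf)
  (fun s => @second_difference U f x u v s sf)).
Qed.

End MatrixCalculus.

(** * Differential forms *)

Section ExteriorDerivative.
Variables (R : realType) (a b : nat).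
Notation V := 'M[R]_(a, b).

Definition extd p (w : V -> ('I_p -> V) -> R) (y : V) (v : 'I_p.+1 -> V) : R :=
  \sum_(i < p.+1) (-1) ^+ i * 'D_(v i) (fun y' => w y' (v \o lift i)) y.

Definition smooth_form p (U : set V) (w : V -> ('I_p -> V) -> R) : Prop :=
  forall v, smooth_on U (fun y => w y v).

(** Two arguments can be omitted in either order; with opposite signs, by [lift_swap_sign], this is
    the cancellation behind d d = 0. *)
Lemma lift_swap n (i i' : 'I_n.+2) (ii' : i != i') (j j' : 'I_n.+1) :
  lift i j = i' -> lift i' j' = i -> lift i \o lift j = lift i' \o lift j'.
Proof.
move=> ji' j'i; apply/funext => t /=; apply/val_inj => /=.
have := congr1 val ji'; have := congr1 val j'i; move: ii'.
rewrite -(inj_eq val_inj) /= /bump.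
move: (val i) (val i') (val j) (val j') (val t).
by move=> {ji' j'i}; lia.
Qed.

Lemma lift_swap_sign n (i i' : 'I_n.+2) (ii' : i != i') (j j' : 'I_n.+1) :
  lift i j = i' -> lift i' j' = i ->
  (-1) ^+ i * (-1) ^+ j = - ((-1) ^+ i' * (-1) ^+ j') :> R.
Proof.
move=> ji' j'i.
have := congr1 val ji'; have := congr1 val j'i; move: ii'.
rewrite -(inj_eq val_inj) /= /bump => ii' e1 e2.
rewrite -!exprD -[RHS]mulN1r -exprS -signr_odd -[RHS]signr_odd.
congr (_ ^+ nat_of_bool _).
move: (val i) (val i') (val j) (val j') ii' e1 e2.
by move=> {ji' j'i}; lia.
Qed.

Lemma extd_extd p (U : set V) (w : V -> ('I_p -> V) -> R) y v :
  open U -> smooth_form U w -> U y -> extd (extd w) y v = 0.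
Proof.
move=> oU sw Uy; rewrite /extd.
(* The term that omits [i] first and [i'] second, indexed by the omitted pair itself and zero on the
   diagonal. It is antisymmetric by Schwarz, so the total equals its own negative. *)
pose T (i i' : 'I_p.+2) : R := if unlift i i' is Some j then
  (-1) ^+ i * (-1) ^+ j * 'D_(v i) ('D_(v i')
     (fun y => w y (v \o lift i \o lift j))) y else 0.
have E (i : 'I_p.+2) : (-1) ^+ i * 'D_(v i) (fun y' : V => \sum_(j < p.+1) (-1) ^+ j *
     'D_((v \o lift i) j) (fun z => w z (v \o lift i \o lift j)) y') y =
   \sum_(i' < p.+2) T i i'.
  have dD j : derivable ('D_((v \o lift i) j)
      (fun z => w z (v \o lift i \o lift j))) y (v i).
    exact: (smooth_on_derivable (smooth_on_derive _ (sw _)) Uy).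
  rewrite (_ : (fun y' => _) = \sum_(j < p.+1) (fun y' : V => (-1) ^+ j *:
     'D_((v \o lift i) j) (fun z => w z (v \o lift i \o lift j)) y')); last first.
    by apply/funext => z; rewrite fct_sumE.
  rewrite derive_sum => [|j]; last exact: derivableZ.
  rewrite mulr_sumr [RHS](bigD1 i) //= {1}/T unlift_none add0r.
  rewrite (reindex_onto (lift i) (fun i' => odflt ord0 (unlift i i'))) /=.
    apply: eq_big => [j|j _]; first by rewrite liftK eqxx eq_sym neq_lift.
    by rewrite /T liftK deriveZ // -mulrA.
  by move=> i'; case: unliftP => [j -> //|->]; rewrite eqxx.
under eq_bigr => i _ do rewrite E.
have Tanti i i' : T i i' = - T i' i.
  have [->|ne] := eqVneq i i'; first by rewrite /T unlift_none oppr0.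
  rewrite /T; have [j ji' ->] := unlift_some ne.
  have ne' : i' != i by rewrite eq_sym.
  have [j' j'i ->] := unlift_some ne'.
  rewrite (lift_swap_sign ne (esym ji') (esym j'i)) !mulNr.
  have -> : (v \o lift i) \o lift j = (v \o lift i') \o lift j'.
    rewrite -[LHS]/(v \o (lift i \o lift j)).
    by rewrite (lift_swap ne (esym ji') (esym j'i)).
  by rewrite (smooth_on_schwarz (v i) (v i') oU (sw _) Uy).
have : \sum_i \sum_i' T i i' = - \sum_i \sum_i' T i i'.
  rewrite {1}exchange_big /= -sumrN; apply: eq_bigr => i _.
  by rewrite -sumrN; apply: eq_bigr => i' _.
by move/eqP; rewrite -addr_eq0 -mulr2n mulrn_eq0 => /eqP.
Qed.

(** The form df_0 ^ ... ^ df_(p-1). *)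
Definition dwedge p (f : 'I_p -> V -> R) (y : V) (v : 'I_p -> V) : R :=
  \det (\matrix_(i < p, j < p) 'D_(v j) (f i) y).

Lemma smooth_dwedge p (U : set V) (f : 'I_p -> V -> R) : open U ->
  (forall i, smooth_on U (f i)) -> smooth_form U (dwedge f).
Proof.
move=> oU sf v; rewrite /dwedge /determinant.
have H i j : smooth_on U
    (fun x => (\matrix_(i0 < p, j0 < p) 'D_(v j0) (f i0) x) i j).
  apply: (@smooth_on_ext _ _ _ U ('D_(v j) (f i))) => // [x _|].
    by rewrite mxE.
  exact: smooth_on_derive.
apply: smooth_on_sum => // s; apply: smooth_on_mul => //.
  exact: smooth_on_cst.
by apply: smooth_on_prod => // i; exact: H.
Qed.

Lemma dwedge_recl p (f : 'I_p.+1 -> V -> R) y v :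
  dwedge f y v = \sum_(j < p.+1) (-1) ^+ j * ('D_(v j) (f ord0) y *
    dwedge (f \o lift ord0) y (v \o lift j)).
Proof.
rewrite /dwedge (expand_det_row _ ord0); apply: eq_bigr => j _.
rewrite mxE /cofactor add0n mulrCA; congr (_ * (_ * \det _)).
by apply/matrixP => i i'; rewrite !mxE.
Qed.

(** Expansion along the first row gives df_0 ^ eta = d(f_0 eta) - f_0 d eta, where d eta vanishes by
    induction; what is left is d d = 0. *)
Lemma extd_dwedge p (U : set V) (f : 'I_p -> V -> R) y v : open U ->
  (forall i, smooth_on U (f i)) -> U y -> extd (dwedge f) y v = 0.
Proof.
move=> oU; elim: p f y v => [|p IH] f y v sf Uy.
  rewrite /extd big_ord1 expr0 mul1r.
  rewrite (_ : (fun _ => _) = cst 1) ?derive_cst //.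
  by apply/funext => z; rewrite /dwedge det_mx00.
have sg i : smooth_on U ((f \o lift ord0) i) by exact: sf.
pose w z u := f ord0 z * dwedge (f \o lift ord0) z u.
have sw : smooth_form U w.
  by move=> u; apply: smooth_on_mul => //; exact: smooth_dwedge.
have E z u : U z -> dwedge f z u = extd w z u.
  move=> Uz; rewrite dwedge_recl /extd.
  have E0 := IH _ z u sg Uz.
  transitivity (\sum_(j < p.+1) ((-1) ^+ j * ('D_(u j) (f ord0) z *
      dwedge (f \o lift ord0) z (u \o lift j)) + f ord0 z * ((-1) ^+ j *
      'D_(u j) (fun y => dwedge (f \o lift ord0) y (u \o lift j)) z))).
    rewrite big_split /= -mulr_sumr -[X in _ + _ * X]/(extd _ z u) E0.
    by rewrite mulr0 addr0.
  apply: eq_bigr => j _.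
  rewrite -[X in _ = _ * X]/('D_(u j)
    (f ord0 * (fun y => dwedge (f \o lift ord0) y (u \o lift j))) z).
  rewrite deriveM; last 2 first.
  - exact: smooth_on_derivable (sf ord0) Uz.
  - exact: smooth_on_derivable (smooth_dwedge oU sg (u \o lift j)) Uz.
  rewrite -[_ *: 'D_(u j) (fun _ => _) z]/(_ * _) -[_ *: 'D_(u j) (f _) z]/(_ * _).
  by move: ('D_(_) _ _) ('D_(_) _ _) (dwedge _ _ _) => a1 a2 a3; ring.
rewrite -[RHS](extd_extd v oU sw Uy) /extd; apply: eq_bigr => i _.
congr (_ * _); apply: near_eq_derive.
have nU : nbhs y U by move: oU; rewrite openE; exact.
by apply: filterS nU => z Uz; rewrite E.
Qed.

Lemma alternating_dwedge p (f : 'I_p -> V -> R) y :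
  (forall i, differentiable (f i) y) -> alternating_form (dwedge f y).
Proof.
move=> df; split=> [v i e x z|v i j ij vij].
  rewrite /dwedge -det_tr -[X in _ = _ * X + _]det_tr.
  rewrite -[X in _ = _ + X]det_tr.
  rewrite -[X in _ = _ + X]mul1r; apply: (determinant_multilinear (i0 := i)).
  - apply/rowP => j; rewrite !mxE /= eqxx !deriveE // linearP.
    by rewrite mul1r.
  - apply/matrixP => j j'; rewrite !mxE /= eq_sym.
    by rewrite (negPf (neq_lift _ _)).
  - apply/matrixP => j j'; rewrite !mxE /= eq_sym.
    by rewrite (negPf (neq_lift _ _)).
rewrite /dwedge -det_tr; apply: (determinant_alternate ij) => l.
by rewrite !mxE vij.
Qed.

Lemma alternating_form_sum p (I : Type) (r : seq I) (c : I -> R)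
    (w : I -> ('I_p -> V) -> R) :
  (forall i, alternating_form (w i)) ->
  alternating_form (fun v => \sum_(i <- r) c i * w i v).
Proof.
move=> aw; split=> [v i e x z|v i j ij vij].
  rewrite mulr_sumr -big_split /=; apply: eq_bigr => l _.
  by have [-> _] := aw l; ring.
by rewrite big1 // => l _; have [_ /(_ v i j ij vij) ->] := aw l; rewrite mulr0.
Qed.

End ExteriorDerivative.

Section LocalForms.
Variables (R : realType) (a b : nat) (X : topologicalType).
Notation V := 'M[R]_(a, b).
Variable A : set (chart X V).
Hypothesis manA : smooth_manifold A.

Definition chart_image (c : chart X V) (U : set X) : set V :=
  [set y | cimg c y /\ U (cbwd c y)].

Lemma open_chart_image (c : chart X V) (U : set X) :
  top_chart c -> open U -> open (chart_image c U).
Proof.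
move=> [odom oimg _ _ cb] oU; rewrite openE => y [yc Uy].
rewrite /interior; apply: filterI; first by move: oimg; rewrite openE; exact.
by apply: (cb y yc); move: oU; rewrite openE; exact.
Qed.

Lemma cbwdK (c : chart X V) y : top_chart c -> cimg c y ->
  cdom c (cbwd c y) /\ cfwd c (cbwd c y) = y.
Proof. by move=> [_ _ K _ _] [x xc <-]; rewrite K. Qed.

Lemma open_overlap (c c' : chart X V) : top_chart c -> top_chart c' ->
  open (overlap c c').
Proof.
move=> tc tc'; rewrite (_ : overlap c c' = chart_image c (cdom c')).
  by apply: open_chart_image => //; case: tc'.
apply/seteqP; split=> y.
  by case=> x [xc xc'] <-; split; [exists x|case: tc => _ _ -> //].
by case=> yc yc'; have [d e] := cbwdK tc yc; exists (cbwd c y).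
Qed.

Definition smooth_fun (U : set X) (f : X -> R) : Prop :=
  forall c, A c -> smooth_on (chart_image c U) (f \o cbwd c).

Lemma smooth_fun_transition U f c c' y v : open U -> smooth_fun U f ->
  A c -> A c' -> overlap c c' y -> U (cbwd c y) ->
  'D_v (f \o cbwd c) y =
  'D_('D_v (transition c c') y) (f \o cbwd c') (transition c c' y).
Proof.
move=> oU sf Ac Ac' yo Uy; case: manA => _ _ tA _ sA.
have tc := tA _ Ac; have tc' := tA _ Ac'.
have oO := open_overlap tc tc'.
have K z : overlap c c' z ->
    cbwd c' (transition c c' z) = cbwd c z /\ cimg c' (transition c c' z).
  case=> x [xc xc'] <-; rewrite /transition /=.
  case: tc => _ _ -> // _ _; case: tc' => _ _ K' _ _; rewrite K' //.
  by split=> //; exists x.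
have -> : 'D_v (f \o cbwd c) y =
    'D_v ((f \o cbwd c') \o transition c c') y.
  apply: near_eq_derive.
  have nO : nbhs y (overlap c c') by move: oO; rewrite openE; exact.
  by apply: filterS nO => z /K[E _]; rewrite /= E.
have [Ky iy] := K y yo.
have dT := smooth_on_derivable (v := v) (sA _ _ Ac Ac') yo.
have df : differentiable (f \o cbwd c') (transition c c' y).
  apply: (smooth_on_differentiable (open_chart_image tc' oU) (sf _ Ac')).
  by split=> //; rewrite Ky.
by have [_ ->] := is_derive_chain dT df; rewrite (deriveE _ df).
Qed.

(** The functions [f i l] live on [X], so a change of chart is the chain rule in each entry of the
    determinants; the coefficients are constants, so every term is closed. *)
Definition locally_exact p (omega : form_field R X V p) : Prop :=
  forall x, exists U (I : Type) (r : seq I) (e : I -> R)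
      (f : I -> 'I_p -> X -> R),
    [/\ open U, U x, forall i l, smooth_fun U (f i l) &
        forall c y v, A c -> cimg c y -> U (cbwd c y) ->
          omega c y v =
          \sum_(i <- r) e i * dwedge (fun l => f i l \o cbwd c) y v].

Lemma locally_exact_closed p (omega : form_field R X V p) :
  locally_exact omega -> differential_form A omega /\ closed_form A omega.
Proof.
move=> ex; have [_ _ tA _ sA] := manA.
split; last first.
  move=> c y v Ac yc.
  have [U [I [r [e [f [oU Uy sf E]]]]]] := ex (cbwd c y).
  have tc := tA _ Ac; have oN := open_chart_image tc oU.
  have nN : nbhs y (chart_image c U) by move: oN; rewrite openE; apply.
  have sd i u : smooth_on (chart_image c U)
      (fun y => dwedge (fun l => f i l \o cbwd c) y u).
    by apply: smooth_dwedge => // l; exact: sf.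
  rewrite /ext_der.
  transitivity (\sum_(j < p.+1) \sum_(i <- r) e i * ((-1) ^+ j *
    'D_(v j) (fun y' => dwedge (fun l => f i l \o cbwd c) y' (v \o lift j)) y)).
    apply: eq_bigr => j _.
    rewrite (near_eq_derive (g := fun y' => \sum_(i <- r) e i *
      dwedge (fun l => f i l \o cbwd c) y' (v \o lift j))); last first.
      by apply: filterS nN => z [zc Uz]; rewrite E.
    elim: (r) => [|i s IH].
      rewrite big_nil (_ : (fun _ => _) = cst 0) ?derive_cst ?mulr0 //.
      by apply/funext => z; rewrite big_nil.
    rewrite big_cons -IH (_ : (fun _ => _) =
      (e i *: (fun y' => dwedge (fun l => f i l \o cbwd c) y' (v \o lift j))) +
      (fun y' => \sum_(i <- s) e i *
         dwedge (fun l => f i l \o cbwd c) y' (v \o lift j))); last first.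
      by apply/funext => z; rewrite big_cons.
    rewrite deriveD; last 2 first.
    - by apply: derivableZ; exact: smooth_on_derivable (sd _ _) _.
    - have : smooth_on (chart_image c U) (fun y' => \sum_(i <- s) e i *
         dwedge (fun l => f i l \o cbwd c) y' (v \o lift j)).
        apply: smooth_on_sum => // l; apply: smooth_on_mul => //.
        exact: smooth_on_cst.
      by move/smooth_on_derivable; apply.
    rewrite deriveZ; last exact: smooth_on_derivable (sd _ _) _.
    rewrite mulrDr; congr (_ + _); rewrite -[e i *: _]/(e i * _).
    by rewrite mulrCA.
  rewrite exchange_big big1 //= => i _.
  rewrite -mulr_sumr -[X in _ * X]/(extd (dwedge (fun l => f i l \o cbwd c)) y v).
  by rewrite (extd_dwedge v oN) ?mulr0 // => l; exact: sf.
split.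
- move=> c y Ac yc.
  have [U [I [r [e [f [oU Uy sf E]]]]]] := ex (cbwd c y).
  rewrite (_ : omega c y = fun v =>
    \sum_(i <- r) e i * dwedge (fun l => f i l \o cbwd c) y v); last first.
    by apply/funext => v; rewrite E.
  apply: alternating_form_sum => i; apply: alternating_dwedge => l.
  by apply: (smooth_on_differentiable (open_chart_image (tA _ Ac) oU) (sf i l c Ac)).
- move=> c v Ac; apply: smooth_on_local => y yc.
  have [U [I [r [e [f [oU Uy sf E]]]]]] := ex (cbwd c y).
  have oN := open_chart_image (tA _ Ac) oU.
  exists (chart_image c U) => //.
  apply: (@smooth_on_ext _ _ _ _ (fun y => \sum_(i <- r) e i *
    dwedge (fun l => f i l \o cbwd c) y v)) => //.
    by move=> z [zc Uz]; rewrite E.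
  apply: smooth_on_sum => // i; apply: smooth_on_mul => //.
    exact: smooth_on_cst.
  by apply: smooth_dwedge => // l; exact: sf.
- move=> c c' y v Ac Ac' yo.
  have [U [I [r [e [f [oU Uy sf E]]]]]] := ex (cbwd c y).
  have [x [xc xc'] xy] := yo.
  have tc := tA _ Ac; have tc' := tA _ Ac'.
  have yc : cimg c y by exists x.
  have Kc : cbwd c y = x by rewrite -xy; case: tc => _ _ ->.
  have Ty : transition c c' y = cfwd c' x by rewrite /transition /= Kc.
  have Kc' : cbwd c' (transition c c' y) = x.
    by rewrite Ty; case: tc' => _ _ ->.
  rewrite E // [RHS]E //; last by rewrite Kc' -Kc.
    apply: eq_bigr => i _; congr (_ * \det _); apply/matrixP => l j.
    by rewrite !mxE (smooth_fun_transition _ oU (sf i l) Ac Ac' yo Uy).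
  by exists x.
Qed.

End LocalForms.

(** * Compact cubes and bump functions *)

Section Compactness.
Variable R : realType.

Lemma continuous_mx (V : normedModType R) a b (F : V -> 'M[R]_(a, b)) :
  (forall i j, continuous (fun x => F x i j)) -> continuous F.
Proof.
move=> cF x; apply: (Ck_mx F 0 openT).2 => // i j y _; exact: cF.
Qed.

Lemma bounded_closed_compact_mx a b (K : set 'M[R]_(a, b)) :
  bounded_set K -> closed K -> compact K.
Proof.
move=> bK cK.
have cv : continuous (@vec_mx R a b).
  apply: continuous_mx => i j.
  rewrite (_ : (fun _ => _) = fun v : 'rV[R]_(a * b) => v 0 (mxvec_index i j)).
    exact: coord_continuous.
  by apply/funext => v; rewrite mxE.
have -> : K = vec_mx @` (vec_mx @^-1` K).
  apply/seteqP; split=> [x Kx|x [v Kv <-] //].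
  by exists (mxvec x); rewrite /= mxvecK.
apply: continuous_compact; first exact: continuous_subspaceT.
apply: bounded_closed_compact; last by apply: closed_comp => // v _; exact: cv.
case: bK => M [Mr MK]; exists M; split=> // e Me v Kv.
apply: mx_norm_le => [|i j].
  by apply: le_trans (MK _ Me _ Kv).
rewrite (ord1 i) -(vec_mxK v); case/mxvec_indexP: j => i' j'.
by rewrite mxvecE; apply: le_trans (mx_norm_ge _ _ _) (MK _ Me _ Kv).
Qed.

Lemma compact_cube a b (y0 : 'M[R]_(a, b)) (r : R) :
  compact [set y | `|y - y0| <= r].
Proof.
apply: bounded_closed_compact_mx.
  exists (`|y0| + r); split=> [|e re y /= yr]; first exact: num_real.
  apply: le_trans (ltW re); rewrite -(subrK y0 y) addrC.
  by apply: le_trans (ler_normD _ _) _; rewrite lerD2l.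
rewrite (_ : [set _ | _] = (fun y => `|y - y0|) @^-1` [set t | t <= r]) //.
apply: closed_comp; last exact: closed_le.
move=> y _; apply: continuous_comp; last exact: norm_continuous.
by apply: continuousB; [exact: cvg_id|exact: cst_continuous].
Qed.

(** Derivatives are bounded on the compact cube, and the segment between two of its points stays
    inside by convexity. *)
Lemma lipschitz_on_cube a b (U : set 'M[R]_(a, b)) (g : 'M[R]_(a, b) -> R)
    (y0 : 'M[R]_(a, b)) (r : R) :
  open U -> smooth_on U g -> 0 < r -> [set y | `|y - y0| <= r] `<=` U ->
  exists L : R, [/\ 0 <= L, forall y, `|y - y0| <= r -> `|g y| <= L &
    forall y y', `|y - y0| <= r -> `|y' - y0| <= r ->
      `|g y - g y'| <= L * `|y - y'|].
Proof.
move=> oU sg r0 QU; pose Q := [set y : 'M[R]_(a, b) | `|y - y0| <= r].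
have bound (h : 'M[R]_(a, b) -> R) : smooth_on U h ->
    exists2 L : R, 0 <= L & forall y, Q y -> `|h y| <= L.
  move=> sh; have Q0 : Q !=set0 by exists y0; rewrite /Q /= subrr normr0 ltW.
  have [|y Qy ymax] := @compact_EVT_max _ R (fun y => `|h y|) Q Q0
      (compact_cube (y0 := y0) (r := r)).
    apply: continuous_in_subspaceT => y /set_mem Qy.
    apply: continuous_comp; last exact: norm_continuous.
    exact: smooth_on_continuous sh (QU y Qy).
  exists `|h y| => // z Qz; apply: ymax; exact/mem_set.
have [L0 L00 L0P] := bound g sg.
have /choice[Ld LdP] (ij : 'I_a * 'I_b) : exists L : R, 0 <= L /\
    forall y, Q y -> `|'D_(delta_mx ij.1 ij.2) g y| <= L.
  by have [L ? ?] := bound _ (smooth_on_derive (delta_mx ij.1 ij.2) sg); exists L.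
have Ld0 : 0 <= \sum_ij Ld ij by apply: sumr_ge0 => ij _; case: (LdP ij).
exists (L0 + \sum_ij Ld ij); split.
- exact: addr_ge0.
- by move=> y Qy; apply: le_trans (L0P y Qy) _; rewrite lerDl.
move=> y y' Qy Qy'.
have Qt (t : R) : 0 <= t <= 1 -> Q (y' + t *: (y - y')).
  case/andP=> t0 t1; rewrite /Q /=.
  have -> : y' + t *: (y - y') - y0 = (1 - t) *: (y' - y0) + t *: (y - y0).
    by apply/matrixP => i j; rewrite !mxE; ring.
  apply: le_trans (ler_normD _ _) _; rewrite !normrZ (ger0_norm t0) ger0_norm ?subr_ge0 //.
  have : (1 - t) * `|y' - y0| <= (1 - t) * r by rewrite ler_wpM2l // subr_ge0.
  have : t * `|y - y0| <= t * r by rewrite ler_wpM2l.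
  lra.
have [|t t01] := @MVT_line R _ g y' (y - y').
  move=> t t01; exact: smooth_on_derivable sg (QU _ (Qt t t01)).
rewrite [y' + _]addrC subrK => ->.
have dg := smooth_on_differentiable oU sg (QU _ (Qt t t01)).
rewrite deriveE // diff_mx_sum //; apply: le_trans (ler_norm_sum _ _ _) _.
rewrite mulrDl; apply: le_trans (lerD (mulr_ge0 L00 (normr_ge0 _)) (lexx _)).
rewrite add0r mulr_suml; apply: ler_sum => ij _; rewrite normrM mulrC.
by apply: ler_pM => //; [case: (LdP ij) => _; apply; exact: Qt|exact: mx_norm_ge].
Qed.

End Compactness.

Section Bump.
Variable R : realType.

Lemma is_derive_dir (f : R -> R) (x v d : R) :
  is_derive x (1 : R) f d -> is_derive x v f (v * d).
Proof.
move=> [df <-]; have := is_derive_scale v df.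
by rewrite -[v *: (1 : R)]/(v * 1) mulr1.
Qed.

Lemma smooth_on_powR (e : R) : smooth_on [set t : R | 0 < t] (@powR R ^~ e).
Proof.
have oU : open [set t : R | 0 < t] by exact: open_gt.
pose F := [set f : R -> R | exists c e, f = fun t => c * t `^ e].
have dF c e' v (x : R) : 0 < x ->
    is_derive x v (fun t : R => c * t `^ e') (v * c * e' * x `^ (e' - 1)).
  move=> x0; rewrite -!mulrA; apply: is_derive_dir.
  exact: is_deriveZ (is_derive1_powR e' x0).
apply: (smooth_on_family oU (F := F)); last first.
- by exists 1, e; apply/funext => t; rewrite mul1r.
- move=> _ v [c [e' ->]]; exists (fun t => v * c * e' * t `^ (e' - 1)).
    by exists (v * c * e'), (e' - 1).
  by move=> x x0; exact: dF.
- move=> _ [c [e' ->]] x x0; apply: differentiable_continuous.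
  by apply/derivable1_diffP; case: (dF c e' 1 x x0).
Qed.

Lemma smooth_on_inv : smooth_on [set t : R | 0 < t] (@GRing.inv R).
Proof.
apply: smooth_on_ext (smooth_on_powR (-1)); first exact: open_gt.
by move=> t t0; rewrite powR_inv1 // ltW.
Qed.

(** p(1/t) exp(-1/t) for t > 0. The polynomial makes the family stable under derivation, which turns
    [p] into (p - p') X^2. *)
Definition flat (p : {poly R}) (t : R) : R :=
  if 0 < t then p.[t^-1] * expR (- t^-1) else 0.

Lemma horner_growth (p : {poly R}) :
  exists C n, 0 <= C /\ forall s : R, 1 <= s -> `|p.[s]| <= C * s ^+ n.
Proof.
elim/poly_ind: p => [|p c [C [n [C0 IH]]]].
  by exists 0, 0%N; split=> // s _; rewrite horner0 normr0 mul0r.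
exists (C + `|c|), n.+1; split=> [|s s1]; first exact: addr_ge0.
rewrite hornerMXaddC mulrDl; apply: le_trans (ler_normD _ _) _; apply: lerD.
  have s0 : 0 <= s by apply: le_trans s1.
  by rewrite normrM (ger0_norm s0) exprSr mulrA ler_wpM2r // IH.
by rewrite ler_peMr // exprn_ege1.
Qed.

(** Since exp(s) >= s^(n+2) / (n+2)!, the exponential beats the growth s^n of [p] with two powers to
    spare. The quadratic bound makes the difference quotient at 0 tend to 0. *)
Lemma flat_bound (p : {poly R}) :
  exists2 C, 0 <= C & forall t : R, 0 < t -> t <= 1 -> `|flat p t| <= C * t ^+ 2.
Proof.
have [C [n [C0 pC]]] := horner_growth p.
exists (C * n.+2`!%:R); first by rewrite mulr_ge0.
move=> t t0 t1; rewrite /flat t0 normrM (ger0_norm (expR_ge0 _)) expRN.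
have s1 : 1 <= t^-1 by rewrite invf_ge1.
have s0 : 0 < t^-1 by rewrite invr_gt0.
have e0 := expR_gt0 t^-1.
rewrite ler_pdivrMr //; apply: le_trans (pC _ s1) _.
have -> : C * n.+2`!%:R * t ^+ 2 * expR t^-1 =
    C * (t ^+ 2 * (expR t^-1 * n.+2`!%:R)).
  by move: (n.+2`!%:R : R) (expR _) => f e; ring.
rewrite ler_wpM2l //.
have : (t^-1) ^+ n.+2 / n.+2`!%:R <= expR t^-1.
  by apply: le_trans (expR_ge1Dxn n.+1 (ltW s0)); rewrite lerDr.
have f0 : 0 < n.+2`!%:R :> R by rewrite ltr0n fact_gt0.
rewrite ler_pdivrMr // => H.
have t2 : 0 <= t ^+ 2 by rewrite exprn_ge0 // ltW.
have H2 := ler_wpM2l t2 H. apply: le_trans H2.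
rewrite -(addn2 n) exprD mulrCA -exprMn divff ?gt_eqF //.
by rewrite expr1n mulr1.
Qed.

Lemma is_derive_flat p (x : R) : is_derive x (1 : R) (flat p) (flat ((p - p^`()) * 'X^2) x).
Proof.
have [x0|x0|->] := ltgtP x 0.
- rewrite {2}/flat ltNge (ltW x0) /=; have := is_derive_cst (0 : R) x (1 : R).
  apply: near_eq_is_derive; near=> y; rewrite /flat ltNge /cst.
  suff -> : y <= 0 by [].
  by rewrite ltW //; near: y; exact: lt_nbhsl.
- rewrite {2}/flat x0.
  have xn : x != 0 by rewrite gt_eqF.
  have di : is_derive x (1 : R) (@GRing.inv R) (- x ^- 2).
    apply: DeriveDef; first exact: derivableV.
    by rewrite deriveV // derive_id -[LHS]/(_ * 1) mulr1.
  have dp : is_derive x (1 : R) (horner p \o (@GRing.inv R))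
      (- x ^- 2 * p^`().[x^-1]).
    have := @is_derive1_comp R (horner p) (@GRing.inv R) _ _ _ (is_derive_poly p x^-1) di.
    by move/is_derive_eq; apply; rewrite mulrC.
  have de : is_derive x (1 : R) (expR \o (fun t => - t^-1))
      (x ^- 2 * expR (- x^-1)).
    have dn : is_derive x (1 : R) (fun t : R => - t^-1) (x ^- 2).
      by have := is_deriveN di; rewrite opprK.
    have := @is_derive1_comp R expR (fun t => - t^-1) _ _ _ (is_derive_expR (- x^-1)) dn.
    by move/is_derive_eq; apply; rewrite mulrC.
  have := is_deriveM dp de; set D := (X in is_derive _ _ _ X).
  have -> : D = ((p - p^`()) * 'X^2).[x^-1] * expR (- x^-1).
    rewrite /D hornerM hornerXn hornerD hornerN /=.
    rewrite -![_ *: _]/(_ * _) exprVn; move: (p.[_]) (p^`().[_]) => u w; ring.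
  apply: near_eq_is_derive; near=> y; rewrite /flat.
  suff -> : 0 < y by [].
  by near: y; exact: lt_nbhsr.
- have [C C0 pC] := flat_bound p.
  have -> : flat ((p - p^`()) * 'X^2) 0 = 0 by rewrite /flat ltxx.
  have H : (fun h : R => h^-1 *: ((flat p \o shift 0) (h *: (1 : R)) - flat p 0)) @ 0^'
      --> (0 : R).
    apply/cvgr0Pnorm_le => e e0; near=> h.
    have h0 : h != 0 by near: h; exact: nbhs_dnbhs_neq.
    rewrite /= addr0 {2}/flat ltxx subr0 -[h *: (1 : R)]/(h * 1) mulr1.
    have [hp|hn] := ltP 0 h; last first.
      by rewrite /flat ltNge hn /= scaler0 normr0 ltW.
    have h1 : h <= 1.
      rewrite -(gtr0_norm hp); near: h; apply: dnbhs0_le; exact: ltr01.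
    rewrite normrM gtr0_norm ?invr_gt0 // ler_pdivrMl //.
    apply: le_trans (pC h hp h1) _; rewrite expr2 mulrA mulrC ler_pM2l //.
    have : `|h| <= e / (C + 1).
      by near: h; apply: dnbhs0_le; rewrite divr_gt0 // ltr_wpDl.
    rewrite gtr0_norm // ler_pdivlMr ?ltr_wpDl // => hC.
    by apply: le_trans hC; rewrite mulrC ler_wpM2l ?lerDl // ltW.
  by apply: DeriveDef; [apply/cvg_ex; exists 0|exact: (cvg_lim _ H)].
Unshelve. all: by end_near. Qed.

Lemma smooth_on_flat p : smooth_on setT (flat p).
Proof.
pose F := [set f : R -> R | exists p, f = flat p].
apply: (smooth_on_family openT (F := F)); last by exists p.
  move=> _ [q ->] x _; apply: differentiable_continuous.
  by apply/derivable1_diffP; case: (is_derive_flat q x).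
move=> _ v [q ->]; exists (flat (v *: ((q - q^`()) * 'X^2))); first by eexists.
move=> x _; have := is_derive_dir v (is_derive_flat q x).
move: (_ * 'X^2) => P; suff -> : flat (v *: P) x = v * flat P x by [].
by rewrite /flat; case: ifP => _; rewrite ?hornerZ ?mulrA ?mulr0.
Qed.

Lemma flat1_gt0 (t : R) : 0 < t -> 0 < flat 1 t.
Proof. by move=> t0; rewrite /flat t0 hornerC mul1r expR_gt0. Qed.

Lemma flat_le0 p (t : R) : t <= 0 -> flat p t = 0.
Proof. by rewrite /flat ltNge => ->. Qed.

Lemma flat1_ge0 (t : R) : 0 <= flat 1 t.
Proof.
by have [/flat_le0 ->|/flat1_gt0/ltW] := leP t 0.
Qed.

Lemma bump_exists : exists phi : R -> R, [/\ smooth_on setT phi,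
  forall t, `|t| <= 1 -> phi t = 1 & forall t, 2 <= `|t| -> phi t = 0].
Proof.
(* Never zero, as 4 - t^2 and t^2 - 1 cannot both be nonpositive. The first summand divided by [den]
   is 1 where the second vanishes, and 0 where the first does. *)
pose den t : R := flat 1 (4 - t ^+ 2) + flat 1 (t ^+ 2 - 1).
have den0 t : 0 < den t.
  rewrite /den; have [t1|t1] := ltP 1 (t ^+ 2).
    by rewrite ltr_wpDl ?flat1_ge0 // flat1_gt0 // subr_gt0.
  by rewrite ltr_wpDr ?flat1_ge0 // flat1_gt0 // subr_gt0; lra.
have sid : smooth_on [set: R] (fun t : R => t).
  move=> [|k] /=; first by move=> x _; exact: cvg_id.
  split=> [x v _|v]; first exact: derivable_id.
  apply: (Ck_ext openT) (smooth_on_cst v openT k) => x _.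
  by rewrite derive_id.
have s2 := smooth_on_exp 2 openT sid.
have cs c := smooth_on_cst (c : R) (@openT R).
have s4 : smooth_on [set: R] (fun t : R => flat 1 (4 - t ^+ 2)).
  by apply: (smooth_on_comp_real openT (smooth_on_flat 1)) => //; apply: (smooth_on_sub openT) => //; exact: cs.
have s1 : smooth_on [set: R] (fun t : R => flat 1 (t ^+ 2 - 1)).
  by apply: (smooth_on_comp_real openT (smooth_on_flat 1)) => //; apply: (smooth_on_sub openT) => //; exact: cs.
exists (fun t => flat 1 (4 - t ^+ 2) * (den t)^-1); split.
- apply: (smooth_on_mul openT) => //.
  apply: (smooth_on_comp_real openT smooth_on_inv) => [|t _]; last exact: den0.
  exact: (smooth_on_add openT).
- move=> t t1; have := den0 t; rewrite /den.
  rewrite (@flat_le0 _ (t ^+ 2 - 1)) ?addr0 => [H|].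
    by rewrite mulfV // gt_eqF.
  by rewrite subr_le0 -real_normK ?num_real // expr_le1.
- move=> t t2; rewrite (@flat_le0 _ (4 - t ^+ 2)) ?mul0r //.
  rewrite subr_le0 -(real_normK (num_real t)).
  have -> : 4 = 2 ^+ 2 :> R by ring.
  by rewrite lerXn2r // nnegrE.
Qed.

End Bump.

(** * Generic closed forms *)

(* A counting form of Sard's theorem: q-dimensional graphs over a #|D|-dimensional
   cube, depending on the remaining parameters, do not cover the parameter cube
   when #|D| < q.  Both cubes are discretised with step 1/M; over a cell of the
   z-cube a graph meets at most C values of each of the q coordinates. *)
Lemma avoid_graphs (R : realType) (Theta B D : finType) (q : nat)
    (pos : B -> 'I_q -> Theta)
    (Phi : B -> 'I_q -> (Theta -> R) -> (D -> R) -> R) (L : R) :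
  (forall b, injective (pos b)) -> (#|D| < q)%N -> 0 <= L ->
  (forall b l eta eta' z,
     (forall t, (forall l', t != pos b l') -> eta t = eta' t) ->
     Phi b l eta z = Phi b l eta' z) ->
  (forall b l eta z z', (forall t, 0 <= eta t <= 1) ->
     (forall d, 0 <= z d <= 1) -> (forall d, 0 <= z' d <= 1) ->
     forall e, (forall d, `|z d - z' d| <= e) ->
     `|Phi b l eta z - Phi b l eta z'| <= L * e) ->
  exists eta : Theta -> R, (forall t, 0 <= eta t <= 1) /\
    forall b z, (forall d, 0 <= z d <= 1) ->
      exists l, eta (pos b l) != Phi b l eta z.
Proof.
move=> posI Dq L0 Phi_loc Phi_lip; apply/not_existsP => all_bad.
(* An integer within [L] of a given real exceeds the floor of the lower end of that window by less
   than 2L + 1, so C + 1 offsets suffice. *)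
have [C CL] : exists C : nat, 2 * L + 1 < C.+1%:R.
  exists (Num.trunc (2 * L + 1)); apply: truncnS_gt.
(* Grid size. There are M^#|D| cells for each [b], each excluding at most C.+1^q M^(#|Theta| - q)
   grid points; as #|D| < q, this [M] makes the total smaller than M^#|Theta|. *)
pose M := (#|B| * C.+1 ^ q).+1.
have M0 : 0 < M%:R :> R by rewrite ltr0n.
pose g (k : {ffun Theta -> 'I_M}) (t : Theta) : R := (k t)%:R / M%:R.
pose corner (k : {ffun D -> 'I_M}) (d : D) : R := (k d)%:R / M%:R.
have ratio01 (i : 'I_M) : 0 <= (i%:R / M%:R : R) <= 1.
  by rewrite divr_ge0 //= ler_pdivrMr // mul1r ler_nat ltnW.
(* Moving [z] to the corner of its cell changes a graph by at most L / M, hence by [L] after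
   rescaling by [M]. *)
pose bad b zeta := [set k : {ffun Theta -> 'I_M} | [forall l,
  `|(k (pos b l))%:R - M%:R * Phi b l (g k) (corner zeta)| <= L]]%SET.
have cover : [set: {ffun Theta -> 'I_M}]%SET
    \subset (\bigcup_(bz : B * {ffun D -> 'I_M}) bad bz.1 bz.2)%SET.
  apply/fintype.subsetP => k _.
  have /not_andP[] := all_bad (g k); first by move=> []; move=> t; exact: ratio01.
  move/existsNP => [b /existsNP[z /not_implyP[z01 /forallNP zP]]].
  (* The cap at [M.-1] catches [z d = 1], whose own cell would fall outside the grid. *)
  pose zeta : {ffun D -> 'I_M} :=
    [ffun d => inord (minn (Num.trunc (z d * M%:R)) M.-1)].
  have zetaP d : `|z d - corner zeta d| <= M%:R^-1.
    have /andP[zd0 zd1] := z01 d.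
    rewrite /corner ffunE inordK ?ltnS ?geq_minr //.
    have zM0 : 0 <= z d * M%:R by rewrite mulr_ge0 // ltW.
    have /andP[t1 t2] := truncn_itv zM0.
    have zM1 : z d * M%:R <= M%:R by rewrite ler_piMl // ltW.
    set n := minn _ _.
    have -> : z d - n%:R / M%:R = (z d * M%:R - n%:R) / M%:R.
      by rewrite mulrBl mulfK // gt_eqF.
    rewrite normrM (gtr0_norm (x := M%:R^-1)) ?invr_gt0 //.
    apply: ler_piMl; first by rewrite invr_ge0 ltW.
    have ME : M%:R = M.-1%:R + 1 :> R by rewrite natr1.
    rewrite /n; case: leqP => [tM|Mt].
      by rewrite -natr1 in t2; rewrite ler_norml; lra.
    have : M%:R <= (Num.trunc (z d * M%:R))%:R :> R by rewrite ler_nat.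
    by rewrite ler_norml; lra.
  apply/bigcupP; exists (b, zeta) => //; rewrite inE /=; apply/forallP => l.
  have := zP l => /negP; rewrite negbK => /eqP kE.
  have -> : (k (pos b l))%:R = M%:R * g k (pos b l).
    by rewrite /g mulrC divfK // gt_eqF.
  rewrite kE -mulrBr normrM gtr0_norm //.
  rewrite -ler_pdivlMl // mulrC.
  apply: (Phi_lip b l (g k)) => // [t|d]; exact: ratio01.
have bad_card b zeta : (#|bad b zeta| <= C.+1 ^ q * M ^ (#|Theta| - q))%N.
  pose fl k l := Num.floor (M%:R * Phi b l (g k) (corner zeta) - L).
  (* The q coordinates on the graph are stored as bounded offsets, the others verbatim. Decoding
     works because [Phi] ignores the q coordinates that are to be recovered. *)
  pose code (k : {ffun Theta -> 'I_M}) : {ffun 'I_q -> 'I_C.+1} *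
      {ffun Theta -> 'I_M} :=
    ([ffun l => inord `|(k (pos b l))%:Z - fl k l|%N],
     [ffun t => if t \in codom (pos b) then ord0 else k t]).
  pose fam := pffun_on (ord0 : 'I_M) [predC codom (pos b)] (@predT 'I_M).
  have offP k l : k \in bad b zeta ->
      0 <= (k (pos b l))%:Z - fl k l < C.+1%:Z.
    rewrite inE => /forallP/(_ l).
    rewrite ler_norml => /andP[h1 h2].
    have /andP[] := floor_itv (M%:R * Phi b l (g k) (corner zeta) - L).
    rewrite -/(fl k l) => f1 f2; apply/andP; split.
      rewrite subr_ge0 -(ler_int R); apply: le_trans f1 _.
      by rewrite -[_%:~R]/((k (pos b l))%:R : R); lra.
    rewrite ltrBlDr -(ltr_int R) intrD -[_%:~R]/((k (pos b l))%:R : R).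
    rewrite -[C.+1%:Z%:~R]/(C.+1%:R : R); rewrite intrD in f2; lra.
  have codeI : {in bad b zeta &, injective code}.
    move=> k k' kb kb' [/ffunP e1 /ffunP e2].
    have off t : t \notin codom (pos b) -> k t = k' t.
      by move=> tn; have := e2 t; rewrite !ffunE (negPf tn).
    have flE l : fl k l = fl k' l.
      rewrite /fl (Phi_loc b l (g k) (g k')) // => t tn; rewrite /g off //.
      by apply/codomP => -[l' tl']; move: (tn l'); rewrite tl' eqxx.
    apply/ffunP => t; have [/codomP[l ->]|/off //] := boolP (t \in codom (pos b)).
    have := e1 l; rewrite !ffunE flE => /(congr1 (@nat_of_ord _)) E.
    have /andP[p1 p2] := offP k l kb; have /andP[p1' p2'] := offP k' l kb'.
    rewrite flE in p1 p2.
    apply/val_inj => /=; move: p1 p2 p1' p2' E.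
    move: (fl k' l) (k (pos b l)) (k' (pos b l)) => f u u' p1 p2 p1' p2'.
    by rewrite !inordK; lia.
  have famP : {in bad b zeta, forall k, code k \in
      finset.setX [set: {ffun 'I_q -> 'I_C.+1}]%SET [set k' | k' \in fam]%SET}.
    move=> k _; rewrite !inE /=; apply/pffun_onP; split=> [|_ _ //].
    apply/supportP => t; rewrite inE negbK ffunE => ->.
    by [].
  rewrite -(card_in_imset codeI); apply: (@leq_trans #|finset.setX
      [set: {ffun 'I_q -> 'I_C.+1}]%SET [set k' | k' \in fam]%SET|).
    apply: subset_leq_card.
    by apply/fintype.subsetP => _ /imsetP[k kb ->]; exact: famP.
  rewrite cardsX cardsT card_ffun !card_ord leq_mul2l; apply/orP; right.
  rewrite cardsE card_pffun_on card_ord leq_pexp2l //.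
  have := cardC (mem (codom (pos b))); rewrite (card_codom (posI b)) card_ord => <-.
  by rewrite addKn.
have := subset_leq_card cover; rewrite cardsT card_ffun card_ord leqNgt => /negP; apply.
apply: (@leq_ltn_trans (\sum_(bz : B * {ffun D -> 'I_M})
    C.+1 ^ q * M ^ (#|Theta| - q))%N).
  apply: leq_trans (_ : (\sum_(bz : B * {ffun D -> 'I_M}) #|bad bz.1 bz.2| <= _)%N).
    elim/big_ind2: _ => [|x1 x2 y1 y2 h1 h2|bz _ //].
      by rewrite cards0.
    by apply: leq_trans (leq_card_setU _ _) _; exact: leq_add.
  by apply: leq_sum => bz _; exact: bad_card.
have qT (b : B) : (q <= #|Theta|)%N.
  by rewrite -(card_ord q) -(card_codom (posI b)) max_card.
rewrite sum_nat_const card_prod card_ffun card_ord.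
have [->|B0] := posnP #|B|; first by rewrite !mul0n expn_gt0.
have /card_gt0P[b _] := B0.
have -> : (#|B| * M ^ #|D| * (C.+1 ^ q * M ^ (#|Theta| - q)) =
  M.-1 * M ^ (#|D| + (#|Theta| - q)))%N by rewrite expnD /=; ring.
have : (#|D| + (#|Theta| - q) < #|Theta|)%N by have := qT b; lia.
move: (#|D| + _)%N => n nT.
apply: (@leq_trans (M ^ n.+1)%N); last by rewrite leq_pexp2l.
by rewrite expnS ltn_mul2r expn_gt0 /=.
Qed.

Section BumpCoordinates.
Variables (R : realType) (a b : nat) (X : topologicalType).
Notation V := 'M[R]_(a, b).
Notation J := ('I_a * 'I_b)%type.
Variable A : set (chart X V).
Hypothesis manA : smooth_manifold A.

(** Coordinates times a cut-off, extended by 0. Smoothness across the border of the chart holds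
    because the function vanishes off the image of a compact cube, which is closed as [X] is
    Hausdorff. *)
Lemma bump_coordinates (c : chart X V) (y0 : V) (r : R) : A c -> 0 < r ->
  [set y | `|y - y0| <= 2 * r] `<=` cimg c ->
  exists F : J -> X -> R, (forall j, smooth_fun A setT (F j)) /\
    forall y j, `|y - y0| <= r -> F j (cbwd c y) = y j.1 j.2.
Proof.
move=> Ac r0 QU; have [hX _ tA _ sA] := manA.
have tc := tA _ Ac.
have [phi [sphi phi1 phi0]] := bump_exists R.
pose chi (y : V) := \prod_(j : J) phi ((y j.1 j.2 - y0 j.1 j.2) * r^-1).
have schi : smooth_on setT chi.
  apply: (smooth_on_prod _ openT) => j.
  apply: (smooth_on_comp_real openT sphi) => //.
  apply: (smooth_on_mul openT); last exact: (smooth_on_cst _ openT).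
  apply: (smooth_on_sub openT); first exact: (smooth_on_coord _ _ openT).
  exact: (smooth_on_cst _ openT).
have chi1 y : `|y - y0| <= r -> chi y = 1.
  move=> yr; apply: big1 => j _; apply: phi1.
  rewrite normrM [X in _ * X]ger0_norm ?invr_ge0 ?(ltW r0) //.
  rewrite ler_pdivrMr // mul1r; apply: le_trans yr.
  by have := mx_norm_ge (y - y0) j.1 j.2; rewrite !mxE.
have chi0 y : 2 * r < `|y - y0| -> chi y = 0.
  move=> yr; have [|H] := pselect (exists j : J, 2 * r < `|(y - y0) j.1 j.2|).
    case=> j yj; rewrite /chi (bigD1 j) //= phi0 ?mul0r //.
    rewrite normrM [X in _ * X]ger0_norm ?invr_ge0 ?(ltW r0) //.
    by rewrite ler_pdivlMr // ltW //; move: yj; rewrite !mxE.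
  suff : `|y - y0| <= 2 * r by rewrite leNgt yr.
  apply: mx_norm_le => [|i j]; first by rewrite mulr_ge0 // ltW.
  by rewrite leNgt; apply/negP => yj; apply: H; exists (i, j).
pose F (j : J) (x : X) : R :=
  if pselect (cdom c x) then chi (cfwd c x) * cfwd c x j.1 j.2 else 0.
pose K := cbwd c @` [set y | `|y - y0| <= 2 * r].
have cK : closed K.
  apply: compact_closed => //; apply: continuous_compact; last exact: compact_cube.
  apply: continuous_in_subspaceT => y /set_mem /QU yc.
  by case: tc => _ _ _ _; exact.
have F0 j x : ~ K x -> F j x = 0.
  rewrite /F; case: pselect => // xc nK; rewrite chi0 ?mul0r // ltNge.
  apply/negP => le; apply: nK; exists (cfwd c x) => //.
  by case: tc => _ _ ->.
exists F; split=> [j c' Ac'|y j yr]; last first.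
  have yc : cimg c y by apply: QU; rewrite /= (le_trans yr) // ler_peMl ?(ltW r0) // ler1n.
  case: (cbwdK tc yc) => cx cy.
  by rewrite /F; case: pselect => //= ?; rewrite cy chi1 // mul1r.
have tc' := tA _ Ac'; have oO := open_overlap tc' tc.
apply: smooth_on_local => y [yc' _].
have [d e] := cbwdK tc' yc'.
have [dc|ndc] := pselect (cdom c (cbwd c' y)).
  exists (overlap c' c); first by exists (cbwd c' y).
  have : smooth_on (overlap c' c) (fun y => (fun z : V => chi z * z j.1 j.2)
      (transition c' c y)).
    apply: (smooth_on_comp (g := fun z : V => chi z * z j.1 j.2) oO (@openT V)
      _ (sA _ _ Ac' Ac)) => //.
    by apply: (smooth_on_mul openT) => //; exact: (smooth_on_coord _ _ openT).
  apply: smooth_on_ext => // z [x [xc' xc] <-] /=.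
  rewrite /F /transition /=; case: tc' => _ _ -> // _ _.
  by case: pselect => //= ?.
exists (chart_image c' (~` K)).
  split=> //= -[z /= zr zE]; apply: ndc; rewrite -zE.
  by have [] := cbwdK tc (QU _ zr).
have oN : open (chart_image c' (~` K)).
  by apply: open_chart_image => //; rewrite openC.
apply: smooth_on_ext (smooth_on_cst (0 : R) oN) => // z [zc' nK].
by rewrite /= F0.
Qed.

End BumpCoordinates.

Section SelectDeterminant.
Variables (R : realType) (J : finType).

(** The argument list that [interior_product] passes to a 4-form. *)
Definition slots (T : Type) (u : T) (w : 'I_3 -> T) (k : 'I_4) : T :=
  if unlift ord0 k is Some t then w t else u.

Lemma slots0 T (u : T) w : slots u w ord0 = u.
Proof. by rewrite /slots unlift_none. Qed.

Lemma slotsS T (u : T) w t : slots u w (lift ord0 t) = w t.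
Proof. by rewrite /slots liftK. Qed.

(** The default [i] is never reached when [B] has three elements. *)
Definition triple (i : J) (B : {set J}) (t : 'I_3) : J := nth i (enum B) t.

(** The value of dx_i ^ dx_B on (v, e_B'). The first row is (v i, 0, 0, 0) because [i \notin B'],
    and the complementary minor is the identity or, for different triples, has a zero row. *)
Lemma det_triples (i : J) (B B' : {set J}) (v : J -> R) :
  #|B| = 3%N -> #|B'| = 3%N -> i \notin B -> i \notin B' ->
  \det (\matrix_(k, j) slots v (fun t j' => (j' == triple i B' t)%:R) j
     (slots i (triple i B) k)) = v i * (B == B')%:R.
Proof.
move=> cB cB' iB iB'.
have memT (D : {set J}) t : #|D| = 3%N -> triple i D t \in D.
  by move=> cD; rewrite /triple -mem_enum mem_nth // -cardE cD.
rewrite (expand_det_row _ ord0) big_ord_recl mxE !slots0 big1 ?addr0; last first.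
  move=> t _; rewrite mxE slots0 slotsS.
  have -> : i == triple i B' t = false.
    by apply/negP => /eqP iE; move: iB'; rewrite iE memT.
  by rewrite mul0r.
congr (_ * _); rewrite /cofactor expr0 mul1r.
set N := row' _ _.
have NE t t' : N t t' = (triple i B t == triple i B' t')%:R.
  by rewrite !mxE !slotsS.
have [BB|BB] := eqVneq B B'.
  rewrite (_ : N = 1%:M) ?det1 //; apply/matrixP => t t'.
  rewrite NE -BB mxE /triple nth_uniq ?enum_uniq // -cardE cB ltn_ord //.
have [t tB] : exists t, triple i B t \notin B'.
  apply/existsP; rewrite -negb_forall; apply: contra BB => /forallP tB'.
  rewrite eqEcard cB cB' leqnn andbT; apply/fintype.subsetP => j jB.
  have jB' : j \in enum B by rewrite mem_enum.
  have lt3 : (index j (enum B) < 3)%N by rewrite -cB cardE index_mem.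
  by have := tB' (Ordinal lt3); rewrite /triple nth_index.
rewrite (expand_det_row _ t) big1 // => t' _; rewrite NE.
have -> : triple i B t == triple i B' t' = false.
  by apply/negP => /eqP E; move: tB; rewrite E memT.
by rewrite mul0r.
Qed.

End SelectDeterminant.

Section DwedgeLinear.
Variables (R : realType) (a b : nat).
Notation V := 'M[R]_(a, b).

Lemma dwedge_slots (f : 'I_4 -> V -> R) y (u : V) (w : 'I_3 -> V) :
  (forall k, differentiable (f k) y) ->
  dwedge f y (slots u w) = \sum_(j : 'I_a * 'I_b) u j.1 j.2 *
    dwedge f y (slots (delta_mx j.1 j.2) w).
Proof.
move=> df; rewrite /dwedge.
pose N u := \matrix_(k < 4, j < 4) 'D_(slots u w j) (f k) y : 'M[R]_4.
have cof k u' : cofactor (N u) k ord0 = cofactor (N u') k ord0.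
  rewrite /cofactor; congr (_ * \det _); apply/matrixP => k' t.
  by rewrite !mxE !slotsS.
rewrite -/(N u) (expand_det_col _ ord0).
under eq_bigr => k _ do rewrite mxE slots0 deriveE // diff_mx_sum // mulr_suml.
rewrite exchange_big /=; apply: eq_bigr => j _.
rewrite -/(N (delta_mx j.1 j.2)) (expand_det_col _ ord0) mulr_sumr.
apply: eq_bigr => k _.
by rewrite -mulrA mxE slots0 (cof k (delta_mx j.1 j.2)).
Qed.

End DwedgeLinear.

(* [compact_cover] is stated for pointed spaces only. *)
Lemma compact_cover_compact (T : topologicalType) (K : set T) :
  compact K -> cover_compact K.
Proof.
move=> cK; have [->|/set0P[x0 Kx0]] := eqVneq K set0.
  by move=> I D f _ _; exists finmap.fset0.
pose PT : ptopologicalType := HB.pack (Topological.sort T) (isPointed.Build T x0).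
have : @compact PT K by exact: cK.
by rewrite compact_cover.
Qed.

(** For [n] the real dimension: parameters of a point and a direction, against three-element sets of
    coordinates avoiding a fixed one. *)
Lemma binomial3_gt n : (8 <= n)%N -> (n + n < 'C(n.-1, 3))%N.
Proof.
move=> n8; have := bin_ffact n.-1 3.
rewrite ffactnS ffactnS ffactn1 -[3`!]/6%N.
case: n n8 => // -[//|[//|n]] n8 /=; nia.
Qed.

Lemma alternating_slots_scale (R : realType) (F : lmodType R)
    (w : ('I_4 -> F) -> R) (t : R) u v :
  alternating_form w -> w (slots (t *: u) v) = t * w (slots u v).
Proof.
move=> [ml _].
have E x : ([eta slots u v with ord0 |-> x] : _ -> _) = slots x v.
  apply/funext => k /=; case: (unliftP ord0 k) => [k' ->|->].
    by rewrite eq_sym (negPf (neq_lift _ _)) !slotsS.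
  by rewrite eqxx slots0.
have w0 : w (slots 0 v) = 0.
  have := ml (slots u v) ord0 1 0 0; rewrite scaler0 addr0 !E mul1r.
  by move/eqP; rewrite -subr_eq0 opprD addrA subrr sub0r oppr_eq0 => /eqP.
by have := ml (slots u v) ord0 t u 0; rewrite addr0 !E w0 addr0.
Qed.

Lemma derive_coord (R : realType) a b (i : 'I_a) (j : 'I_b)
    (y u : 'M[R]_(a, b)) : 'D_u (fun z : 'M[R]_(a, b) => z i j) y = u i j.
Proof.
have := derive_mx (@derivable_id _ _ y u); rewrite derive_id.
by move/matrixP/(_ i j); rewrite mxE => ->.
Qed.

Lemma smooth_on_differentiable_mx (R : realType) a b c d
    (U : set 'M[R]_(a, b)) (f : 'M[R]_(a, b) -> 'M[R]_(c, d)) x :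
  open U -> smooth_on U f -> U x -> differentiable f x.
Proof.
move=> oU /(smooth_on_mx f oU) sf Ux.
rewrite (_ : f = \sum_(ij : 'I_c * 'I_d)
    (fun y => f y ij.1 ij.2 *: delta_mx ij.1 ij.2)); last first.
  apply/funext => y; rewrite fct_sumE {1}(matrix_sum_delta (f y)).
  by rewrite (pair_bigA _ (fun i j => _ *: _)).
elim/big_ind: _ => [|g h dg dh|ij _]; first exact: differentiable_cst.
  exact: differentiableD.
apply: differentiableZl.
exact: (smooth_on_differentiable oU (sf ij.1 ij.2) Ux).
Qed.

Section GenericForm.
Variables (R : realType) (a b : nat) (X : topologicalType).
Notation V := 'M[R]_(a, b).
Notation J := ('I_a * 'I_b)%type.
Variable A : set (chart X V).
Hypothesis manA : smooth_manifold A.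
Hypothesis cptX : compact [set: X].

Lemma derive_transitionK c1 c2 (A1 : A c1) (A2 : A c2) y v : overlap c1 c2 y ->
  'D_('D_v (transition c1 c2) y) (transition c2 c1) (transition c1 c2 y) = v.
Proof.
move=> yo; have [_ _ tA _ sA] := manA; have e1 := tA _ A1; have e2 := tA _ A2.
have dT : derivable (transition c1 c2) y v.
  exact: smooth_on_derivable (sA _ _ A1 A2) yo.
have yo' : overlap c2 c1 (transition c1 c2 y).
  case: yo => x [x1 x2] <-; exists x => //.
  by rewrite /transition /=; case: e1 => _ _ ->.
have dT' := smooth_on_differentiable_mx (open_overlap e2 e1) (sA _ _ A2 A1) yo'.
rewrite deriveE //; have [_ <-] := is_derive_chain dT dT'.
rewrite -[RHS](derive_id y v); apply: near_eq_derive.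
have : nbhs y (overlap c1 c2) by have := open_overlap e1 e2; rewrite openE; exact.
apply: filterS => _ [x [x1 x2] <-]; rewrite /transition /=.
by case: e1 => _ _ -> // _ _; case: e2 => _ _ -> // _ _.
Qed.

(** The points covered lie within [r i / 2] of the centre although the bump functions are
    coordinates up to [r i]: the margin makes their derivatives at those points agree with those of
    the coordinates. *)
Lemma finite_bump_atlas : exists (N : nat) (c : 'I_N -> chart X V)
    (y0 : 'I_N -> V) (r : 'I_N -> R) (F : 'I_N -> J -> X -> R),
  [/\ forall i, [/\ A (c i), 0 < r i & [set y | `|y - y0 i| <= r i] `<=` cimg (c i)],
      forall i j, smooth_fun A setT (F i j),
      forall i y j, `|y - y0 i| < r i -> \forall z \near y,
         F i j (cbwd (c i) z) = z j.1 j.2 &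
      forall x, exists i, cdom (c i) x /\ `|cfwd (c i) x - y0 i| < r i / 2].
Proof.
have [hX _ tA cov sA] := manA.
have /choice[d dP] (x : X) : exists d : chart X V * R * (J -> X -> R),
    [/\ A d.1.1, cdom d.1.1 x, 0 < d.1.2,
      [set y | `|y - cfwd d.1.1 x| <= d.1.2] `<=` cimg d.1.1 &
      (forall j, smooth_fun A setT (d.2 j)) /\
      forall y j, `|y - cfwd d.1.1 x| <= d.1.2 ->
        d.2 j (cbwd d.1.1 y) = y j.1 j.2].
  have [c Ac cx] := cov x; have [_ oi _ _ _] := tA _ Ac.
  have /nbhs_ballP[e /= e0 eb] : nbhs (cfwd c x) (cimg c).
    by move: oi; rewrite openE; apply; exists x.
  (* [bump_coordinates] needs the cube of twice the radius inside the chart, and 2e/3 < e. *)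
  have r0 : 0 < e / 3 by rewrite divr_gt0.
  have sub y : `|y - cfwd c x| <= 2 * (e / 3) -> cimg c y.
    move=> yr; apply: eb; rewrite -ball_normE /= distrC.
    by apply: le_lt_trans yr _; lra.
  have [F [sF FE]] := bump_coordinates manA Ac r0 sub.
  exists (c, e / 3, F); split=> //= y yr; apply: sub.
  by apply: le_trans yr _; lra.
pose U x := [set x' | cdom (d x).1.1 x' /\
  `|cfwd (d x).1.1 x' - cfwd (d x).1.1 x| < (d x).1.2 / 2].
have oU x : open (U x).
  have [Ac cx r0 _ _] := dP x; have [od _ _ cf _] := tA _ Ac.
  rewrite openE => x' [cx' x'r]; rewrite /interior.
  apply: filterI; first by move: od; rewrite openE; exact.
  have cn : (fun z => `|cfwd (d x).1.1 z - cfwd (d x).1.1 x|) @ x' -->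
      `|cfwd (d x).1.1 x' - cfwd (d x).1.1 x|.
    apply: cvg_norm; apply: cvgB; first exact: cf.
    exact: cvg_cst.
  exact: cvgr_lt cn _ x'r.
have [|x _|D' _ cD] := compact_cover_compact cptX (D := setT) (f := U).
- by move=> x _; exact: oU.
- exists x => //; have [Ac cx r0 _ _] := dP x; split=> //.
  by rewrite subrr normr0 divr_gt0.
exists (size (finmap.enum_fset D')).
pose xs i := tnth (in_tuple (finmap.enum_fset D')) i.
exists (fun i => (d (xs i)).1.1), (fun i => cfwd (d (xs i)).1.1 (xs i)),
  (fun i => (d (xs i)).1.2), (fun i => (d (xs i)).2); split.
- by move=> i; have [] := dP (xs i).
- by move=> i j; have [_ _ _ _ []] := dP (xs i).
- move=> i y j yr; have [_ _ _ _ [_ FE]] := dP (xs i).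
  apply/nbhs_ballP; exists ((d (xs i)).1.2 - `|y - cfwd (d (xs i)).1.1 (xs i)|).
    by rewrite /= subr_gt0.
  move=> z; rewrite -ball_normE /= distrC ltrBrDr => zr; apply: FE.
  rewrite -[z](subrK y) -addrA; apply: le_trans (ler_normD _ _) _.
  exact: ltW.
- move=> x; have [z /= zD [xd xr]] := cD x I.
  have /tnthP[i zE] : z \in in_tuple (finmap.enum_fset D') by [].
  by exists i; rewrite /xs -zE.
Qed.

Lemma exists_plectic : (8 <= a * b)%N ->
  exists omega : form_field R X V 4, plectic_form A omega.
Proof.
move=> ab8; have [hX _ tA cov sA] := manA.
have [N [c [y0 [r [F [cP sF FE cX]]]]]] := finite_bump_atlas.
pose n := #|{: J}|.
have n8 : (8 <= n)%N by rewrite /n card_prod !card_ord.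
pose q := 'C(n.-1, 3).
(* For a direction whose dominant entry is [i], the test triples e_B are those with [i \notin B];
   each gives one equation. *)
pose S (i : J) := [set B : {set J} | (B \subset ~: [set i]%SET) && (#|B| == 3%N)]%SET.
have cS i : #|S i| = q.
  rewrite /S cards_draws cardsC1 -/n //.
pose Bl i (l : 'I_q) := enum_val (cast_ord (esym (cS i)) l).
have BlP i l : i \notin Bl i l /\ #|Bl i l| = 3%N.
  have := enum_valP (cast_ord (esym (cS i)) l); rewrite inE -/(Bl i l).
  case/andP=> /fintype.subsetP sub /eqP ->; split=> //.
  by apply/negP => /sub; rewrite !inE eqxx.
have BlI i : injective (Bl i) by move=> l l' /enum_val_inj /cast_ord_inj.
(* One coefficient for each choice of a chart and of four bump coordinates of that chart. *)
pose Theta := ('I_N * {ffun 'I_4 -> J})%type.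
pose pos (s : 'I_N * J) (l : 'I_q) : Theta :=
  (s.1, [ffun k => slots s.2 (triple s.2 (Bl s.2 l)) k]).
have posI s : injective (pos s).
  move=> l l' [/ffunP E]; apply: (BlI s.2); apply/eqP.
  have [iB cB] := BlP s.2 l; have [iB' cB'] := BlP s.2 l'.
  rewrite eqEcard cB cB' leqnn andbT; apply/fintype.subsetP => j jB.
  have jE : j \in enum (Bl s.2 l) by rewrite mem_enum.
  have lt3 : (index j (enum (Bl s.2 l)) < 3)%N by rewrite -cB cardE index_mem.
  have := E (lift ord0 (Ordinal lt3)); rewrite !ffunE !slotsS /triple /=.
  rewrite nth_index // => ->; rewrite -mem_enum mem_nth // -cardE cB'.
  exact: lt3.
pose e3 (i : J) (B : {set J}) (t : 'I_3) : V :=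
  delta_mx (triple i B t).1 (triple i B t).2.
pose w (i : 'I_N) (t : Theta) (y : V) (u : 'I_4 -> V) : R :=
  dwedge (fun k => F t.1 (t.2 k) \o cbwd (c i)) y u.
have oC i : open (chart_image (c i) setT).
  by apply: open_chart_image; [apply: tA; case: (cP i)|exact: openT].
have sFc i (t : Theta) k :
    smooth_on (chart_image (c i) setT) (F t.1 (t.2 k) \o cbwd (c i)).
  by apply: sF; case: (cP i).
have cube i y : `|y - y0 i| <= r i -> chart_image (c i) setT y.
  by case: (cP i) => _ _ sub yr; split=> //; exact: sub.
have r0 i : 0 < r i by case: (cP i).
have r20 i : 0 < r i / 2 by rewrite divr_gt0.
have /choice[Lw LwP] (p : 'I_N * Theta * J * {set J} * J) : exists L : R,
   let g y := w p.1.1.1.1 p.1.1.1.2 y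
      (slots (delta_mx p.1.1.2.1 p.1.1.2.2) (e3 p.2 p.1.2)) in
   let Q y := `|y - y0 p.1.1.1.1| <= r p.1.1.1.1 / 2 in
   [/\ 0 <= L, forall y, Q y -> `|g y| <= L &
    forall y y', Q y -> Q y' -> `|g y - g y'| <= L * `|y - y'|].
  move: p => [[[[i t] j] B] i'] /=.
  apply: (lipschitz_on_cube (oC i) _ (r20 i)).
    by apply: (smooth_dwedge (oC i)) => k; exact: sFc.
  move=> y /= yr; apply: cube; apply: le_trans yr _.
  by have := r0 i; lra.
(* A point [z] of the unit cube encodes a direction with entry [i] equal to 1 and the others in
   [-1, 1] and, through [yz], a point of the half cube of a chart. *)
pose vz (i : J) (z : (J + J)%type -> R) : V :=
  \matrix_(i1, i2) if (i1, i2) == i then 1 else 2 * z (inr (i1, i2)) - 1.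
pose yz (i : 'I_N) (z : (J + J)%type -> R) : V :=
  y0 i + \matrix_(i1, i2) (r i / 2 * (2 * z (inl (i1, i2)) - 1)).
(* On (v, e_B) the parameters [pos s] contribute exactly [eta (pos s l)], by [det_triples] with v_i
   = 1. So omega(v, e_B) = 0 reads [eta (pos s l) = Phi s l eta z], and [Phi] involves the remaining
   parameters only. *)
pose Phi (s : 'I_N * J) (l : 'I_q) (eta : Theta -> R) z : R :=
  - \sum_(t | t \notin codom (pos s)) eta t * \sum_j (vz s.2 z) j.1 j.2 *
     w s.1 t (yz s.1 z) (slots (delta_mx j.1 j.2) (e3 s.2 (Bl s.2 l))).
(* Lipschitz constant in [z]: the direction moves with speed 2, the point with speed [r i], and [Lw]
   bounds both the form and its variation. *)
pose G i (B : {set J}) (i' : J) : R :=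
  \sum_t \sum_j (2 + r i) * Lw (i, t, j, B, i').
have G0 i B i' : 0 <= G i B i'.
  apply: sumr_ge0 => t _; apply: sumr_ge0 => j _; apply: mulr_ge0.
    by rewrite addr_ge0 // ltW.
  by case: (LwP (i, t, j, B, i')).
pose L := \sum_i \sum_B \sum_i' G i B i'.
have GL i B i' : G i B i' <= L.
  rewrite /L (bigD1 i) //= (bigD1 B) //= (bigD1 i') //= -!addrA lerDl.
  rewrite !addr_ge0 // ?sumr_ge0 // => *; rewrite ?sumr_ge0 // => *.
    by rewrite ?sumr_ge0.
have L0 : 0 <= L.
  by apply: sumr_ge0 => i _; apply: sumr_ge0 => B _; exact: sumr_ge0.
have yzQ i z : (forall d, 0 <= z d <= 1) -> `|yz i z - y0 i| <= r i / 2.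
  move=> z01; rewrite /yz addrC addKr; apply: mx_norm_le => [|i1 i2].
    exact: ltW.
  rewrite mxE normrM gtr0_norm // ler_piMr ?(ltW (r20 i)) //.
  by have /andP[] := z01 (inl (i1, i2)); rewrite ler_norml; lra.
have vz1 i z j : (forall d, 0 <= z d <= 1) -> `|vz i z j.1 j.2| <= 1.
  move=> z01; rewrite mxE; case: ifP => _; first by rewrite normr1.
  by have /andP[] := z01 (inr (j.1, j.2)); rewrite ler_norml; lra.
have Phi_lip s l eta z z' : (forall t, 0 <= eta t <= 1) ->
    (forall d, 0 <= z d <= 1) -> (forall d, 0 <= z' d <= 1) ->
    forall e, (forall d, `|z d - z' d| <= e) ->
    `|Phi s l eta z - Phi s l eta z'| <= L * e.
  move=> eta01 z01 z'01 e ze; case: s => i i'.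
  have e0 : 0 <= e by apply: le_trans (ze (inl i')); exact: normr_ge0.
  rewrite /Phi -opprD normrN -sumrB /=.
  apply: le_trans (ler_wpM2r e0 (GL i (Bl i' l) i')).
  apply: le_trans (ler_norm_sum _ _ _) _.
  rewrite /G mulr_suml big_mkcond /=; apply: ler_sum => t _.
  have T0 : 0 <= (\sum_j (2 + r i) * Lw (i, t, j, Bl i' l, i')) * e.
    rewrite mulr_ge0 // sumr_ge0 // => j _; rewrite mulr_ge0 //.
      by rewrite addr_ge0 // ltW.
    by case: (LwP (i, t, j, Bl i' l, i')).
  case: ifP => // _; rewrite -mulrBr normrM; have /andP[eta0 eta1] := eta01 t.
  rewrite (ger0_norm eta0); apply: le_trans (ler_piMl (normr_ge0 _) eta1) _.
  rewrite -sumrB mulr_suml; apply: le_trans (ler_norm_sum _ _ _) _.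
  apply: ler_sum => j _.
  have [/= Lw0 Lwb Lwl] := LwP (i, t, j, Bl i' l, i').
  have b1 := Lwb _ (yzQ i z z01).
  have b2 := Lwl _ _ (yzQ i z z01) (yzQ i z' z'01).
  have vd : `|vz i' z j.1 j.2 - vz i' z' j.1 j.2| <= 2 * e.
    rewrite !mxE; case: ifP => _; first by rewrite subrr normr0 mulr_ge0.
    have -> : 2 * z (inr (j.1, j.2)) - 1 - (2 * z' (inr (j.1, j.2)) - 1) =
      2 * (z (inr (j.1, j.2)) - z' (inr (j.1, j.2))) by ring.
    by rewrite normrM ger0_norm // ler_wpM2l.
  have yd : `|yz i z - yz i z'| <= r i * e.
    apply: mx_norm_le => [|i1 i2]; first by rewrite mulr_ge0 // ltW.
    rewrite !mxE.
    have -> : y0 i i1 i2 + r i / 2 * (2 * z (inl (i1, i2)) - 1) -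
      (y0 i i1 i2 + r i / 2 * (2 * z' (inl (i1, i2)) - 1)) =
      r i * (z (inl (i1, i2)) - z' (inl (i1, i2))) by field.
    by rewrite normrM gtr0_norm // ler_wpM2l // ltW.
  have v1 := vz1 i' z' j z'01.
  set g := w i t (yz i z) _ in b1 b2 *.
  set g' := w i t (yz i z') _ in b2 *.
  have -> : vz i' z j.1 j.2 * g - vz i' z' j.1 j.2 * g' =
    (vz i' z j.1 j.2 - vz i' z' j.1 j.2) * g + vz i' z' j.1 j.2 * (g - g').
    by ring.
  apply: le_trans (ler_normD _ _) _; rewrite !normrM.
  have h1 := ler_pM (normr_ge0 _) (normr_ge0 _) vd b1.
  have h2 := ler_pM (normr_ge0 _) (normr_ge0 _) v1 b2.
  have h3 := ler_wpM2l Lw0 yd.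
  lra.
have Dq : (#|{: J + J}| < q)%N by rewrite card_sum; exact: binomial3_gt.
have [|eta [eta01 etaP]] := avoid_graphs posI Dq L0 _ Phi_lip.
  move=> s l eta eta' z E; rewrite /Phi; congr (- _); apply: eq_bigr => t tn.
  rewrite E // => l'; apply/negP => /eqP tE; move: tn.
  by rewrite tE codom_f.
pose omega : form_field R X V 4 := fun c y v =>
  \sum_t eta t * dwedge (fun k => F t.1 (t.2 k) \o cbwd c) y v.
have exact_omega : locally_exact A omega.
  move=> x; exists setT, Theta, (index_enum Theta), eta,
    (fun (t : Theta) k => F t.1 (t.2 k)).
  by split=> //; exact: openT.
have [dform closed] := locally_exact_closed manA exact_omega.
have dFc i (t : Theta) k y : cimg (c i) y ->
    differentiable (F t.1 (t.2 k) \o cbwd (c i)) y.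
  by move=> yc; apply: (smooth_on_differentiable (oC i) (sFc i t k)).
have omegaE s l z : (forall d, 0 <= z d <= 1) ->
    omega (c s.1) (yz s.1 z) (slots (vz s.2 z) (e3 s.2 (Bl s.2 l))) =
    eta (pos s l) - Phi s l eta z.
  move=> z01; have yQ := yzQ s.1 z z01.
  have yr : `|yz s.1 z - y0 s.1| < r s.1.
    by apply: le_lt_trans yQ _; have := r0 s.1; lra.
  have yc : cimg (c s.1) (yz s.1 z) by case: (cube _ _ (ltW yr)).
  rewrite /omega (bigID (fun t => t \in codom (pos s))) /= /Phi opprK.
  congr (_ + _); last first.
    apply: eq_bigr => t _; congr (_ * _); apply: dwedge_slots => k.
    exact: dFc.
  rewrite -big_uniq; last by rewrite map_inj_uniq ?enum_uniq //; exact: posI.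
  rewrite big_map big_enum /= (bigD1 l) //= big1 ?addr0 => [|l' l'l].
    rewrite -[RHS]mulr1; congr (_ * _).
    have [iB cB] := BlP s.2 l.
    have := det_triples (fun j => vz s.2 z j.1 j.2) cB cB iB iB.
    rewrite eqxx mulr1 [X in _ = X -> _]mxE -surjective_pairing eqxx => <-.
    congr (\det _); apply/matrixP => k k'; rewrite !mxE ffunE.
    rewrite (near_eq_derive _ (FE s.1 _ _ yr)) derive_coord.
    case: (unliftP ord0 k') => [t ->|->]; last by rewrite !slots0.
    by rewrite !slotsS /e3 mxE -xpair_eqE -!surjective_pairing.
  have [iB cB] := BlP s.2 l; have [iB' cB'] := BlP s.2 l'.
  have := det_triples (fun j => vz s.2 z j.1 j.2) cB' cB iB' iB.
  rewrite (inj_eq (BlI s.2)) (negPf l'l) mulr0 => E.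
  rewrite -[RHS](mulr0 (eta (pos s l'))) -[in RHS]E; congr (_ * \det _).
  apply/matrixP => k k'; rewrite !mxE ffunE.
  rewrite (near_eq_derive _ (FE s.1 _ _ yr)) derive_coord.
  case: (unliftP ord0 k') => [t ->|->]; last by rewrite !slots0.
  by rewrite !slotsS /e3 mxE -xpair_eqE -!surjective_pairing.
exists omega; split=> //.
move=> c0 y u Ac0 yc0 H; apply/eqP; rewrite -[_ == _]negbK; apply/negP => u0.
have tc0 := tA _ Ac0; have [xc0 x0E] := cbwdK tc0 yc0.
have [i [xi xr]] := cX (cbwd c0 y).
have [Aci _ _] := cP i; have tci := tA _ Aci.
pose T := transition c0 (c i); pose T' := transition (c i) c0.
pose y1 := T y.
have y1E : y1 = cfwd (c i) (cbwd c0 y) by [].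
have K1 : cbwd (c i) y1 = cbwd c0 y by rewrite y1E; case: tci => _ _ ->.
have yo : overlap c0 (c i) y by exists (cbwd c0 y).
have y1o : overlap (c i) c0 y1 by exists (cbwd c0 y).
have T'y1 : T' y1 = y by rewrite /T' /transition /= K1.
pose u1 := 'D_u T y.
have Tu1 : 'D_u1 T' y1 = u by exact: derive_transitionK.
have u10 : `|u1| != 0.
  rewrite normr_eq0; apply: contra u0 => /eqP E; move: Tu1.
  by rewrite E derive0 => <-.
(* The direction, moved to the chart [c i], is divided by an entry of largest modulus, which brings
   it into the range of [vz i']. *)
have [i' i'E] := mx_norm_neq0 (x := u1) u10.
pose t := u1 i'.1 i'.2.
have tE : `|t| = `|u1| := esym i'E.
have t0 : 0 < `|t| by rewrite tE lt_def u10 normr_ge0.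
have tn : t != 0 by rewrite -normr_gt0.
pose v := t^-1 *: u1.
pose z (d : J + J) : R := match d with
  | inl j => ((y1 - y0 i) j.1 j.2 / (r i / 2) + 1) / 2
  | inr j => (v j.1 j.2 + 1) / 2 end.
have z01 d : 0 <= z d <= 1.
  case: d => j /=.
    have := mx_norm_ge (y1 - y0 i) j.1 j.2.
    move/le_trans/(_ (ltW xr)); rewrite ler_norml => /andP[h1 h2].
    have : -1 <= (y1 - y0 i) j.1 j.2 / (r i / 2) <= 1.
      by rewrite ler_pdivlMr // ler_pdivrMr // mulN1r mul1r h1 h2.
    lra.
  have := mx_norm_ge u1 j.1 j.2; rewrite -tE => h.
  have : `|v j.1 j.2| <= 1.
    by rewrite mxE normrM normfV mulrC ler_pdivrMr // mul1r.
  by rewrite ler_norml; lra.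
have vE : vz i' z = v.
  apply/matrixP => j1 j2; rewrite mxE; case: eqP => [E|_].
    by rewrite /v mxE /t -E /= mulVf // /t; move: tn; rewrite /t -E.
  by rewrite /z /=; lra.
have yE : yz i z = y1.
  apply/matrixP => j1 j2; rewrite !mxE /z /= !mxE; have := r0 i => ri.
  by field; rewrite gt_eqF.
have [l /negP lP] := etaP (i, i') z z01; apply: lP.
rewrite -subr_eq0 -(omegaE (i, i') l z z01) /= vE yE.
have [alt _ trans] := dform.
have y1c : cimg (c i) y1 by exists (cbwd c0 y).
rewrite alternating_slots_scale; last exact: alt.
(* The test vectors are pulled back to [c0], where degeneracy is assumed; the transition returns
   them to e_B. *)
pose w' k := 'D_(e3 i' (Bl i' l) k) T' y1.
have := congr1 (fun h => h w') H; rewrite /interior_product /=.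
rewrite -[X in omega _ _ X]/(slots u w') (trans c0 (c i)) //.
rewrite (_ : (fun k => 'D_(slots u w' k) _ y) = slots u1 (e3 i' (Bl i' l))).
  by move=> ->; rewrite mulr0.
apply/funext => k; case: (unliftP ord0 k) => [k' ->|->].
  rewrite !slotsS /w' -[in 'D_(_) _ y]T'y1.
  exact: (derive_transitionK Aci Ac0).
by rewrite !slots0.
Qed.

End GenericForm.

(** * Orbit spaces and slice charts *)

Section OrbitSpaceTheory.
Variables (E : topologicalType) (Z : set E) (orb : E -> set E).
Notation Q := (orbit_space Z orb).
Notation proj := (@orbit_proj E Z orb).

Lemma set_val_in (z : Z) : Z (set_val z).
Proof. exact: set_valP. Qed.

Lemma set_val_insubd (z0 : Z) q : Z q -> set_val (insubd z0 q) = q.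
Proof. by move=> Zq; rewrite set_valE insubdK // inE. Qed.

Lemma orbit_proj_repr (x : Q) : proj (repr x) = x.
Proof. exact: reprK. Qed.

Lemma orbit_projP (z z' : Z) :
  proj z = proj z' <-> orb (set_val z) = orb (set_val z').
Proof.
split=> [e|e].
  by apply/asboolP; have /eqmodP := e.
by apply/eqmodP/asboolP.
Qed.

Lemma orbit_proj_surj (x : Q) : exists z, proj z = x.
Proof. by exists (repr x); exact: orbit_proj_repr. Qed.

Lemma orbit_proj_continuous : continuous proj.
Proof. exact: pi_continuous. Qed.

Lemma open_orbit_space (U : set Q) : open (proj @^-1` U) -> open U.
Proof. by []. Qed.

Lemma orbit_space_continuous (Y : topologicalType) (f : Q -> Y) :
  continuous (f \o proj) -> continuous f.
Proof. by move=> cf; apply/quotient_continuous. Qed.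

Lemma open_set_val (O : set E) : open O -> open (set_val @^-1` O : set Z).
Proof. by move=> oO; exists O. Qed.

Lemma set_val_continuous : continuous (set_val : Z -> E).
Proof. exact: initial_continuous. Qed.

(** Near a point of the saturation of [U], the map [phi] carries points into [U] without leaving
    their classes. One map for each pair of equivalent points takes the place of a group. *)
Lemma open_orbit_proj :
  (forall q q', Z q -> Z q' -> orb q = orb q' -> exists phi : E -> E,
     [/\ continuous phi, phi q = q' &
         forall p, Z p -> Z (phi p) /\ orb (phi p) = orb p]) ->
  forall U : set E, open U -> open (proj @` (set_val @^-1` U)).
Proof.
move=> act U oU; apply: open_orbit_space; rewrite openE => z [z' Uz' /orbit_projP e].
have [phi [cphi phiz phiP]] :=
  act _ _ (set_val_in z) (set_val_in z') (esym e).
rewrite /interior nbhsE; exists (set_val @^-1` (phi @^-1` U)); first split.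
- by apply: open_set_val; move/continuousP: cphi; exact.
- by rewrite /= phiz.
move=> y /= Uy; have [Zy oy] := phiP _ (set_val_in y).
exists (insubd z (phi (set_val y))); first by rewrite /= set_val_insubd.
by apply/orbit_projP; rewrite set_val_insubd.
Qed.

End OrbitSpaceTheory.

Section SliceChart.
Variables (R : realType) (V F : normedModType R) (Z : set V).
Variables (orb : V -> set V) (O : set V) (g : V -> F) (D : set F) (s : F -> V).
Variable z0 : Z.
Hypothesis oO : open O.
Hypothesis oD : open D.
Hypothesis satO : forall q q', Z q -> Z q' -> orb q = orb q' -> O q -> O q'.
Hypothesis sg : smooth_on O g.
Hypothesis ginv : forall q q', Z q -> Z q' -> orb q = orb q' -> O q -> g q = g q'.
Hypothesis ss : smooth_on D s.
Hypothesis sD : forall u, D u -> [/\ Z (s u), O (s u) & g (s u) = u].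
Hypothesis gO : forall q, Z q -> O q -> D (g q) /\ orb (s (g q)) = orb q.

(** The choice made by [repr] is harmless, [O] being saturated and [g] invariant; [z0] is a default
    for [s u] outside [Z], which does not happen on [D]. *)
Definition slice_chart : chart (orbit_space Z orb) F :=
  Chart [set x | O (set_val (repr x))] (fun x => g (set_val (repr x)))
        (fun u => orbit_proj orb (insubd z0 (s u))).

Lemma orb_repr (z : Z) : orb (set_val (repr (orbit_proj orb z))) = orb (set_val z).
Proof. by apply/orbit_projP; rewrite orbit_proj_repr. Qed.

Lemma slice_cdom (z : Z) : cdom slice_chart (orbit_proj orb z) <-> O (set_val z).
Proof.
by split=> /=; apply: satO; rewrite ?orb_repr //; exact: set_val_in.
Qed.

Lemma slice_cfwd (z : Z) : O (set_val z) ->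
  cfwd slice_chart (orbit_proj orb z) = g (set_val z).
Proof.
move=> Oz; apply/esym; apply: ginv Oz; rewrite ?orb_repr //; exact: set_val_in.
Qed.

Lemma slice_cbwd u : D u ->
  exists2 z : Z, set_val z = s u & orbit_proj orb z = cbwd slice_chart u.
Proof.
by move=> /sD[Zs _ _]; exists (insubd z0 (s u)); rewrite ?set_val_insubd.
Qed.

Lemma slice_cimg : cimg slice_chart = D.
Proof.
apply/seteqP; split=> [u [x]|u Du].
  have [z <-] := orbit_proj_surj x => /slice_cdom Oz <-.
  by rewrite slice_cfwd //; case: (gO (set_val_in z) Oz).
have [Zs Os gs] := sD Du; have [z zE _] := slice_cbwd Du.
by exists (orbit_proj orb z); [apply/slice_cdom|rewrite slice_cfwd]; rewrite zE.
Qed.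

Lemma slice_chart_quotient : @quotient_charts R V F Z orb slice_chart.
Proof.
split.
- split.
  + apply: open_orbit_space.
    rewrite (_ : _ @^-1` _ = set_val @^-1` O); first exact: open_set_val.
    by apply/seteqP; split=> z /slice_cdom.
  + by rewrite slice_cimg.
  + move=> x; have [z <-] := orbit_proj_surj x => /slice_cdom Oz.
    have [Dg og] := gO (set_val_in z) Oz; rewrite slice_cfwd //.
    by have [z' z'E <-] := slice_cbwd Dg; apply/orbit_projP; rewrite z'E.
  + move=> x; have [z <-] := orbit_proj_surj x => /slice_cdom Oz W.
    rewrite slice_cfwd // nbhsE => -[B [oB Bg] BW].
    suff : nbhs (orbit_proj orb z) (cfwd slice_chart @^-1` W) by [].
    rewrite nbhsE; exists [set x' | cdom slice_chart x' /\
        B (cfwd slice_chart x')]; last by move=> x' [_ /BW].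
    split; last by split; [exact/slice_cdom|rewrite slice_cfwd].
    apply: open_orbit_space.
    rewrite (_ : _ @^-1` _ = set_val @^-1` (O `&` g @^-1` B)).
      apply: open_set_val; rewrite openE => q [Oq Bq]; apply: filterI.
        by move: oO; rewrite openE; exact.
      by apply: (smooth_on_continuous sg Oq); move: oB; rewrite openE; exact.
    apply/seteqP; split=> z' /=.
      by move=> [/slice_cdom Oz']; rewrite -[g _]/(cfwd slice_chart _) slice_cfwd.
    move=> [Oz' Bz']; split; first exact/slice_cdom.
    by rewrite -[g _]/(cfwd slice_chart _) slice_cfwd.
  + rewrite slice_cimg => u Du W.
    have [z zE zu] := slice_cbwd Du.
    rewrite -zu nbhsE => -[B [oB Bz] BW].
    have [B' oB' B'E] : open (orbit_proj orb @^-1` B : set Z) by [].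
    have memB (z' : Z) : B (orbit_proj orb z') <-> B' (set_val z').
      by have := congr1 (fun T => T z') B'E; rewrite /= => ->.
    apply: (@filterS _ _ _ (D `&` s @^-1` B')).
      move=> u' [/slice_cbwd[z' z'E pz'] B's].
      suff : W (cbwd slice_chart u') by [].
      by rewrite -pz'; apply: BW; apply/memB; rewrite z'E.
    apply: filterI; first by move: oD; rewrite openE; exact.
    apply: (smooth_on_continuous ss Du); move: oB'; rewrite openE; apply.
    by rewrite -zE; apply/memB.
- move=> z /slice_cdom Oz; exists O, g; split=> // z' Oz' _.
  by rewrite slice_cfwd.
- rewrite slice_cimg => u Du; exists D, s; split=> // u' Du' _.
  exact: slice_cbwd.
Qed.

End SliceChart.

Section QuotientManifold.
Variables (R : realType) (a b c d : nat).
Notation V := 'M[R]_(a, b).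
Notation F := 'M[R]_(c, d).
Variables (Z : set V) (orb : V -> set V).
Notation Q := (orbit_space Z orb).
Notation A := (@quotient_charts R V F Z orb).

(** A local lift of the inverse of [c1] into [Z], followed by a local extension of [c2] to [V], is a
    composition of smooth maps. *)
Lemma quotient_transition (c1 c2 : chart Q F) :
  A c1 -> A c2 -> smooth_on (overlap c1 c2) (transition c1 c2).
Proof.
move=> [t1 _ S1] [t2 G2 _]; have oO := open_overlap t1 t2.
apply: smooth_on_local => y yo.
have y1 : cimg c1 y by case: yo => x [x1 _] <-; exists x.
have y2 : cdom c2 (cbwd c1 y).
  by case: yo => x [x1 x2] <-; case: t1 => _ _ ->.
have [U [s [oU Uy ss sP]]] := S1 y y1.
have [z zE pz] := sP y Uy y1; rewrite -pz in y2.
have [U' [g [oU' Uz' sg gP]]] := G2 z y2.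
pose N := overlap c1 c2 `&` U `&` s @^-1` U'.
have oN : open N.
  rewrite openE => u [[uo Uu] Us]; apply: filterI; first apply: filterI.
  - by move: oO; rewrite openE; exact.
  - by move: oU; rewrite openE; exact.
  - by apply: (smooth_on_continuous ss Uu); move: oU'; rewrite openE; exact.
exists N; first by split; [split|rewrite /= -zE].
have : smooth_on N (fun u => g (s u)).
  apply: (smooth_on_comp_mx oN oU' sg); last by move=> u [].
  by apply: smooth_on_subset ss => u [[]].
apply: smooth_on_ext => // u [[uo Uu] Us].
have u1 : cimg c1 u by case: uo => x [x1 _] <-; exists x.
have [z' z'E pz'] := sP u Uu u1.
rewrite /transition /= -pz' -z'E gP ?z'E // pz'.
by case: uo => x [x1 x2] <-; case: t1 => _ _ ->.
Qed.

Lemma quotient_second_countable :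
  (forall q q', Z q -> Z q' -> orb q = orb q' -> exists phi : V -> V,
     [/\ continuous phi, phi q = q' &
         forall p, Z p -> Z (phi p) /\ orb (phi p) = orb p]) ->
  @second_countable Q.
Proof.
move=> act; have open_proj := open_orbit_proj act.
pose W (qr : 'M[rat]_(a, b) * rat) : set Q := @orbit_proj V Z orb @`
  (set_val @^-1` [set p : V | `|p - map_mx ratr qr.1| < ratr qr.2]).
have oball (p0 : V) (r : R) : open [set p : V | `|p - p0| < r].
  rewrite (_ : [set _ | _] = ball p0 r); first exact: ball_open.
  by apply/seteqP; split=> p; rewrite -ball_normE /= distrC.
exists (range W); first exact: sub_countable (card_image_le _ _) (countableP _).
split; first by move=> _ [qr _ <-]; apply: open_proj; exact: oball.
move=> x U; have [z <-] := orbit_proj_surj x => Uz.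
have : nbhs z (@orbit_proj V Z orb @^-1` U).
  by apply: orbit_proj_continuous.
rewrite nbhsE => -[_ [[B oB <-] Bz] BU].
have /nbhs_ballP[e /= e0 eB] : nbhs (set_val z) B by move: oB; rewrite openE; exact.
have e4 : 0 < e / 4 by rewrite divr_gt0.
(* The rational centre is within e/4 of the point and e/4 < r < e/2: the cube contains the point and
   has diameter below [e]. *)
have [r /itvP rP] : exists r : rat, ratr r \in `](e / 4), (e / 2)[%R.
  have [|r rI] := @rat_in_itvoo R (e / 4) (e / 2); first by lra.
  by exists r.
have /choice[q qP] (ij : 'I_a * 'I_b) : exists q : rat,
    `|set_val z ij.1 ij.2 - ratr q| <= e / 4.
  have [|q /itvP qI] := @rat_in_itvoo R (set_val z ij.1 ij.2 - e / 4)
    (set_val z ij.1 ij.2 + e / 4); first by lra.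
  exists q; rewrite ler_norml.
  have : set_val z ij.1 ij.2 - e / 4 < ratr q by rewrite qI.
  have : ratr q < set_val z ij.1 ij.2 + e / 4 by rewrite qI.
  lra.
have rl : e / 4 < ratr r by rewrite rP.
have ru : ratr r < e / 2 by rewrite rP.
pose qm : 'M[rat]_(a, b) := \matrix_(i, j) q (i, j).
have zq : `|set_val z - map_mx ratr qm| <= e / 4.
  by apply: mx_norm_le => [|i j]; [exact: ltW|rewrite !mxE; exact: (qP (i, j))].
exists (W (qm, r)).
  split; first by exists (qm, r).
  by exists z => //=; apply: le_lt_trans zq _.
move=> _ [z' /= z'q <-]; apply: BU => /=; apply: eB.
rewrite -ball_normE /= -(subrKA (map_mx ratr qm)).
apply: le_lt_trans (ler_normD _ _) _; rewrite [`|map_mx _ _ - _|]distrC.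
lra.
Qed.

Lemma quotient_manifold : hausdorff_space Q -> @second_countable Q ->
  (forall x, exists2 c1, A c1 & cdom c1 x) -> smooth_manifold A.
Proof.
move=> hQ sQ cov; split=> // [c1 []//|c1 c2]; exact: quotient_transition.
Qed.

End QuotientManifold.

(** * Quaternions *)

Section QuaternionAlgebra.
Variable R : realType.
Notation H := 'rV[R]_4.
Implicit Types p q h : H.

Lemma ord4_cases (P : 'I_4 -> Prop) : P 0 -> P 1 -> P 2 -> P 3 -> forall i, P i.
Proof.
move=> p0 p1 p2 p3 [[|[|[|[|//]]]] lt]; [move: p0|move: p1|move: p2|move: p3];
  by congr P; exact/val_inj.
Qed.

Lemma quat_ext p q : p 0 0 = q 0 0 -> p 0 1 = q 0 1 -> p 0 2 = q 0 2 ->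
  p 0 3 = q 0 3 -> p = q.
Proof. by move=> ? ? ? ?; apply/rowP; apply: ord4_cases. Qed.

Lemma qmulE p q :
  (qmul p q 0 0 = p 0 0 * q 0 0 - p 0 1 * q 0 1 - p 0 2 * q 0 2 - p 0 3 * q 0 3) *
  (qmul p q 0 1 = p 0 0 * q 0 1 + p 0 1 * q 0 0 + p 0 2 * q 0 3 - p 0 3 * q 0 2) *
  (qmul p q 0 2 = p 0 0 * q 0 2 - p 0 1 * q 0 3 + p 0 2 * q 0 0 + p 0 3 * q 0 1) *
  (qmul p q 0 3 = p 0 0 * q 0 3 + p 0 1 * q 0 2 - p 0 2 * q 0 1 + p 0 3 * q 0 0).
Proof. by rewrite !mxE. Qed.

Lemma qconjE q :
  (qconj q 0 0 = q 0 0) * (qconj q 0 1 = - q 0 1) *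
  (qconj q 0 2 = - q 0 2) * (qconj q 0 3 = - q 0 3).
Proof. by rewrite !mxE. Qed.

Lemma qoneE : (qone R 0 0 = 1) * (qone R 0 1 = 0) *
  (qone R 0 2 = 0) * (qone R 0 3 = 0).
Proof. by rewrite !mxE. Qed.

Lemma sqnormE q :
  sqnorm q = q 0 0 ^+ 2 + q 0 1 ^+ 2 + q 0 2 ^+ 2 + q 0 3 ^+ 2.
Proof.
rewrite /sqnorm big_ord1 !big_ord_recl big_ord0 addr0 !addrA.
by congr (_ + _ + _ + _); congr (q 0 _ ^+ 2); exact/val_inj.
Qed.

Lemma qmulA p q h : qmul p (qmul q h) = qmul (qmul p q) h.
Proof. by apply: quat_ext; rewrite !qmulE; ring. Qed.

Lemma qmul1q q : qmul (qone R) q = q.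
Proof. by apply: quat_ext; rewrite !qmulE !qoneE; ring. Qed.

Lemma qmulq1 q : qmul q (qone R) = q.
Proof. by apply: quat_ext; rewrite !qmulE !qoneE; ring. Qed.

Lemma qmulZl (r : R) p q : qmul (r *: p) q = r *: qmul p q.
Proof.
apply: quat_ext; rewrite [RHS]mxE !qmulE ![(r *: p) _ _]mxE; ring.
Qed.

Lemma qmulZr (r : R) p q : qmul p (r *: q) = r *: qmul p q.
Proof.
apply: quat_ext; rewrite [RHS]mxE !qmulE ![(r *: q) _ _]mxE; ring.
Qed.

Lemma qmulq0 q : qmul q 0 = 0.
Proof. by rewrite -(scale0r 0) qmulZr !scale0r. Qed.

Lemma qconjM p q : qconj (qmul p q) = qmul (qconj q) (qconj p).
Proof. by apply: quat_ext; rewrite !(qmulE, qconjE); ring. Qed.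

Lemma qconjK q : qconj (qconj q) = q.
Proof. by apply: quat_ext; rewrite !qconjE ?opprK. Qed.

Lemma qconj1 : qconj (qone R) = qone R.
Proof. by apply: quat_ext; rewrite !(qconjE, qoneE) ?oppr0. Qed.

Lemma qconjZ (r : R) q : qconj (r *: q) = r *: qconj q.
Proof.
by apply: quat_ext; rewrite [RHS]mxE !qconjE ![(r *: q) _ _]mxE ?mulrN.
Qed.

Lemma sqnormM p q : sqnorm (qmul p q) = sqnorm p * sqnorm q.
Proof. by rewrite !sqnormE !qmulE; ring. Qed.

Lemma sqnorm_conj q : sqnorm (qconj q) = sqnorm q.
Proof. by rewrite !sqnormE !qconjE !sqrrN. Qed.

Lemma sqnorm1 : sqnorm (qone R) = 1.
Proof. by rewrite sqnormE !qoneE; ring. Qed.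

Lemma qmul_conj q : qmul q (qconj q) = sqnorm q *: qone R.
Proof.
apply: quat_ext; rewrite [RHS]mxE !qmulE !qconjE sqnormE !qoneE; ring.
Qed.

Lemma qconj_mul q : qmul (qconj q) q = sqnorm q *: qone R.
Proof. by rewrite -{2}(qconjK q) qmul_conj sqnorm_conj. Qed.

Lemma sqnorm_ge0 n l (x : 'M[R]_(n, l)) : 0 <= sqnorm x.
Proof. by apply: sumr_ge0 => i _; apply: sumr_ge0 => j _; exact: sqr_ge0. Qed.

Lemma sqnorm_eq0 n l (x : 'M[R]_(n, l)) : (sqnorm x == 0) = (x == 0).
Proof.
apply/eqP/eqP => [x0|->]; last first.
  by rewrite /sqnorm big1 // => i _; rewrite big1 // => j _; rewrite mxE expr0n.
apply/matrixP => i j; rewrite mxE; apply/eqP; rewrite -sqrf_eq0; apply/eqP.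
have := x0; rewrite /sqnorm => /psumr_eq0P/(_ i isT) xi.
have /psumr_eq0P := xi (fun i _ => sumr_ge0 _ (fun j _ => sqr_ge0 (x i j))).
by apply=> // j' _; exact: sqr_ge0.
Qed.

Lemma sqnormZ n l (r : R) (x : 'M[R]_(n, l)) : sqnorm (r *: x) = r ^+ 2 * sqnorm x.
Proof.
rewrite /sqnorm mulr_sumr; apply: eq_bigr => i _.
by rewrite mulr_sumr; apply: eq_bigr => j _; rewrite mxE exprMn.
Qed.

Lemma sqnorm_gt0 n l (x : 'M[R]_(n, l)) : (0 < sqnorm x) = (x != 0).
Proof. by rewrite lt_def sqnorm_ge0 andbT sqnorm_eq0. Qed.

Lemma sqnorm_row n l (x : 'M[R]_(n, l)) : sqnorm x = \sum_i sqnorm (row i x).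
Proof.
apply: eq_bigr => i _; rewrite /sqnorm big_ord1; apply: eq_bigr => j _.
by rewrite mxE.
Qed.

Section Unit.
Variables (h : H) (h1 : sqnorm h = 1).

Lemma unit_mulV : qmul h (qconj h) = qone R.
Proof. by rewrite qmul_conj h1 scale1r. Qed.

Lemma unit_Vmul : qmul (qconj h) h = qone R.
Proof. by rewrite qconj_mul h1 scale1r. Qed.

Lemma unit_mulVK q : qmul h (qmul (qconj h) q) = q.
Proof. by rewrite qmulA unit_mulV qmul1q. Qed.

Lemma unit_VmulK q : qmul (qconj h) (qmul h q) = q.
Proof. by rewrite qmulA unit_Vmul qmul1q. Qed.

Lemma mul_unitVK q : qmul (qmul q h) (qconj h) = q.
Proof. by rewrite -qmulA unit_mulV qmulq1. Qed.

Lemma mulV_unitK q : qmul (qmul q (qconj h)) h = q.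
Proof. by rewrite -qmulA unit_Vmul qmulq1. Qed.

End Unit.

Definition qabs n l (x : 'M[R]_(n, l)) : R := (sqnorm x) `^ (2^-1).

(** A real power of the squared norm, so that smoothness away from 0 reduces to that of [powR]. *)
Definition qdir q : H := (sqnorm q) `^ (- 2^-1) *: q.

Lemma qabs_ge0 n l (x : 'M[R]_(n, l)) : 0 <= qabs x.
Proof. exact: powR_ge0. Qed.

Lemma qabs_sqr n l (x : 'M[R]_(n, l)) : qabs x ^+ 2 = sqnorm x.
Proof.
by rewrite -powR_mulrn ?qabs_ge0 // -powRrM mulVf ?pnatr_eq0 // powRr1 ?sqnorm_ge0.
Qed.

Lemma qabs_gt0 n l (x : 'M[R]_(n, l)) : (0 < qabs x) = (x != 0).
Proof. by rewrite -sqnorm_gt0 -qabs_sqr exprn_even_gt0 //= lt_def qabs_ge0 andbT. Qed.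

Lemma qdirE q : q != 0 -> qdir q = (qabs q)^-1 *: q.
Proof. by move=> q0; rewrite /qdir /qabs -powRN. Qed.

Lemma sqnorm_dir q : q != 0 -> sqnorm (qdir q) = 1.
Proof.
move=> q0; rewrite qdirE // sqnormZ exprVn qabs_sqr mulVf // gt_eqF //.
by rewrite sqnorm_gt0.
Qed.

Lemma qabs_dir q : q != 0 -> q = qabs q *: qdir q.
Proof.
by move=> q0; rewrite qdirE // scalerA mulfV ?scale1r // gt_eqF // qabs_gt0.
Qed.

Lemma qabsM p q : qabs (qmul p q) = qabs p * qabs q.
Proof. by rewrite /qabs sqnormM powRM ?sqnorm_ge0. Qed.

Lemma qabs_conj q : qabs (qconj q) = qabs q.
Proof. by rewrite /qabs sqnorm_conj. Qed.

Lemma qabs_unit q : sqnorm q = 1 -> qabs q = 1.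
Proof. by rewrite /qabs => ->; rewrite powR1. Qed.

Lemma qabs_real (r : R) : 0 <= r -> qabs (r *: qone R) = r.
Proof.
move=> r0; apply/eqP; rewrite -(@eqrXn2 _ 2) ?qabs_ge0 //.
by rewrite qabs_sqr sqnormZ sqnorm1 mulr1.
Qed.

Lemma qmul_real (r : R) q : qmul (r *: qone R) q = r *: q.
Proof. by rewrite qmulZl qmul1q. Qed.

Lemma qmulr_real (r : R) q : qmul q (r *: qone R) = r *: q.
Proof. by rewrite qmulZr qmulq1. Qed.

End QuaternionAlgebra.

Section QuaternionSmooth.
Variables (R : realType) (V : normedModType R) (U : set V).
Hypothesis oU : open U.
Notation H := 'rV[R]_4.

Lemma smooth_on_rV4 (f : V -> H) :
  smooth_on U f <-> forall j, smooth_on U (fun x => f x 0 j).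
Proof.
split=> [/(smooth_on_mx f oU) sf j|sf]; first exact: sf.
by apply/(smooth_on_mx f oU) => i j; rewrite (ord1 i).
Qed.

Lemma smooth_on_qmul (f g : V -> H) : smooth_on U f -> smooth_on U g ->
  smooth_on U (fun x => qmul (f x) (g x)).
Proof.
move=> /smooth_on_rV4 sf /smooth_on_rV4 sg; apply/smooth_on_rV4.
apply: (@ord4_cases (fun j => smooth_on U (fun x => qmul (f x) (g x) 0 j)));
  under eq_fun do rewrite qmulE;
  do ?[apply: (smooth_on_sub oU)|apply: (smooth_on_add oU)];
  by apply: (smooth_on_mul oU).
Qed.

Lemma smooth_on_qconj (f : V -> H) : smooth_on U f ->
  smooth_on U (fun x => qconj (f x)).
Proof.
move=> /smooth_on_rV4 sf; apply/smooth_on_rV4 => j.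
apply: (@smooth_on_ext _ _ _ U (fun x => if j == 0 then f x 0 j else - f x 0 j)) => //.
  by move=> x _; rewrite mxE.
by case: (j == 0) => //; exact: smooth_on_opp.
Qed.

Lemma smooth_on_scale (a b : nat) (f : V -> R) (g : V -> 'M[R]_(a, b)) :
  smooth_on U f -> smooth_on U g -> smooth_on U (fun x => f x *: g x).
Proof.
move=> sf /(smooth_on_mx g oU) sg; apply/(smooth_on_mx _ oU) => i j.
apply: (@smooth_on_ext _ _ _ U (fun x => f x * g x i j)) => //.
  by move=> x _; rewrite mxE.
exact: smooth_on_mul.
Qed.

Lemma smooth_on_sqnorm (a b : nat) (f : V -> 'M[R]_(a, b)) :
  smooth_on U f -> smooth_on U (fun x => sqnorm (f x)).
Proof.
move=> /(smooth_on_mx f oU) sf.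
apply: smooth_on_sum => // i; apply: smooth_on_sum => // j.
exact: smooth_on_exp.
Qed.

Lemma smooth_on_qdir (f : V -> H) : smooth_on U f ->
  (forall x, U x -> f x != 0) -> smooth_on U (fun x => qdir (f x)).
Proof.
move=> sf f0; apply: smooth_on_scale => //.
apply: (smooth_on_comp_real oU (smooth_on_powR _)).
  exact: smooth_on_sqnorm.
by move=> x Ux /=; rewrite sqnorm_gt0 f0.
Qed.

Lemma smooth_on_row (a : nat) (f : V -> 'M[R]_(a, 4)) i :
  smooth_on U f -> smooth_on U (fun x => row i (f x)).
Proof.
move=> /(smooth_on_mx f oU) sf; apply/smooth_on_rV4 => j.
apply: (@smooth_on_ext _ _ _ U (fun x => f x i j)) => //.
by move=> x _; rewrite mxE.
Qed.

Lemma smooth_on_rows (a : nat) (f : V -> 'M[R]_(a, 4)) :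
  (forall i, smooth_on U (fun x => row i (f x))) -> smooth_on U f.
Proof.
move=> sf; apply/(smooth_on_mx f oU) => i j.
have /smooth_on_rV4/(_ j) := sf i.
by apply: smooth_on_ext => // x _; rewrite mxE.
Qed.

End QuaternionSmooth.

(** * Facets of the cut simplex *)

Section FacetsOfPolyhedra.
Variables (R : realType) (m d : nat).
Variables (v : 'M[int]_(d, m.+1)) (lam : 'cV[R]_d).
Notation P := (polyhedron v lam).
Notation A := (map_mx intr v : 'M[R]_(d, m.+1)).
Hypothesis v0 : forall i, row i A != 0.
Hypothesis dimP : aff_dim P m.+1.

Definition tight (i : 'I_d) : set 'cV[R]_m.+1 :=
  P `&` [set x | (A *m x) i 0 = lam i 0].

Lemma slack_direction (x y : 'cV[R]_m.+1) :
  (forall i, (A *m x) i 0 < lam i 0) -> exists2 e : R, 0 < e & P (x + e *: y).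
Proof.
move=> xP; near (0 : R)^'+ => e; exists e => [//|i].
rewrite mulmxDr -scalemxAr !mxE -lerBrDl.
have gap : 0 < lam i 0 - (A *m x) i 0 by rewrite subr_gt0.
have D0 : 0 < 1 + `|(A *m y) i 0| by rewrite ltr_pwDl.
have : e < (lam i 0 - (A *m x) i 0) / (1 + `|(A *m y) i 0|).
  move: (i); near: e; apply: filter_forall => i'.
  by apply: nbhs_right_lt; rewrite divr_gt0 ?subr_gt0 // ltr_pwDl.
rewrite ltr_pdivlMr // !mxE => h; apply: le_trans (ltW h).
have e0 : 0 < e by [].
rewrite ler_pM2l // (le_trans (ler_norm _)) // lerDr.
Unshelve. all: by end_near. Qed.

(** Consider the barycentre of the affinely independent points. If no inequality were tight there,
    moving along [a^T] would leave the supporting half-space unless a = 0 and b = 0, which means F =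
    P. A tight one is tight at all these points, and the affine functions vanishing on them form a
    line, so the two equations are proportional. *)
Lemma facet_tight F : facet P F -> exists i, F = tight i.
Proof.
move=> [[a [b [ab FE]]] [[X [FX rX]] nF]].
have FneP : ~ (F = P) by move=> E; apply: nF; rewrite E; case: dimP.
have aX j : (a *m col j X) 0 0 = b by have := FX j; rewrite FE => -[].
have ab0 : ~ (a = 0 /\ b = 0).
  move=> [a0 b0]; apply: FneP; rewrite FE a0 b0; apply/seteqP; split=> [x []//|x Px].
  by split=> //=; rewrite mul0mx mxE.
pose xb : 'cV[R]_m.+1 := m.+1%:R^-1 *: \sum_j col j X.
have m1 : m.+1%:R != 0 :> R by rewrite pnatr_eq0.
have avg n (B : 'M[R]_(n, m.+1)) i :
    (B *m xb) i 0 = m.+1%:R^-1 * \sum_j (B *m col j X) i 0.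
  by rewrite /xb -scalemxAr mxE mulmx_sumr summxE.
clearbody xb.
have axb : (a *m xb) 0 0 = b.
  rewrite avg (eq_bigr (fun=> b)) => [|j _]; last exact: aX.
  by rewrite sumr_const card_ord -[b *+ _]mulr_natl mulKf.
have PX j i : (A *m col j X) i 0 <= lam i 0.
  by have := FX j; rewrite FE => -[+ _]; apply.
have [/forallP slack|] := boolP [forall i, (A *m xb) i 0 < lam i 0].
  have [e e0 Pe] := slack_direction a^T slack.
  exfalso; apply: ab0.
  have E : (a *m (xb + e *: a^T)) 0 0 = b + e * (a *m a^T) 0 0.
    by rewrite mulmxDr -scalemxAr -axb !(mxE _ _ _ 0).
  have := ab _ Pe; rewrite E gerDl pmulr_rle0 // [X in X <= _]mxE => h.
  have a0 : a = 0.
    apply/rowP => j; rewrite [RHS]mxE; apply/eqP; rewrite -sqrf_eq0; apply/eqP.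
    have sq (l : 'I_m.+1) : true -> 0 <= a 0 l * a^T l 0.
      by rewrite mxE -expr2 sqr_ge0.
    have s0 : \sum_l a 0 l * a^T l 0 = 0.
      by apply/eqP; rewrite eq_le h sumr_ge0.
    by have /psumr_eq0P/(_ s0 j isT) := sq; rewrite mxE -expr2.
  by split=> //; rewrite -axb a0 mul0mx mxE.
rewrite negb_forall => /existsP[i]; rewrite -leNgt => tight_i.
have iX j : (A *m col j X) i 0 = lam i 0.
  apply/eqP; rewrite eq_le PX /= leNgt; apply/negP => lt.
  move: tight_i; rewrite avg; apply/negP; rewrite -ltNge.
  rewrite ltr_pdivrMl ?ltr0n // (bigD1 j) //=.
  have -> : m.+1%:R * lam i 0 = lam i 0 + \sum_(j' | j' != j) lam i 0.
    rewrite sumr_const cardC1 card_ord mulr_natl mulrS //.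
  by apply: ltr_leD => //; apply: ler_sum => j' _.
(* Its left kernel consists of the affine functions that vanish at the columns of [X]. *)
pose M : 'M[R]_(m.+1 + 1, m.+1) := col_mx X (const_mx 1).
pose u1 : 'rV[R]_(m.+1 + 1) := row_mx (row i A) (- (lam i 0)%:M).
pose u2 : 'rV[R]_(m.+1 + 1) := row_mx a (- b%:M).
have kerE (r : 'rV[R]_m.+1) (t : R) : (forall j, (r *m col j X) 0 0 = t) ->
    row_mx r (- t%:M) *m M = 0.
  move=> rX'; rewrite mul_row_col; apply/rowP => j; rewrite !mxE.
  have := rX' j; rewrite !mxE => <-; rewrite big_ord1 !mxE eqxx mulr1n.
  rewrite mulr1; apply/eqP; rewrite subr_eq0; apply/eqP.
  by apply: eq_bigr => l _; rewrite !mxE.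
have u1K : (u1 <= kermx M)%MS.
  apply/sub_kermxP; apply: kerE => j; rewrite -(iX j) !mxE.
  by apply: eq_bigr => l _; rewrite !mxE.
have u2K : (u2 <= kermx M)%MS by apply/sub_kermxP; exact: kerE.
have rK : \rank (kermx M) = 1%N by rewrite mxrank_ker rX addn1 subSnn.
have u10 : u1 != 0.
  apply: contra (v0 i) => /eqP E; apply/eqP.
  by have := congr1 lsubmx E; rewrite row_mxKl lsubmx_const.
have Ku1 : (kermx M <= u1)%MS.
  by rewrite -(geq_leqif (mxrank_leqif_sup u1K)) rK lt0n mxrank_eq0.
have /sub_rVP[t tE] := submx_trans u2K Ku1.
have aE : a = t *: row i A.
  by have := congr1 lsubmx tE; rewrite scale_row_mx !row_mxKl.
have bE : b = t * lam i 0.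
  have := congr1 (fun r => rsubmx r 0 0) tE; rewrite scale_row_mx !row_mxKr !mxE.
  by rewrite !mulr1n mulrN => /oppr_inj.
have t0 : t != 0.
  by apply/eqP => t0; apply: ab0; rewrite aE bE t0 scale0r mul0r.
have axE x : (a *m x) 0 0 = t * (A *m x) i 0.
  by rewrite aE -scalemxAl -row_mul 2!mxE.
exists i; rewrite FE /tight; apply/seteqP; split=> x [Px /= xt]; split=> //=.
  by apply: (mulfI t0); rewrite -axE -bE.
by rewrite axE bE xt.
Qed.

Hypothesis cardF : ([set F | facet P F] #= `I_d)%card.

(** Every facet comes from some inequality, different facets from different ones, and there are as
    many of both. *)
Lemma all_tight_facets : (forall i, facet P (tight i)) /\ injective tight.
Proof.
have /card_set_bijP[f [fP fI _]] : (`I_d #= [set F | facet P F])%card.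
  by rewrite card_eq_sym.
have /choice[g gP] (j : 'I_d) : exists i, f j = tight i.
  by apply: facet_tight; apply: fP; exact: ltn_ord.
have gI : injective g.
  move=> j j' gE; apply/val_inj; apply: fI; rewrite ?inE ?ltn_ord //=.
  by rewrite !gP gE.
have gS i : exists j, g j = i.
  by have [h _ hK] := injF_bij gI; exists (h i).
split=> [i|i i' E].
  by have [j <-] := gS i; rewrite -gP; apply: fP; exact: ltn_ord.
have [j jE] := gS i; have [j' j'E] := gS i'.
suff jj : j = j' by rewrite -jE -j'E jj.
apply/val_inj; apply: fI; rewrite ?inE ?ltn_ord //=.
by rewrite !gP jE j'E.
Qed.

Lemma tight_nonempty i : exists x, tight i x.
Proof.
have [/(_ i)[_ [[X [FX _]] _]] _] := all_tight_facets.
by exists (col ord0 X); exact: FX.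
Qed.

(** Inequalities with equal normals, both attained on [P], have equal offsets, hence cut out the
    same facet. *)
Lemma rows_distinct i i' : row i v = row i' v -> i = i'.
Proof.
move=> E; have [_ tI] := all_tight_facets.
have AE x : (A *m x) i 0 = (A *m x) i' 0.
  rewrite !mxE; apply: eq_bigr => j _; rewrite !mxE; congr (intr _ * _).
  by have /rowP/(_ j) := E; rewrite !mxE.
have [x [Px xi]] := tight_nonempty i; have [y [Py yi]] := tight_nonempty i'.
have lE : lam i 0 = lam i' 0.
  apply/eqP; rewrite eq_le; apply/andP; split.
    by move: xi => /= <-; rewrite AE; exact: Px.
  by move: yi => /= <-; rewrite -AE; exact: Py.
by apply: tI; rewrite /tight lE; apply/seteqP; split=> z [Pz /= zE]; split=> //=;
  rewrite -zE.
Qed.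

End FacetsOfPolyhedra.

Section Barycentric.
Variables (R : realType) (m : nat).

(** The slacks of the simplex inequalities, that is, the barycentric coordinates. *)
Definition bary (x : 'cV[R]_m) (l : 'I_(m + 1)) : R :=
  simplex_offsets R m l 0 - (map_mx intr (simplex_normals m) *m x) l 0.

Lemma bary_lshift x (l : 'I_m) : bary x (lshift 1 l) = x l 0.
Proof.
rewrite /bary /simplex_offsets col_mxEu mxE sub0r /simplex_normals map_col_mx.
rewrite mul_col_mx col_mxEu !mxE (bigD1 l) //= big1 ?addr0 => [|j jl].
  by rewrite !mxE eqxx mulr1n mulN1r opprK.
by rewrite !mxE eq_sym (negPf jl) mulr0n oppr0 mul0r.
Qed.

Lemma bary_rshift x (l : 'I_1) : bary x (rshift m l) = 1 - \sum_i x i 0.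
Proof.
rewrite /bary /simplex_offsets col_mxEd /simplex_normals map_col_mx.
rewrite mul_col_mx col_mxEd !mxE (ord1 l) eqxx; congr (_ - _).
by apply: eq_bigr => i _; rewrite !mxE mul1r.
Qed.

Lemma sum_bary x : \sum_l bary x l = 1.
Proof.
rewrite big_split_ord big_ord1 /= bary_rshift.
under eq_bigr do rewrite bary_lshift.
by rewrite addrCA subrr addr0.
Qed.

Lemma bary_inj x y : (forall l, bary x l = bary y l) -> x = y.
Proof.
move=> E; apply/matrixP => l j; rewrite (ord1 j).
by have := E (lshift 1 l); rewrite !bary_lshift.
Qed.

Lemma bary_point (beta : 'I_(m + 1) -> R) : \sum_l beta l = 1 ->
  exists x, forall l, bary x l = beta l.
Proof.
move=> s1; exists (\col_i beta (lshift 1 i)) => l.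
case: (split_ordP l) => i ->; first by rewrite bary_lshift mxE.
rewrite bary_rshift (ord1 i) -[X in X - _]s1 big_split_ord big_ord1 /=.
by under [X in _ - X]eq_bigr do rewrite mxE; rewrite addrAC subrr add0r.
Qed.

End Barycentric.

Section Cuts.
Variables (R : realType) (m k : nat).
Variables (w : 'M[int]_(k, m.+1)) (mu : 'cV[R]_k).
Notation N := (simplex_normals m.+1).
Notation v := (col_mx N w).
Notation lam := (col_mx (simplex_offsets R m.+1) mu).
Notation Delta := (polyhedron N (simplex_offsets R m.+1)).
Notation P := (polyhedron v lam).

Lemma simplex_normals_neq0 (l : 'I_(m.+1 + 1)) : row l N != 0.
Proof.
apply/eqP => /rowP E; case: (split_ordP l) E => i -> E.
  by have := E i; rewrite mxE /simplex_normals col_mxEu !mxE eqxx.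
by have := E ord0; rewrite mxE /simplex_normals col_mxEd !mxE.
Qed.

Lemma normals_opp (l l' : 'I_(m.+1 + 1)) : m = 0%N -> l != l' ->
  - row l N = row l' N.
Proof.
move=> m0 ll'; apply/rowP => j.
have N0 (i : 'I_m.+1) : N (lshift 1 i) j = -1.
  rewrite /simplex_normals col_mxEu !mxE; suff -> : i = j by rewrite eqxx.
  by apply/val_inj; move: (ltn_ord i) (ltn_ord j) => /=; lia.
have N1 (i : 'I_1) : N (rshift m.+1 i) j = 1 by rewrite /simplex_normals col_mxEd mxE.
move: ll'; rewrite [LHS]mxE ![row _ _ _ _]mxE.
case: (split_ordP l) => i ->; case: (split_ordP l') => i' -> ll'.
- case/eqP: ll'; congr (lshift _ _); apply/val_inj.
  by move: (ltn_ord i) (ltn_ord i') => /=; lia.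
- by rewrite N0 N1 opprK.
- by rewrite N0 N1.
- by case/eqP: ll'; rewrite (ord1 i) (ord1 i').
Qed.

Lemma cut_structure :
  (forall j, exists i, row j w = row i N \/ row j w = - row i N) ->
  (forall i j, i != j -> Delta
     `&` [set x | mu i 0 <= (map_mx intr w *m x) i 0]
     `&` [set x | mu j 0 <= (map_mx intr w *m x) j 0] = set0) ->
  delzant P -> ([set F | facet P F] #= `I_(m.+1 + k + 1))%card ->
  exists idx : 'I_k -> 'I_(m.+1 + 1),
    let c j := mu j 0 + simplex_offsets R m.+1 (idx j) 0 in
    [/\ injective idx, forall j, row j w = - row (idx j) N,
        forall j, 0 < c j < 1, forall i j, i != j -> 1 < c i + c j &
        (0 < k)%N -> (0 < m)%N].
Proof.
move=> par disj [_ _ dimP _] cardF.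
have {}cardF : ([set F | facet P F] #= `I_(m.+1 + 1 + k))%card.
  by rewrite (addnAC m.+1 k 1) in cardF.
have rowv l : row (lshift k l) v = row l N by rewrite rowKu.
have roww j : row (rshift _ j) v = row j w by rewrite rowKd.
have intr0 (u : 'rV[int]_m.+1) : (map_mx intr u == 0 :> 'rV[R]_m.+1) = (u == 0).
  apply/eqP/eqP => [/rowP E|->]; last exact: map_mx0.
  apply/rowP => j; have := E j; rewrite !mxE => /eqP.
  by rewrite intr_eq0 => /eqP.
have v0 l : row l (map_mx intr v : 'M[R]__) != 0.
  rewrite -map_row intr0; case: (split_ordP l) => i ->.
    by rewrite rowv simplex_normals_neq0.
  rewrite roww; have [i' [->|->]] := par i; first exact: simplex_normals_neq0.
  by rewrite oppr_eq0 simplex_normals_neq0.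
have [allF tI] := all_tight_facets v0 dimP cardF.
have dist := rows_distinct v0 dimP cardF.
have nonempty := tight_nonempty v0 dimP cardF.
(* A cut with the same normal as a facet of the simplex would contradict [rows_distinct]. *)
have /choice[idx idxP] (j : 'I_k) : exists i, row j w = - row i N.
  have [i [E|E]] := par j; last by exists i.
  have : rshift (m.+1 + 1) j = lshift k i by apply: dist; rewrite rowv roww.
  by move/eqP; rewrite eq_rlshift.
exists idx => c.
have idxI : injective idx.
  move=> j j' E; apply: (@rshift_inj (m.+1 + 1)); apply: dist.
  by rewrite !roww !idxP E.
have wE x j : (map_mx intr w *m x : 'cV[R]__) j 0 =
    bary x (idx j) - (c j - mu j 0).
  have -> : bary x (idx j) - (c j - mu j 0) =
      - (map_mx intr N *m x : 'cV[R]__) (idx j) 0 by rewrite /bary /c; ring.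
  rewrite !mxE -sumrN; apply: eq_bigr => l _; rewrite !mxE.
  have /rowP/(_ l) := idxP j; rewrite !mxE => ->.
  by rewrite -mulNr -[in RHS]rmorphN.
have PE x : P x <-> (forall l, 0 <= bary x l) /\ forall j, bary x (idx j) <= c j.
  split=> [Px|[xb xc] i].
    split=> [l|j].
      have := Px (lshift k l); rewrite map_col_mx mul_col_mx !col_mxEu.
      by rewrite /bary subr_ge0.
    have := Px (rshift _ j); rewrite map_col_mx mul_col_mx !col_mxEd wE.
    by lra.
  rewrite map_col_mx mul_col_mx; case: (split_ordP i) => l ->.
    by rewrite !col_mxEu; have := xb l; rewrite /bary subr_ge0.
  by rewrite !col_mxEd wE; have := xc l; lra.
have tightl x l : tight v lam (lshift k l) x <-> P x /\ bary x l = 0.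
  split=> -[Px /= E]; split=> //=; move: E.
    by rewrite map_col_mx mul_col_mx !col_mxEu /bary => ->; rewrite subrr.
  rewrite map_col_mx mul_col_mx !col_mxEu /bary => /eqP.
  by rewrite subr_eq0 => /eqP ->.
have tightr x j : tight v lam (rshift _ j) x <-> P x /\ bary x (idx j) = c j.
  split=> -[Px /= E]; split=> //=; move: E.
    by rewrite map_col_mx mul_col_mx !col_mxEd wE; lra.
  by rewrite map_col_mx mul_col_mx !col_mxEd wE; lra.
(* On a segment the two normals are opposite, so a cut would repeat the normal of the other end. *)
have m0 : (0 < k)%N -> (0 < m)%N.
  move=> k0; rewrite lt0n; apply/negP => /eqP m0; pose j := Ordinal k0.
  have [l' ll'] : exists l', idx j != l'.
    have [/eqP E|E] := eqVneq (idx j) (lshift 1 ord0).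
      by exists (rshift m.+1 ord0); rewrite (eqP E) eq_lrshift.
    by exists (lshift 1 ord0).
  have E := normals_opp m0 ll'.
  have : rshift (m.+1 + 1) j = lshift k l' by apply: dist; rewrite rowv roww idxP.
  by move/eqP; rewrite eq_rlshift.
(* At [c j = 0] the cut would have the same facet as the simplex inequality [idx j]. *)
have c0 j : 0 < c j.
  have [x /tightr[/PE[xb _] xE]] := nonempty (rshift _ j).
  rewrite lt_def -{2}xE xb andbT; apply/eqP => cj0.
  have : rshift (m.+1 + 1) j = lshift k (idx j).
    apply: tI; apply/seteqP; split=> y.
      by move/tightr=> [Py yE]; apply/tightl; rewrite yE.
    by move/tightl=> [Py yE]; apply/tightr; rewrite yE.
  by move/eqP; rewrite eq_rlshift.
(* At [c j = 1] the facet of the cut would shrink to the vertex opposite to the facet [idx j], and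
   could not hold two affinely independent points. *)
have c1 j : c j < 1.
  have [x /tightr[/PE[xb _] xE]] := nonempty (rshift _ j).
  have le1 y l : (forall l, 0 <= bary y l) -> bary y l <= 1.
    by move=> yb; rewrite -(sum_bary y) (bigD1 l) //= lerDl sumr_ge0.
  rewrite lt_def -{2}xE le1 // andbT; apply/eqP => cj1.
  have m1 : (0 < m)%N by apply: m0; exact: leq_ltn_trans (ltn_ord j).
  have [_ [[X [FX rX]] _]] := allF (rshift _ j).
  have Xeq i i' : col i X = col i' X.
    have zero y l : tight v lam (rshift _ j) y -> l != idx j -> bary y l = 0.
      move=> /tightr[/PE[yb _] yE] lj.
      have : \sum_(l | l != idx j) bary y l = 0.
        have := sum_bary y; rewrite (bigD1 (idx j)) //= yE -cj1.
        by move/eqP; rewrite -subr_eq0 addrAC subrr add0r => /eqP.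
      by move/psumr_eq0P; apply.
    apply: bary_inj => l; have [->|lj] := eqVneq l (idx j).
      by have /tightr[_ ->] := FX i; have /tightr[_ ->] := FX i'.
    by rewrite !zero.
  pose M : 'M[R]_(m.+1 + 1, m.+1) := col_mx X (const_mx 1).
  pose i1 : 'I_m.+1 := Ordinal (m1 : (1 < m.+1)%N).
  pose z : 'cV[R]_m.+1 := delta_mx ord0 0 - delta_mx i1 0.
  have Mz : M *m z = 0.
    rewrite mul_col_mx !mulmxBr -!colE (Xeq _ i1) subrr.
    by rewrite !col_const subrr col_mx0.
  have : z^T *m M^T = 0 by rewrite -trmx_mul Mz trmx0.
  rewrite -(mul0mx _ M^T) => /(row_free_inj _).
  rewrite /row_free mxrank_tr rX eqxx => /(_ isT) /(congr1 trmx).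
  rewrite trmxK trmx0 => /matrixP/(_ ord0 0); rewrite !mxE eqxx /=.
  by rewrite subr0 => /eqP; rewrite oner_eq0.
split=> // [j|i j ij]; first by rewrite c0 c1.
rewrite ltNge; apply/negP => cij.
have ij' : idx j != idx i by rewrite (inj_eq idxI) eq_sym.
(* If c_i + c_j <= 1, this point on an edge of the simplex lies in both pieces that are cut off. *)
have [x xE] : exists x, forall l, bary x l =
    (if l == idx i then c i else if l == idx j then 1 - c i else 0).
  apply: bary_point; rewrite (bigD1 (idx i)) //= eqxx (bigD1 (idx j)) //=.
  rewrite (negPf ij') eqxx big1 ?addr0 => [|l /andP[/negPf -> /negPf ->] //].
  by rewrite addrC subrK.
have := disj i j ij; apply/eqP/set0P; exists x; split; first split.
- move=> l; have : 0 <= bary x l.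
    by rewrite xE; case: ifP => _; [exact: ltW|case: ifP => _ //; rewrite subr_ge0 ltW].
  by rewrite /bary subr_ge0.
- by rewrite /= wE xE eqxx; lra.
- by rewrite /= wE xE (negPf ij') eqxx; move: cij; rewrite -/(c i) -/(c j); lra.
Qed.

End Cuts.

(** * The action as a gauge action on a graph *)

Section GraphAction.
Variables (R : realType) (d n : nat) (e : extension d n).
Notation V := 'M[R]_(d, 4).
Notation node := (option 'I_n).

(* The action of Sp(1)^n seen on a graph: the vertices are the n factors and one
   vertex None carrying the trivial group, the coordinate l is the edge from
   [src l] to [tgt l], on which h acts by q |-> h_src q h_tgt^-1. *)
Definition src (l : 'I_d) : node := if lexp e l then Some (lidx e l) else None.
Definition tgt (l : 'I_d) : node := if rexp e l then Some (ridx e l) else None.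

Definition at_node (h : 'M[R]_(n, 4)) (a : node) : 'rV[R]_4 :=
  if a is Some i then row i h else qone R.

Lemma row_ext_act h (q : V) l : row l (ext_act e h q) =
  qmul (qmul (at_node h (src l)) (row l q)) (qconj (at_node h (tgt l))).
Proof.
rewrite rowK /src /tgt; case: (lexp e l); case: (rexp e l) => //=.
  by rewrite qconj1.
by rewrite qconj1.
Qed.

Lemma at_node_Sp1 h a : Sp1 h -> sqnorm (at_node h a) = 1.
Proof. by move=> h1; case: a => [i|] /=; [exact: h1|exact: sqnorm1]. Qed.

Lemma at_node_cmul h h' a :
  at_node (cmul h h') a = qmul (at_node h a) (at_node h' a).
Proof. by case: a => [i|] /=; rewrite ?rowK ?qmul1q. Qed.

Lemma ext_act_cmul h h' (q : V) :
  ext_act e (cmul h h') q = ext_act e h (ext_act e h' q).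
Proof.
apply/row_matrixP => l; rewrite !row_ext_act !at_node_cmul qconjM.
by rewrite !qmulA.
Qed.

Definition inv_Sp1 (h : 'M[R]_(n, 4)) : 'M[R]_(n, 4) := \matrix_i qconj (row i h).

Lemma at_node_inv h a : at_node (inv_Sp1 h) a = qconj (at_node h a).
Proof. by case: a => [i|] /=; rewrite ?rowK ?qconj1. Qed.

Lemma Sp1_inv h : Sp1 h -> Sp1 (inv_Sp1 h).
Proof. by move=> h1 i; rewrite rowK sqnorm_conj; exact: h1. Qed.

Lemma Sp1_cmul (h h' : 'M[R]_(n, 4)) : Sp1 h -> Sp1 h' -> Sp1 (cmul h h').
Proof. by move=> h1 h'1 i; rewrite rowK sqnormM h1 h'1 mulr1. Qed.

Lemma ext_actK h (q : V) : Sp1 h -> ext_act e (inv_Sp1 h) (ext_act e h q) = q.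
Proof.
move=> h1; apply/row_matrixP => l; rewrite !row_ext_act !at_node_inv qconjK.
rewrite -!qmulA unit_VmulK ?at_node_Sp1 // unit_Vmul ?at_node_Sp1 //.
by rewrite qmulq1.
Qed.

Lemma sqnorm_ext_act h (q : V) l : Sp1 h ->
  sqnorm (row l (ext_act e h q)) = sqnorm (row l q).
Proof.
move=> h1; rewrite row_ext_act !sqnormM sqnorm_conj !at_node_Sp1 //.
by rewrite mul1r mulr1.
Qed.

Lemma Sp1_one : @Sp1 R n (\matrix_i qone R).
Proof. by move=> i; rewrite rowK sqnorm1. Qed.

Lemma ext_act_one (q : V) : ext_act e (\matrix_i qone R) q = q.
Proof.
apply/row_matrixP => l; rewrite row_ext_act.
have E a : at_node (\matrix_i qone R) a = qone R by case: a => [i|] //=; rewrite rowK.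
by rewrite !E qconj1 qmul1q qmulq1.
Qed.

Lemma ext_orbit_refl (q : V) : ext_orbit e q q.
Proof. by exists (\matrix_i qone R); [exact: Sp1_one|exact: ext_act_one]. Qed.

Lemma ext_orbitP (q q' : V) :
  ext_orbit e q = ext_orbit e q' <-> exists2 h, Sp1 h & q' = ext_act e h q.
Proof.
split=> [E|[h h1 ->]].
  by have := ext_orbit_refl q'; rewrite -E => -[h h1 <-]; exists h.
apply/seteqP; split=> _ [g g1 <-].
  exists (cmul g (inv_Sp1 h)); first by apply: Sp1_cmul => //; exact: Sp1_inv.
  by rewrite ext_act_cmul ext_actK.
exists (cmul g h); first exact: Sp1_cmul.
by rewrite ext_act_cmul.
Qed.

Lemma continuous_ext_act h : continuous (ext_act e h : V -> V).
Proof.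
have S : smooth_on setT (ext_act e h : V -> V).
  apply: (smooth_on_rows openT) => l; under eq_fun do rewrite row_ext_act.
  apply: (smooth_on_qmul openT); last exact: (smooth_on_cst _ openT).
  apply: (smooth_on_qmul openT); first exact: (smooth_on_cst _ openT).
  apply: (smooth_on_row openT).
  by apply/(smooth_on_mx _ openT) => i j; exact: (smooth_on_coord _ _ openT).
by move=> x; exact: smooth_on_continuous S I.
Qed.

(* The edges of S connect every vertex to None. *)
Definition spanning (S : {set 'I_d}) : Prop := forall C : {set node},
  None \in C -> (forall l, l \in S -> (src l \in C) = (tgt l \in C)) ->
  forall a, a \in C.

Definition support_on (S : {set 'I_d}) : set V :=
  [set q | forall l, l \in S -> row l q != 0].

Lemma open_support_on S : open (support_on S).
Proof.
rewrite openE => q Uq; rewrite /interior /support_on.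
near=> q' => l; move: l; near: q'; apply: filter_forall => l.
have [lS|lS] := boolP (l \in S); last by apply: nearW.
have sN : smooth_on setT (fun q' : V => sqnorm (row l q')).
  apply: (smooth_on_sqnorm openT); apply: (smooth_on_row openT).
  by apply/(smooth_on_mx _ openT) => i j; exact: (smooth_on_coord _ _ openT).
have oP : open [set q' : V | 0 < sqnorm (row l q')].
  have : continuous (fun q' : V => sqnorm (row l q')).
    by move=> x; exact: smooth_on_continuous sN I.
  by move/continuousP/(_ _ (@open_gt R 0)).
have : nbhs q [set q' : V | 0 < sqnorm (row l q')].
  by move: oP; rewrite openE; apply; rewrite /= sqnorm_gt0 Uq.
by apply: filterS => q' /=; rewrite sqnorm_gt0.
Unshelve. all: by end_near. Qed.

(** Where [q] is positive before and after the action, its norm fixes its value, so [h] agrees at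
    the two ends of an edge of [S]. The vertices where [h] is 1 thus include [None] and are closed
    along [S]. *)
Lemma spanning_rigid S h (q : V) : spanning S -> Sp1 h ->
  (forall l, l \in S -> exists2 r, 0 < r & row l q = r *: qone R) ->
  (forall l, l \in S -> exists2 r, 0 < r &
     row l (ext_act e h q) = r *: qone R) ->
  ext_act e h q = q.
Proof.
move=> spS h1 qS hqS.
have Hall : forall a, a \in [set a | at_node h a == qone R]%SET.
  apply: spS => [|l lS]; first by rewrite inE.
  have [r r0 qE] := qS l lS; have [r' r'0] := hqS l lS.
  rewrite row_ext_act qE qmulr_real qmulZl => E.
  have rr : r = r'.
    have := congr1 (@qabs R 1 4) E.
    rewrite -{1}[qmul _ _]qmul1q -qmulZl qabsM !qabs_real ?(ltW r0) ?(ltW r'0) //.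
    by rewrite qabsM qabs_conj !qabs_unit ?at_node_Sp1 // !mulr1.
  have {}E : qmul (at_node h (src l)) (qconj (at_node h (tgt l))) = qone R.
    by apply: (@scalerI _ _ r); [rewrite gt_eqF|rewrite E rr].
  rewrite !inE; have -> : at_node h (src l) = at_node h (tgt l).
    have := congr1 (fun x => qmul x (at_node h (tgt l))) E.
    by rewrite mulV_unitK ?at_node_Sp1 // qmul1q.
  by [].
have hE : h = \matrix_i qone R.
  apply/row_matrixP => i; rewrite rowK.
  by have := Hall (Some i); rewrite inE => /eqP.
by rewrite hE ext_act_one.
Qed.

(** A spanning tree grows from [None]. While vertices are missing, some edge of [S] leaves the part
    already reached; the value at its new end is chosen to cancel the direction of the coordinate, a
    smooth function where the coordinate is nonzero. As #|S| = n, the n steps exhaust [S]. *)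
Lemma gauge_exists S : spanning S -> #|S| = n ->
  exists G : V -> 'M[R]_(n, 4), smooth_on (support_on S) G /\
    forall q, support_on S q -> Sp1 (G q) /\ forall l, l \in S ->
      row l (ext_act e (G q) q) = qabs (row l q) *: qone R.
Proof.
move=> spS cardS; have oS : open (support_on S) by exact: open_support_on.
pose fixes (g : node -> V -> 'rV[R]_4) (l : 'I_d) := forall q, support_on S q ->
  qmul (qmul (g (src l) q) (row l q)) (qconj (g (tgt l) q)) =
  qabs (row l q) *: qone R.
have grow j : (j <= n)%N -> exists (C : {set node}) (E : {set 'I_d})
    (g : node -> V -> 'rV[R]_4),
  [/\ [/\ None \in C, E \subset S, #|E| = j & #|C| = j.+1],
      forall l, l \in E -> src l \in C /\ tgt l \in C,
      g None = cst (qone R),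
      forall a, smooth_on (support_on S) (g a) /\
        forall q, support_on S q -> sqnorm (g a q) = 1 &
      forall l, l \in E -> fixes g l].
  elim: j => [_|j IH jn].
    exists [set None]%SET, finset.set0, (fun=> cst (qone R)); split=> //.
    - by rewrite inE finset.sub0set cards0 cards1.
    - by move=> l; rewrite inE.
    - by move=> a; split=> [|q _]; [exact: smooth_on_cst|rewrite sqnorm1].
    - by move=> l; rewrite inE.
  have [C [E [g [[NC ES cE cC] EC gN gs gE]]]] := IH (ltnW jn).
  have [l lS cross] : exists2 l, l \in S & (src l \in C) != (tgt l \in C).
    apply/exists_inP; rewrite -negb_forall_in; apply/negP => /forall_inP H.
    have CT : forall a, a \in C by apply: spS => // l /H /eqP.
    have : #|C| = n.+1.
      rewrite (eq_card (B := predT)) => [|a]; last by rewrite CT.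
      by rewrite card_option card_ord.
    by rewrite cC => -[jn']; move: jn; rewrite jn' ltnn.
  have lE : l \notin E.
    by apply/negP => /EC[sC tC]; move: cross; rewrite sC tC.
  have sdir : smooth_on (support_on S) (fun q => qdir (row l q)).
    apply: smooth_on_qdir => //; last by move=> q; exact.
    apply: smooth_on_row => //; apply/(smooth_on_mx _ oS) => i i'.
    exact: smooth_on_coord.
  (* One step, for either orientation of the edge [l] that leaves [C]; the new vertex is [b], with
     value [x]. *)
  have extend b x : b \notin C -> smooth_on (support_on S) x ->
      (forall q, support_on S q -> sqnorm (x q) = 1) ->
      (src l = b /\ tgt l \in C \/ tgt l = b /\ src l \in C) ->
      fixes (fun a => if a == b then x else g a) l ->
      exists (C : {set node}) (E : {set 'I_d}) (g : node -> V -> 'rV[R]_4),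
      [/\ [/\ None \in C, E \subset S, #|E| = j.+1 & #|C| = j.+2],
      forall l, l \in E -> src l \in C /\ tgt l \in C,
      g None = cst (qone R),
      forall a, smooth_on (support_on S) (g a) /\
        forall q, support_on S q -> sqnorm (g a q) = 1 &
      forall l, l \in E -> fixes g l].
    move=> bC sx x1 lb fl.
    exists (b |: C)%SET, (l |: E)%SET, (fun a => if a == b then x else g a).
    have neb a : a \in C -> a == b = false.
      by move=> aC; apply/negP => /eqP ab; move: bC; rewrite -ab aC.
    split.
    - split; first by rewrite !inE NC orbT.
      + by apply/fintype.subsetP => l'; rewrite !inE => /orP[/eqP ->//|];
          move/fintype.subsetP: ES; apply.
      + by rewrite cardsU1 lE cE.
      + by rewrite cardsU1 bC cC.
    - move=> l'; rewrite !inE => /orP[/eqP ->|/EC[-> ->]]; last by rewrite !orbT.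
      by case: lb => -[-> ->]; rewrite eqxx orbT.
    - by rewrite neb.
    - move=> a; case: ifP => _; [by split|exact: gs].
    - move=> l'; rewrite !inE => /orP[/eqP -> //|l'E] q Uq.
      have [sC tC] := EC l' l'E; rewrite !neb //; exact: gE.
  have [sC|sC] := boolP (src l \in C).
    have tC : tgt l \notin C by move: cross; rewrite sC; case: (tgt l \in C).
    apply: (extend (tgt l) (fun q => qmul (g (src l) q) (qdir (row l q)))) => //.
    - by apply: smooth_on_qmul => //; case: (gs (src l)).
    - move=> q Uq; have [_ g1] := gs (src l); rewrite sqnormM g1 // sqnorm_dir ?mulr1 //.
      exact: Uq.
    - by right.
    move=> q Uq; rewrite eqxx; case: eqP => [st|_].
      by move: tC; rewrite -st sC.
    have [_ g1] := gs (src l); rewrite qconjM {1}(qabs_dir (Uq l lS)).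
    rewrite qmulZr qmulZl -qmulA [X in qmul _ X]qmulA unit_mulV ?sqnorm_dir //; last exact: Uq.
    by rewrite qmul1q unit_mulV // g1.
  have tC : tgt l \in C by move: cross; rewrite (negPf sC); case: (tgt l \in C).
  apply: (extend (src l) (fun q => qmul (g (tgt l) q) (qconj (qdir (row l q))))) => //.
  - apply: smooth_on_qmul => //; first by case: (gs (tgt l)).
    exact: smooth_on_qconj.
  - move=> q Uq; have [_ g1] := gs (tgt l); rewrite sqnormM g1 // sqnorm_conj.
    by rewrite sqnorm_dir ?mulr1 //; exact: Uq.
  - by left.
  move=> q Uq; rewrite eqxx; case: eqP => [st|_].
    by move: sC; rewrite -st tC.
  have [_ g1] := gs (tgt l).
  have u1 : sqnorm (qdir (row l q)) = 1 by rewrite sqnorm_dir // Uq.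
  have zE := qabs_dir (Uq l lS).
  move: (qdir (row l q)) u1 zE => u u1 zE; rewrite [in LHS]zE qmulZr qmulZl.
  by rewrite -[X in qmul X _]qmulA unit_Vmul // qmulq1 unit_mulV // g1.
have [C [E [g [[NC ES cE cC] EC gN gs gE]]]] := grow n (leqnn n).
have ESe : E = S by apply/eqP; rewrite eqEcard ES cardS cE leqnn.
pose G (q : V) : 'M[R]_(n, 4) := \matrix_i g (Some i) q.
exists G; split.
  apply: smooth_on_rows => // i; under eq_fun do rewrite rowK.
  by case: (gs (Some i)).
have GE q a : at_node (G q) a = g a q.
  by case: a => [i|] /=; rewrite ?rowK ?gN.
move=> q Uq; split=> [i|l lS].
  by rewrite rowK; case: (gs (Some i)) => _; exact.
by rewrite row_ext_act !GE; apply: gE => //; rewrite ESe.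
Qed.

End GraphAction.

(** * The level set and the kernel torus *)

Section CircleAngles.
Variable R : realType.
Implicit Types (x y : R).

Lemma qcisE x : (qcis x 0 0 = cos (2 * pi * x)) * (qcis x 0 1 = sin (2 * pi * x)) *
  (qcis x 0 2 = 0) * (qcis x 0 3 = 0).
Proof. by rewrite !mxE. Qed.

Lemma qcisD x y : qcis (x + y) = qmul (qcis x) (qcis y).
Proof.
apply: quat_ext; rewrite qmulE !qcisE; do ?by rewrite !(mulr0, mul0r, addr0, subr0).
  by rewrite mulrDr cosD; ring.
by rewrite mulrDr sinD; ring.
Qed.

Lemma sqnorm_qcis x : sqnorm (qcis x) = 1.
Proof. by rewrite sqnormE !qcisE !expr0n /= !addr0 cos2Dsin2. Qed.

Lemma qcis_int x : x \is a Num.int -> qcis x = qone R.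
Proof.
have nat1 (n : nat) : qcis (n%:R : R) = qone R.
  elim: n => [|n IH].
    by apply: quat_ext; rewrite !qcisE !qoneE ?mulr0 ?cos0 ?sin0.
  rewrite -natr1 qcisD IH qmul1q; apply: quat_ext; rewrite !qcisE !qoneE // mulr1.
    by rewrite mulr_natl cos2pi.
  by rewrite mulr_natl sin2pi.
move=> /intrP[[n|n] ->]; first exact: nat1.
rewrite NegzE mulrNz -[LHS]qmulq1 -[X in qmul _ X](nat1 n.+1) -qcisD.
by rewrite addNr -[0]/(0%:R) nat1.
Qed.

Lemma qcis_surj (q : 'rV[R]_4) : sqnorm q = 1 -> q 0 2 = 0 -> q 0 3 = 0 ->
  exists x, q = qcis x.
Proof.
rewrite sqnormE => + q2 q3; rewrite q2 q3 !expr0n /= !addr0 => q1.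
have le1 : -1 <= q 0 0 <= 1.
  by rewrite -ler_norml -(@ler_pXn2r _ 2) ?nnegrE // real_normK ?num_real //; nra.
have c1 : cos (acos (q 0 0)) = q 0 0 by rewrite acosK // in_itv.
have s1 : sin (acos (q 0 0)) ^+ 2 = q 0 1 ^+ 2.
  have := cos2Dsin2 (acos (q 0 0)); rewrite c1; lra.
have p0 : 2 * pi != 0 :> R by rewrite mulf_neq0 ?pnatr_eq0 // gt_eqF ?pi_gt0.
have [/eqP e|/eqP e] : q 0 1 == sin (acos (q 0 0)) \/
    q 0 1 == - sin (acos (q 0 0)).
  by move/eqP: s1; rewrite eq_sym eqf_sqr => /orP.
  exists (acos (q 0 0) / (2 * pi)).
  by apply: quat_ext; rewrite !qcisE // mulrC divfK.
exists (- acos (q 0 0) / (2 * pi)).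
by apply: quat_ext; rewrite !qcisE // mulrC divfK // ?cosN ?sinN.
Qed.

End CircleAngles.

Section ToricData.
Variables (R : realType) (m k : nat) (w : 'M[int]_(k, m)) (mu : 'cV[R]_k).
Variable idx : 'I_k -> 'I_(m + 1).
Notation N := (simplex_normals m).
Notation v := (col_mx N w).
Notation lam := (col_mx (simplex_offsets R m) mu).
Notation d := (m + 1 + k)%N.
Hypothesis idxI : injective idx.
Hypothesis wE : forall j, row j w = - row (idx j) N.
Let c j := mu j 0 + simplex_offsets R m (idx j) 0.

Definition edge_l (l : 'I_(m + 1)) : 'I_d := lshift k l.
Definition edge_t (j : 'I_k) : 'I_d := rshift (m + 1) j.
(** The coefficient of the simplex normal [l] in [xi *m v], because row j of [w] is minus the normal
    [idx j]. The simplex normals have one relation, their sum being 0, so ker pi is given by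
    constancy of [cut_coord]. *)
Definition cut_coord (xi : 'rV[R]_d) l : R :=
  xi 0 (edge_l l) - \sum_(j | idx j == l) xi 0 (edge_t j).

Lemma cut_coord_idx xi j : cut_coord xi (idx j) = xi 0 (edge_l (idx j)) - xi 0 (edge_t j).
Proof.
rewrite /cut_coord (bigD1 j) //= big1 ?addr0 // => j' /andP[/eqP/idxI ->].
by rewrite eqxx.
Qed.

Lemma cut_coord_uncut xi l : (forall j, idx j != l) ->
  cut_coord xi l = xi 0 (edge_l l).
Proof.
by move=> un; rewrite /cut_coord big1 ?subr0 // => j; rewrite (negPf (un j)).
Qed.

Lemma mul_normals xi j : (xi *m map_mx intr v) 0 j =
  cut_coord xi (rshift m 0) - cut_coord xi (lshift 1 j).
Proof.
have -> : (xi *m map_mx intr v) 0 j = \sum_l cut_coord xi l * (N l j)%:~R.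
  rewrite mxE big_split_ord /=; under [RHS]eq_bigr do rewrite mulrBl.
  rewrite sumrB; congr (_ + _).
    by apply: eq_bigr => l _; rewrite mxE col_mxEu.
  under [X in _ = - X]eq_bigr => l _ do rewrite mulr_suml.
  rewrite (exchange_big_dep predT) //= -sumrN; apply: eq_bigr => i _.
  rewrite (big_pred1 (idx i)) => [|l]; last by rewrite /= eq_sym.
  rewrite mxE col_mxEd -mulrN -mulrNz; congr (_ * _%:~R).
  by have := congr1 (fun r : 'rV[int]_m => r 0 j) (wE i); rewrite !mxE.
rewrite big_split_ord /= big_ord1 addrC; congr (_ + _).
  by rewrite (_ : ord0 = 0) // /simplex_normals col_mxEd mxE mulr1.
rewrite (bigD1 j) //= big1 => [|l lj].
  by rewrite /simplex_normals col_mxEu !mxE eqxx mulr1n mulrN mulr1 addr0.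
by rewrite /simplex_normals col_mxEu !mxE (negPf lj) mulr0n oppr0 mulr0.
Qed.

Lemma mul_normals_eq0 xi : xi *m map_mx intr v = 0 ->
  forall l, cut_coord xi l = cut_coord xi (rshift m 0).
Proof.
move=> x0 l; case: (split_ordP l) => [j ->|j ->]; last by rewrite (ord1 j).
have := congr1 (fun r : 'rV[R]_m => r 0 j) x0; rewrite mul_normals mxE => /eqP.
by rewrite subr_eq0 => /eqP.
Qed.

Definition quartic (q : 'M[R]_(d, 4)) a : R := sqnorm (row a q) ^+ 2.

Lemma level_setP q : level_set v lam q <->
  \sum_l quartic q (edge_l l) = 4 /\
  forall j, quartic q (edge_l (idx j)) + quartic q (edge_t j) = 4 * c j.
Proof.
have off1 : \sum_l simplex_offsets R m l 0 = 1.
  rewrite big_split_ord /= big_ord1 /simplex_offsets col_mxEd mxE eqxx.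
  by rewrite big1 ?add0r // => l _; rewrite col_mxEu mxE.
have sl l : sigma lam q (edge_l l) 0 =
    - 4^-1 * quartic q (edge_l l) + simplex_offsets R m l 0.
  by rewrite mxE col_mxEu.
have st j : sigma lam q (edge_t j) 0 = - 4^-1 * quartic q (edge_t j) + mu j 0.
  by rewrite mxE col_mxEd.
(* On ker pi the first sum has a constant coefficient and the coefficients in the second are free,
   so the equations of the level set can be read off. *)
have sumE (xi : 'rV[R]_d) : (xi *m sigma lam q) 0 0 =
    \sum_l cut_coord xi l * sigma lam q (edge_l l) 0 + \sum_j xi 0 (edge_t j) *
      (c j - 4^-1 * (quartic q (edge_l (idx j)) + quartic q (edge_t j))).
  have xlE l : xi 0 (edge_l l) =
      cut_coord xi l + \sum_(j | idx j == l) xi 0 (edge_t j) by rewrite subrK.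
  rewrite [LHS]mxE big_split_ord /=.
  under [X in X + _]eq_bigr => l _ do rewrite -/(edge_l l) xlE mulrDl.
  rewrite big_split /= -addrA; congr (_ + _).
  under [X in X + _]eq_bigr => l _ do rewrite mulr_suml.
  rewrite (exchange_big_dep predT) //= -big_split; apply: eq_bigr => j _ /=.
  rewrite (big_pred1 (idx j)) => [|l]; last by rewrite /= eq_sym.
  rewrite -/(edge_t j) sl st /c; ring.
have tot : \sum_l sigma lam q (edge_l l) 0 = - 4^-1 * (\sum_l quartic q (edge_l l)) + 1.
  by under eq_bigr do rewrite sl; rewrite big_split /= off1 mulr_sumr.
split=> [Zq|[q4 qc] xi /mul_normals_eq0 y0].
  split.
    pose xi : 'rV[R]_d := row_mx (const_mx 1) 0.
    have y1 l : cut_coord xi l = 1.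
      rewrite /cut_coord row_mxEl mxE big1 ?subr0 // => j _.
      by rewrite row_mxEr mxE.
    have : xi *m map_mx intr v = 0.
      by apply/rowP => j; rewrite mul_normals !y1 subrr mxE.
    move/Zq/(congr1 (fun r : 'rV[R]_1 => r 0 0)); rewrite sumE [RHS]mxE.
    under eq_bigr do rewrite y1 mul1r.
    rewrite tot [X in _ + X]big1 => [|j _]; first by lra.
    by rewrite row_mxEr mxE mul0r.
  move=> j; pose xi : 'rV[R]_d := row_mx (delta_mx 0 (idx j)) (delta_mx 0 j).
  have y0 l : cut_coord xi l = 0.
    rewrite /cut_coord row_mxEl mxE eqxx /=.
    under eq_bigr do rewrite row_mxEr mxE eqxx /=.
    case: (eqVneq l (idx j)) => [->|lj].
      rewrite (bigD1 j) //= eqxx big1 ?addr0 ?subrr // => i /andP[_ ij].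
      by rewrite (negPf ij).
    rewrite big1 ?subrr // => i /eqP il; rewrite -il in lj.
    by case: (eqVneq i j) lj => // ->; rewrite eqxx.
  have : xi *m map_mx intr v = 0.
    by apply/rowP => i; rewrite mul_normals !y0 subrr mxE.
  move/Zq/(congr1 (fun r : 'rV[R]_1 => r 0 0)); rewrite sumE [RHS]mxE.
  rewrite big1 => [|l _]; last by rewrite y0 mul0r.
  rewrite (bigD1 j) //= row_mxEr mxE !eqxx mul1r [X in _ + (_ + X)]big1.
    by rewrite add0r addr0 => /eqP; rewrite subr_eq0 => /eqP ->; rewrite mulVKf ?pnatr_eq0.
  by move=> i /negPf ij; rewrite row_mxEr mxE eqxx ij mul0r.
apply/rowP => i; rewrite (ord1 i) sumE [RHS]mxE.
under eq_bigr do rewrite y0; rewrite -mulr_sumr tot q4.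
rewrite [X in _ + X]big1 => [|j _]; last by rewrite qc mulKf ?pnatr_eq0 // subrr mulr0.
by rewrite mulNr mulVf ?pnatr_eq0 // addNr mulr0 addr0.
Qed.

(** The multiplicative form of the constancy of [cut_coord] modulo integers, with [s] the
    exponential of the common value. *)
Lemma torus_kernelP (t : 'M[R]_(d, 4)) : torus_kernel v t <-> torus t /\
  exists s : 'rV[R]_4, [/\ sqnorm s = 1 /\ (s 0 2 = 0 /\ s 0 3 = 0),
    forall l, (forall j, idx j != l) -> row (edge_l l) t = s &
    forall j, row (edge_l (idx j)) t = qmul s (row (edge_t j) t)].
Proof.
split=> [[xi xiZ tE]|[tT [s [[s1 [s2 s3]] su sc]]]].
  have y0 l : qcis (cut_coord xi l) = qcis (cut_coord xi (rshift m 0)).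
    case: (split_ordP l) => [j ->|j ->]; last by rewrite (ord1 j).
    rewrite -[X in qcis X = _](subKr (cut_coord xi (rshift m 0))) qcisD.
    by rewrite -mul_normals [X in qmul _ X]qcis_int ?qmulq1 // rpredN xiZ.
  split; first split=> [l|l]; first by rewrite tE sqnorm_qcis.
    have rE b : t l b = row l t 0 b by rewrite mxE.
    by rewrite !rE tE !qcisE.
  exists (qcis (cut_coord xi (rshift m 0))); split.
  - by rewrite sqnorm_qcis !qcisE.
  - by move=> l un; rewrite tE -cut_coord_uncut.
  - by move=> j; rewrite !tE -(y0 (idx j)) -qcisD cut_coord_idx subrK.
have [al sE] := qcis_surj s1 s2 s3.
have /choice[be tE] (j : 'I_k) : exists b, row (edge_t j) t = qcis b.
  have [t1 t2] := tT; have [t3 t4] := t2 (edge_t j).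
  by apply: qcis_surj; rewrite ?t1 // mxE.
pose xi : 'rV[R]_d := row_mx (\row_l (al + \sum_(j | idx j == l) be j)) (\row_j be j).
have xt j : xi 0 (edge_t j) = be j by rewrite /xi /edge_t row_mxEr mxE.
have y0 l : cut_coord xi l = al.
  rewrite /cut_coord /xi /edge_l row_mxEl mxE; under [X in _ - X]eq_bigr do
    rewrite -/(edge_t _) xt.
  by rewrite addrK.
exists xi => [j|a]; first by rewrite mul_normals !y0 subrr.
case: (split_ordP a) => [l ->|j ->]; last by rewrite -/(edge_t j) xt -tE.
have [/forallP un|] := boolP [forall j, idx j != l].
  by rewrite su // sE -[X in qcis X = _](y0 l) cut_coord_uncut.
rewrite negb_forall => /existsP[j]; rewrite negbK => /eqP <-.
by rewrite sc sE tE -qcisD -(y0 (idx j)) cut_coord_idx xt subrK.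
Qed.

End ToricData.

(** * Extensions of the torus action *)

Section Extensions.
Variables (R : realType) (m k : nat) (w : 'M[int]_(k, m)).
Variable idx : 'I_k -> 'I_(m + 1).
Notation N := (simplex_normals m).
Notation v := (col_mx N w).
Notation d := (m + 1 + k)%N.
Hypothesis idxI : injective idx.
Hypothesis wE : forall j, row j w = - row (idx j) N.
Notation edge_l := (@edge_l m k).
Notation edge_t := (@edge_t m k).
Notation node := (option 'I_k.+1).
Implicit Types (e : extension d k.+1) (s : 'M[R]_(k.+1, 4)).

Lemma qmul_complexC (p q : 'rV[R]_4) : p 0 2 = 0 -> p 0 3 = 0 -> q 0 2 = 0 ->
  q 0 3 = 0 -> qmul p q = qmul q p.
Proof.
by move=> p2 p3 q2 q3; apply: quat_ext; rewrite !qmulE p2 p3 q2 q3; ring.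
Qed.

Lemma sqnormN n l (x : 'M[R]_(n, l)) : sqnorm (- x) = sqnorm x.
Proof. by rewrite -scaleN1r sqnormZ sqrrN expr1n mul1r. Qed.

(** Complex numbers commute, so for torus elements the edge action on complex coordinates is
    multiplication by h_src h_tgt^-1. *)
Definition edge_character e s : 'M[R]_(d, 4) :=
  \matrix_a qmul (at_node s (src e a)) (qconj (at_node s (tgt e a))).

Lemma at_node_complex s a : complexes s ->
  at_node s a 0 2 = 0 /\ at_node s a 0 3 = 0.
Proof. by move=> sC; case: a => [i|] /=; rewrite ?qoneE // !mxE; exact: sC. Qed.

Lemma edge_character_act e s z : complexes s -> complexes z ->
  ext_act e s z = cmul (edge_character e s) z.
Proof.
move=> sC zC; apply/row_matrixP => a; rewrite row_ext_act !rowK -!qmulA.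
congr qmul; have [z2 z3] := zC a; have [t2 t3] := at_node_complex (tgt e a) sC.
by apply: qmul_complexC; rewrite ?qconjE ?t2 ?t3 ?oppr0 // mxE.
Qed.

Lemma edge_character_cmul e s s' : complexes s -> complexes s' ->
  edge_character e (cmul s s') = cmul (edge_character e s) (edge_character e s').
Proof.
move=> sC s'C; apply/row_matrixP => a; rewrite !rowK !at_node_cmul qconjM.
rewrite -!qmulA; congr qmul.
have [s2 s3] := at_node_complex (src e a) s'C.
have [t2 t3] := at_node_complex (tgt e a) s'C.
have [t2' t3'] := at_node_complex (tgt e a) sC.
set p := at_node s' (src e a) in s2 s3 *; set q := at_node s' (tgt e a) in t2 t3 *.
set h := at_node s (tgt e a) in t2' t3' *.
apply: quat_ext; rewrite !(qmulE, qconjE) s2 s3 t2 t3 t2' t3'; ring.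
Qed.

Lemma torus_character e s : torus s -> torus (edge_character e s).
Proof.
move=> [s1 sC]; split=> a.
  by rewrite rowK sqnormM sqnorm_conj !at_node_Sp1 // mulr1.
have [s2 s3] := at_node_complex (src e a) sC.
have [t2 t3] := at_node_complex (tgt e a) sC.
have rE b : edge_character e s a b = row a (edge_character e s) 0 b by rewrite [RHS]mxE.
by rewrite !rE !rowK !qmulE !qconjE s2 s3 t2 t3; split; ring.
Qed.

Lemma continuous_character e : continuous (edge_character e : _ -> 'M[R]_(d, 4)).
Proof.
have S : smooth_on setT (edge_character e).
  apply: (smooth_on_rows openT) => a; under eq_fun do rewrite rowK.
  have sn b : smooth_on setT (fun s => at_node s b).
    case: b => [i|] /=; last exact: (smooth_on_cst _ openT).
    apply: (smooth_on_row openT).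
    by apply/(smooth_on_mx _ openT) => i' j; exact: (smooth_on_coord _ _ openT).
  by apply: (smooth_on_qmul openT) => //; exact: (smooth_on_qconj openT).
by move=> x; exact: smooth_on_continuous S I.
Qed.

(** Acting on the vector with all coordinates 1 recovers the identification, so it can only be the
    edge character; bijectivity onto the kernel torus is then a statement about the graph. *)
Lemma extends_character e : extends_torus_action R v e ->
  [/\ forall s, torus s -> torus_kernel v (edge_character e s),
      forall s s', torus s -> torus s' ->
        edge_character e s = edge_character e s' -> s = s' &
      forall t, torus_kernel v t -> exists2 s, torus s & edge_character e s = t].
Proof.
move=> [phi [[phiK phiI phiS] _ _ phiA]].
have phiE s : torus s -> phi s = edge_character e s.
  move=> sT; pose z : 'M[R]_(d, 4) := \matrix_a qone R.
  have zC : complexes z by move=> a; rewrite !mxE.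
  have := phiA s z sT zC; rewrite edge_character_act //; last by case: sT.
  move=> /row_matrixP E; apply/row_matrixP => a.
  by have := E a; rewrite !rowK !qmulq1 => ->.
split=> [s sT|s s' sT s'T E|t /phiS[s sT <-]].
- by rewrite -phiE //; exact: phiK.
- by apply: phiI; rewrite ?inE // !phiE.
- by exists s; rewrite ?phiE.
Qed.

(** The shape x -> z_j <- y with x = [Some ord0], y = [None] and z_j = [Some (lift ord0 j)]. *)
Definition standard_extension : extension d k.+1 :=
  let z (a : 'I_d) := match fintype.split a with
                      | inr j => Some j | inl l => [pick j | idx j == l] end in
  Extension (fun=> ord0) (fun a => oapp (lift ord0) ord0 (z a))
    (fun a : 'I_d => if fintype.split a is inl _ then true else false) (fun a => isSome (z a)).

Lemma standard_src_l l : src standard_extension (edge_l l) = Some ord0.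
Proof. by rewrite /src /= (unsplitK (inl l)). Qed.

Lemma standard_src_t j : src standard_extension (edge_t j) = None.
Proof. by rewrite /src /= (unsplitK (inr j)). Qed.

Lemma standard_tgt_t j : tgt standard_extension (edge_t j) = Some (lift ord0 j).
Proof. by rewrite /tgt /= (unsplitK (inr j)). Qed.

Lemma standard_tgt_idx j : tgt standard_extension (edge_l (idx j)) = Some (lift ord0 j).
Proof.
rewrite /tgt /= (unsplitK (inl (idx j))) /=.
by case: pickP => [i /eqP/idxI ->//|/(_ j)]; rewrite eqxx.
Qed.

Lemma standard_tgt_uncut l : (forall j, idx j != l) ->
  tgt standard_extension (edge_l l) = None.
Proof.
move=> un; rewrite /tgt /= (unsplitK (inl l)) /=.
by case: pickP => [i|//]; rewrite (negPf (un i)).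
Qed.

Lemma standard_extends : extends_torus_action R v standard_extension.
Proof.
exists (edge_character standard_extension); split; first split.
- move=> s sT; apply/(torus_kernelP idxI wE); split; first exact: torus_character.
  have [s1 sC] := sT; exists (row 0 s); split.
  + by rewrite s1 !mxE; split=> //; exact: sC.
  + by move=> l un; rewrite rowK standard_src_l standard_tgt_uncut //= qconj1 qmulq1.
  + move=> j; rewrite !rowK standard_src_l standard_tgt_idx standard_src_t.
    by rewrite standard_tgt_t /= qmul1q.
- move=> s s'; rewrite !inE => -[s1 _] [s'1 _] /row_matrixP E.
  have Et j : row (lift ord0 j) s = row (lift ord0 j) s'.
    have := E (edge_t j); rewrite !rowK standard_src_t standard_tgt_t /= !qmul1q.
    by move/(congr1 (@qconj R)); rewrite !qconjK.
  apply/row_matrixP => i; case: (unliftP ord0 i) => [j ->|->]; first exact: Et.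
  have := E (edge_l (rshift m 0)); rewrite !rowK standard_src_l.
  have [/forallP un|] := boolP [forall j, idx j != rshift m 0].
    by rewrite standard_tgt_uncut //= qconj1 !qmulq1.
  rewrite negb_forall => /existsP[j]; rewrite negbK => /eqP <-.
  rewrite standard_tgt_idx /= -Et => /(congr1 (fun p => qmul p (row (lift ord0 j) s))).
  by rewrite !mulV_unitK.
- move=> t /(torus_kernelP idxI wE)[[t1 tC] [s0 [[s01 [s02 s03]] su sc]]].
  have tr a b : row a t 0 b = t a b by rewrite mxE.
  exists (\matrix_i (if unlift ord0 i is Some j then qconj (row (edge_t j) t) else s0)).
    split=> i; first by rewrite rowK; case: unliftP => [j _|_]; rewrite ?sqnorm_conj.
    rewrite !mxE; case: unliftP => [j _|_]; last by rewrite s02 s03.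
    by rewrite !qconjE !tr; have [-> ->] := tC (edge_t j); rewrite oppr0.
  apply/row_matrixP => a; rewrite rowK.
  have Rt j : row (lift ord0 j) (\matrix_i (if unlift ord0 i is Some j then
      qconj (row (edge_t j) t) else s0)) = qconj (row (edge_t j) t).
    by rewrite rowK liftK.
  have R0 : row 0 (\matrix_i (if unlift ord0 i is Some j then
      qconj (row (edge_t j) t) else s0)) = s0.
    by rewrite rowK unlift_none.
  case: (split_ordP a) => [l ->|j ->]; last first.
    by rewrite -/(edge_t j) standard_src_t standard_tgt_t /= Rt qconjK qmul1q.
  rewrite -/(edge_l l) standard_src_l.
  have [/forallP un|] := boolP [forall j, idx j != l].
    by rewrite standard_tgt_uncut //= qconj1 qmulq1 R0 su.
  rewrite negb_forall => /existsP[j]; rewrite negbK => /eqP <-.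
  by rewrite standard_tgt_idx /= Rt R0 qconjK sc.
- exact/continuous_subspaceT/continuous_character.
- by move=> s t [_ sC] [_ tC]; exact: edge_character_cmul.
- by move=> s z [_ sC]; exact: edge_character_act.
Qed.

Definition pin (o : option 'I_k) (j : 'I_k) : 'I_d :=
  if o == Some j then edge_l (idx j) else edge_t j.

(* The coordinates made real positive by the action in a chart of the quotient:
   (l0, None) or (l0, Some j) is the vertex of the polytope on the facets with
   an index outside this set. *)
Definition pinned (l0 : 'I_(m + 1)) (o : option 'I_k) : {set 'I_d} :=
  edge_l l0 |: [set pin o j | j : 'I_k]%SET.

Lemma edge_lt l j : (edge_l l == edge_t j) = false.
Proof. exact: eq_lrshift. Qed.

Lemma mem_pinned_l l0 o l : (edge_l l \in pinned l0 o) =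
  (l == l0) || (if o is Some j then l == idx j else false).
Proof.
rewrite !inE (inj_eq (@lshift_inj _ _)); congr orb.
apply/imsetP/idP => [[j _]|].
  by rewrite /pin; case: eqP => [->|_] /eqP; rewrite ?edge_lt // (inj_eq (@lshift_inj _ _)).
by case: o => // j /eqP ->; exists j; rewrite // /pin eqxx.
Qed.

Lemma mem_pinned_t l0 o j : (edge_t j \in pinned l0 o) = (o != Some j).
Proof.
rewrite !inE eq_sym edge_lt /=; apply/imsetP/idP => [[i _]|oj].
  rewrite /pin; case: ifP => oi /eqP; first by rewrite eq_sym edge_lt.
  by rewrite (inj_eq (@rshift_inj _ _)) => /eqP ->; rewrite oi.
by exists j; rewrite // /pin (negPf oj).
Qed.

Lemma card_pinned l0 o : (forall j, o = Some j -> l0 != idx j) ->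
  #|pinned l0 o| = k.+1.
Proof.
move=> l0o; rewrite cardsU1 card_imset ?card_ord.
  rewrite (_ : _ \notin _ = true) //; apply/negP => /imsetP[j _].
  rewrite /pin; case: eqP => [/l0o + /eqP|_ /eqP]; last by rewrite edge_lt.
  by rewrite (inj_eq (@lshift_inj _ _)) => /negPf ->.
move=> i j; rewrite /pin; case: ifP => _; case: ifP => _ /eqP.
- by rewrite (inj_eq (@lshift_inj _ _)) => /eqP/idxI.
- by rewrite edge_lt.
- by rewrite eq_sym edge_lt.
- by rewrite (inj_eq (@rshift_inj _ _)) => /eqP.
Qed.

Section Shape.
Variable e : extension d k.+1.
Hypothesis eT : extends_torus_action R v e.

Lemma qone_neqN : qone R != - qone R.
Proof.
apply/eqP => /(congr1 (fun q : 'rV[R]_4 => q 0 0)); rewrite [RHS]mxE !qoneE.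
by move/eqP; rewrite -subr_eq0 opprK -[1 + 1]/(2%:R) pnatr_eq0.
Qed.

(** If a set [C] closed along the pinned edges missed a vertex, the torus element equal to 1 on [C]
    and -1 elsewhere would have character 1 on the pinned coordinates, hence on all by the kernel
    equations, against injectivity of the character. *)
Lemma pinned_spanning l0 o : (forall j, o = Some j -> l0 != idx j) ->
  spanning e (pinned l0 o).
Proof.
have [eK eI _] := extends_character eT.
move=> l0o C NC pC.
pose u a : 'rV[R]_4 := if a \in C then qone R else - qone R.
pose s : 'M[R]_(k.+1, 4) := \matrix_i u (Some i).
have sn a : at_node s a = u a by case: a => [i|] /=; rewrite ?rowK // /u NC.
have u1 a : sqnorm (u a) = 1.
  by rewrite /u; case: ifP => _; rewrite ?sqnormN sqnorm1.
have oneT : @torus R k.+1 (\matrix_i qone R).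
  by split; [exact: Sp1_one|move=> i; rewrite !mxE].
have sT : torus s.
  split=> i; first by rewrite rowK.
  by rewrite !mxE /u; case: ifP => _; rewrite !mxE ?oppr0.
have /(torus_kernelP idxI wE)[_ [h [[h1 _] hu hc]]] := eK s sT.
have eS a : a \in pinned l0 o -> row a (edge_character e s) = qone R.
  by move=> aS; rewrite rowK !sn {1}/u pC // -/(u _) unit_mulV.
have hE : h = qone R.
  have l0S : edge_l l0 \in pinned l0 o by rewrite mem_pinned_l eqxx.
  have [/forallP un|] := boolP [forall j, idx j != l0].
    by rewrite -(hu l0) // eS.
  rewrite negb_forall => /existsP[j]; rewrite negbK => /eqP jl0.
  have := hc j; rewrite jl0 eS // eS ?qmulq1 // mem_pinned_t.
  by apply/eqP => /l0o; rewrite jl0 eqxx.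
have all1 a : row a (edge_character e s) = qone R.
  have et j : row (edge_t j) (edge_character e s) = qone R.
    have [oj|oj] := eqVneq o (Some j); last by rewrite eS // mem_pinned_t.
    have := hc j; rewrite hE qmul1q => <-.
    by rewrite eS // mem_pinned_l oj eqxx orbT.
  case: (split_ordP a) => [l ->|j ->]; last exact: et.
  have [/forallP un|] := boolP [forall j, idx j != l]; first by rewrite [LHS]hu.
  rewrite negb_forall => /existsP[j]; rewrite negbK => /eqP <-.
  by rewrite [LHS]hc et hE qmulq1.
have sE : s = \matrix_i qone R.
  apply: eI => //; apply/row_matrixP => a; rewrite all1 rowK.
  have oneN b : at_node (\matrix_i qone R) b = qone R by case: b => [i|] //=; rewrite rowK.
  by rewrite !oneN unit_mulV // sqnorm1.
case=> [i|//]; have := congr1 (row i) sE; rewrite !rowK /u; case: ifP => // _ E.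
by have := qone_neqN; rewrite E eqxx.
Qed.

(** Elements of order at most two; those in the kernel torus detect loops and parallel edges. *)
Definition sign_t (t : {ffun 'I_d -> bool}) : 'M[R]_(d, 4) :=
  \matrix_a (if t a then - qone R else qone R).

Lemma sign_torus t : torus (sign_t t).
Proof.
split=> a.
  by rewrite rowK; case: ifP => _; rewrite ?sqnormN sqnorm1.
by rewrite !mxE; case: ifP => _; rewrite !mxE ?oppr0.
Qed.

Lemma kernel_l : torus_kernel v
  (sign_t [ffun a : 'I_d => if fintype.split a is inl _ then true else false]).
Proof.
apply/(torus_kernelP idxI wE); split; first exact: sign_torus.
have El l : row (edge_l l) (sign_t [ffun a : 'I_d =>
    if fintype.split a is inl _ then true else false]) = - qone R.
  by rewrite rowK ffunE (unsplitK (inl l)).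
exists (- qone R); split=> [|l _|j]; last 2 first.
- exact: El.
- by rewrite El rowK ffunE (unsplitK (inr j)) qmulq1.
by rewrite sqnormN sqnorm1 !mxE oppr0.
Qed.

Lemma kernel_t j : torus_kernel v
  (sign_t [ffun a => (a == edge_t j) || (a == edge_l (idx j))]).
Proof.
apply/(torus_kernelP idxI wE); split; first exact: sign_torus.
exists (qone R); split=> [|l un|i].
- by rewrite sqnorm1 !mxE.
- by rewrite rowK ffunE edge_lt /= (inj_eq (@lshift_inj _ _)) eq_sym (negPf (un j)).
rewrite qmul1q !rowK !ffunE edge_lt (eq_sym (edge_t i) (edge_l _)) edge_lt orbF /=.
by rewrite (inj_eq (@lshift_inj _ _)) (inj_eq (@rshift_inj _ _)) (inj_eq idxI).
Qed.

(** On a loop every character is 1, while for each coordinate the kernel torus has an element equal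
    to -1 there. *)
Lemma no_loop a : src e a != tgt e a.
Proof.
have [_ _ eS] := extends_character eT.
apply/eqP => loop.
have one t : torus_kernel v t -> row a t = qone R.
  by move=> /eS[s [s1 _] <-]; rewrite rowK loop unit_mulV ?at_node_Sp1.
case: (split_ordP a) => [l|j] aE.
  have := one _ kernel_l; rewrite rowK ffunE aE (unsplitK (inl l)) => /esym/eqP.
  by rewrite (negPf qone_neqN).
have := one _ (kernel_t j); rewrite rowK ffunE aE eqxx => /esym/eqP.
by rewrite (negPf qone_neqN).
Qed.

End Shape.
End Extensions.

(** * Classification of the graphs of extensions *)

Section ExtensionShape.
Variables (R : realType) (m k : nat) (w : 'M[int]_(k, m)).
Variable idx : 'I_k -> 'I_(m + 1).
Notation N := (simplex_normals m).
Notation v := (col_mx N w).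
Notation d := (m + 1 + k)%N.
Hypothesis idxI : injective idx.
Hypothesis wE : forall j, row j w = - row (idx j) N.
Notation edge_l := (@edge_l m k).
Notation edge_t := (@edge_t m k).
Notation node := (option 'I_k.+1).
Variable e : extension d k.+1.
Hypothesis eT : extends_torus_action R v e.

(** The weight of the circle at the vertex [n] on the coordinate [a]; [slope] is [cut_coord] of
    these weights. *)
Definition incidence (a : 'I_d) (n : node) : int :=
  (src e a == n)%:Z - (tgt e a == n)%:Z.

Definition slope l n : int :=
  incidence (edge_l l) n - \sum_(j | idx j == l) incidence (edge_t j) n.

Lemma slope_idx j n :
  slope (idx j) n = incidence (edge_l (idx j)) n - incidence (edge_t j) n.
Proof.
rewrite /slope (bigD1 j) //= big1 ?addr0 // => j' /andP[/eqP/idxI ->].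
by rewrite eqxx.
Qed.

Lemma slope_uncut l n : (forall j, idx j != l) -> slope l n = incidence (edge_l l) n.
Proof. by move=> un; rewrite /slope big1 ?subr0 // => j; rewrite (negPf (un j)). Qed.

Lemma slope_le l n : `|slope l n| <= 2.
Proof.
have inc a : `|incidence a n| <= 1.
  by rewrite /incidence; case: (_ == n); case: (_ == n).
have [/forallP un|] := boolP [forall j, idx j != l].
  by rewrite slope_uncut // (le_trans (inc _)).
rewrite negb_forall => /existsP[j]; rewrite negbK => /eqP <-.
by rewrite slope_idx (le_trans (ler_normB _ _)) // (@lerD _ _ 1 _ 1).
Qed.

Lemma qcisN (x : R) : qcis (- x) = qconj (qcis x).
Proof.
by apply: quat_ext; rewrite !(qconjE, qcisE) ?oppr0 // mulrN ?cosN ?sinN.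
Qed.

(** The angle is at most 4/10 of a turn, and [cos] is injective on [0, pi]. Slopes lie in [-2, 2],
    so they differ by at most 4; this fixes the 1/10. *)
Lemma qcis_small (z : int) : `|z| <= 4 -> qcis (z%:~R / 10 : R) = qone R -> z = 0.
Proof.
move=> z4 /(congr1 (fun q : 'rV[R]_4 => q 0 0)); rewrite qcisE qoneE.
have z4' : `|z%:~R : R| <= 4 by rewrite -intr_norm (ler_int R _ 4).
have pi0 := pi_gt0 R.
have -> : 2 * pi * (z%:~R / 10) = z%:~R * (pi / 5) :> R by field.
rewrite -[cos _]cos_norm -[RHS]cos0 => /cos_inj zz.
have z0 : `|z%:~R * (pi / 5) : R| = 0.
  apply: zz; rewrite in_itv /= ?lexx ?(ltW pi0) // normr_ge0 /=.
  by rewrite normrM (ger0_norm (_ : 0 <= pi / 5)) ?divr_ge0 ?(ltW pi0) //; nra.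
move/eqP: z0; rewrite normr_eq0 mulf_eq0 intr_eq0 => /orP[/eqP//|].
by rewrite gt_eqF // divr_gt0.
Qed.

(* Feeding the circle subgroup at the vertex n into the relations that define
   the torus kernel; the sum over all vertices settles the vertex None. *)
Lemma slope_eq l l' n : slope l n = slope l' n.
Proof.
have [eK _ _] := extends_character eT.
have some i : slope l (Some i) = slope l' (Some i).
  pose x : R := 10^-1.
  pose s : 'M[R]_(k.+1, 4) := \matrix_i' (if i' == i then qcis x else qone R).
  have sn a : at_node s a = if a == Some i then qcis x else qone R.
    by case: a => [i'|] //=; rewrite rowK.
  have sT : torus s.
    split=> i'; first by rewrite rowK; case: ifP => _; rewrite ?sqnorm_qcis ?sqnorm1.
    by rewrite !mxE; case: ifP => _; rewrite ?qcisE ?qoneE.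
  have rE a : row a (edge_character e s) = qcis ((incidence a (Some i))%:~R / 10).
    rewrite rowK !sn /incidence; case: (_ == _); case: (_ == _) => /=.
    - by rewrite subrr mul0r unit_mulV ?sqnorm_qcis // qcis_int ?rpred0.
    - by rewrite qconj1 qmulq1 subr0 mul1r.
    - by rewrite sub0r qmul1q mulrNz mulNr mul1r qcisN.
    - by rewrite subr0 mul0r qcis_int ?rpred0 // qconj1 qmul1q.
  have /(torus_kernelP idxI wE)[_ [h [[h1 _] hu hc]]] := eK s sT.
  have hE l0 : h = qcis ((slope l0 (Some i))%:~R / 10).
    have [/forallP un|] := boolP [forall j, idx j != l0].
      by rewrite slope_uncut // -rE hu.
    rewrite negb_forall => /existsP[j]; rewrite negbK => /eqP <-.
    rewrite slope_idx intrB mulrBl qcisD qcisN -!rE hc mul_unitVK //.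
    by rewrite rE sqnorm_qcis.
  apply/eqP; rewrite -subr_eq0; apply/eqP; apply: qcis_small.
    apply: le_trans (ler_normB _ _) _.
    by rewrite (@lerD _ _ 2 _ 2) ?slope_le.
  by rewrite intrB mulrBl qcisD qcisN -!hE unit_mulV.
case: n => [i|]; first exact: some.
have inc0 a : \sum_n incidence a n = 0.
  rewrite /incidence sumrB; apply/eqP; rewrite subr_eq0; apply/eqP.
  have one (n0 : node) : \sum_n (n0 == n)%:Z = 1.
    rewrite (bigD1 n0) //= eqxx big1 ?addr0 // => n; rewrite eq_sym.
    by move/negPf ->.
  by rewrite !one.
have tot l0 : \sum_n slope l0 n = 0.
  rewrite /slope sumrB inc0 exchange_big big1 ?subr0 // => j _; exact: inc0.
have := etrans (tot l) (esym (tot l')).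
rewrite (bigD1 None) // [RHS](bigD1 None) //= (eq_bigr (slope l')) => [/addIr//|].
by case=> // i _; exact: some.
Qed.

(** Parallel edges have equal characters, but the kernel torus contains the element that is -1 on
    all [edge_l] and 1 on all [edge_t]. *)
Lemma no_parallel j : src e (edge_l (idx j)) = src e (edge_t j) ->
  tgt e (edge_l (idx j)) = tgt e (edge_t j) -> False.
Proof.
have [_ _ eS] := extends_character eT.
move=> sE tE; have [s sT E] := eS _ (kernel_l R idxI wE).
have := congr1 (row (edge_l (idx j))) E; rewrite rowK sE tE.
have := congr1 (row (edge_t j)) E; rewrite rowK => ->.
rewrite !rowK !ffunE (unsplitK (inl (idx j))) (unsplitK (inr j)) => /eqP.
by rewrite (negPf (qone_neqN R)).
Qed.

(** As formal sums of vertices, a - b - c + f = x - y; since a differs from b and c from f, the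
    cancellation can only be b = f or a = c. *)
Lemma four_points (T : eqType) (a b c f x y : T) : a != b -> c != f -> x != y ->
  (forall n, (a == n)%:Z - (b == n)%:Z - ((c == n)%:Z - (f == n)%:Z) =
             (x == n)%:Z - (y == n)%:Z) ->
  [/\ a = x, c = y & b = f] \/ [/\ b = y, f = x & a = c].
Proof.
move=> ab cf xy H.
have [ax|ax] := eqVneq a x.
  left; have bf : b = f.
    have := H f; rewrite ax eqxx (negPf cf); case: (eqVneq b f) => // _.
    by case: (x == f); case: (y == f).
  split=> //; have := H c; rewrite ax bf eqxx; case: (eqVneq y c) => // _.
  by case: (x == c); case: (f == c).
right; have fx : f = x.
  have := H x; rewrite (negPf ax) eqxx eq_sym (eq_sym y) (negPf xy).
  by case: (eqVneq f x) => // _; case: (_ == _); case: (_ == _).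
have ac : a = c.
  have := H a; rewrite eqxx (eq_sym b) (negPf ab) fx.
  case: (eqVneq c a) => // _.
  by case: (x == a); case: (y == a).
split=> //; have := H b; rewrite ac fx eqxx; case: (eqVneq y b) => // _.
by case: (x == b); case: (c == b).
Qed.

(** Either [C] or its complement contains [None], and both are closed along the pinned edges. *)
Lemma pinned_closed l0 (C : {set node}) x : x \in C ->
  (forall a, a \in pinned idx l0 None -> src e a \in C /\ tgt e a \in C) ->
  forall n, n \in C.
Proof.
move=> xC aC.
have sp := pinned_spanning idxI wE eT (l0 := l0) (o := None) (fun j => fun E => ltac:(by [])).
have [NC|NC] := boolP (None \in C).
  by apply: sp => // a /aC[-> ->].
have : forall n, n \in ~: C.
  by apply: sp => [|a /aC[]]; rewrite !inE // => -> ->.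
by move=> /(_ x); rewrite inE xC.
Qed.

Definition reversed_shape (x y z : node) (b : bool) j : Prop := if b
  then [/\ src e (edge_l (idx j)) = z, tgt e (edge_l (idx j)) = y,
           src e (edge_t j) = z & tgt e (edge_t j) = x]
  else [/\ src e (edge_l (idx j)) = x, tgt e (edge_l (idx j)) = z,
           src e (edge_t j) = y & tgt e (edge_t j) = z].

Lemma extension_shape : (0 < k -> 1 < m)%N ->
  exists (x y : node) (z : 'I_k -> node) (b : 'I_k -> bool),
  [/\ x != y, injective z /\ (forall j, z j != x /\ z j != y),
      forall n, [\/ n = x, n = y | exists j, n = z j],
      forall l, (forall j, idx j != l) -> src e (edge_l l) = x /\ tgt e (edge_l l) = y &
      forall j, reversed_shape x y (z j) (b j) j].
Proof.
move=> km.
have nl := no_loop idxI wE eT.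
have [x [y [xy slopeE]]] : exists x y, x != y /\
    forall l n, slope l n = (x == n)%:Z - (y == n)%:Z.
  (* The incidence of an uncut coordinate is the common slope, so its two ends serve as x and y. *)
  have [/existsP[l /forallP un]|] := boolP [exists l, [forall j, idx j != l]].
    exists (src e (edge_l l)), (tgt e (edge_l l)); split=> // l' n.
    by rewrite (slope_eq _ l) slope_uncut.
  rewrite negb_exists => /forallP cut.
  have {}cut l : exists j, idx j = l.
    by have := cut l; rewrite negb_forall => /existsP[j]; rewrite negbK => /eqP; exists j.
  have mk : (m + 1 <= k)%N.
    have /choice[f fP] := cut.
    have := @leq_card _ _ f (can_inj fP); by rewrite !card_ord.
  have k0 : (0 < k)%N by lia.
  have m1 := km k0.
  pose a j := src e (edge_l (idx j)); pose b j := tgt e (edge_l (idx j)).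
  pose c j := src e (edge_t j); pose f j := tgt e (edge_t j).
  have sE j n : slope (idx j) n = (a j == n)%:Z - (b j == n)%:Z - ((c j == n)%:Z - (f j == n)%:Z).
    by rewrite slope_idx.
  have [/existsP[j /eqP ac]|nac] := boolP [exists j, a j == c j].
    exists (f j), (b j); split=> [|l n].
      by apply/eqP => fb; apply: (@no_parallel j) => //; exact/esym.
    by rewrite (slope_eq _ (idx j)) sE ac; ring.
  have [/existsP[j /eqP bf]|nbf] := boolP [exists j, b j == f j].
    exists (a j), (c j); split=> [|l n].
      by apply/eqP => fb; apply: (@no_parallel j).
    by rewrite (slope_eq _ (idx j)) sE bf; ring.
  (* With every coordinate cut and no cancellation in any pair, the slope determines the four ends
     of a pair, so all edges live on at most four vertices; but there are k + 2 >= m + 3 >= 5 of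
     them. *)
  rewrite negb_exists in nac; rewrite negb_exists in nbf.
  move/forallP in nac; move/forallP in nbf.
  pose j0 := Ordinal k0; pose C : {set node} := [set n | n \in [:: a j0; f j0; b j0; c j0]]%SET.
  have ab j : a j != b j by exact: nl.
  have cf j : c j != f j by exact: nl.
  have jC j : [/\ a j \in C, b j \in C, c j \in C & f j \in C].
    have H n := etrans (esym (sE j n)) (etrans (slope_eq _ (idx j0) n) (sE j0 n)).
    have := (ab j, nac j, cf j, nbf j) => -[[[h1 h2] h3] h4].
    split; rewrite !inE.
    - have := H (a j); rewrite eqxx (eq_sym (b j)) (negPf h1) (eq_sym (c j)) (negPf h2).
      rewrite !(eq_sym _ (a j)).
      by do 5![case: (_ == _)].
    - have := H (b j); rewrite eqxx (negPf h1) (eq_sym (f j)) (negPf h4).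
      rewrite !(eq_sym _ (b j)).
      by do 5![case: (_ == _)].
    - have := H (c j); rewrite eqxx (negPf h2) (eq_sym (f j)) (negPf h3).
      rewrite !(eq_sym _ (c j)).
      by do 5![case: (_ == _)].
    - have := H (f j); rewrite eqxx (negPf h4) (negPf h3).
      rewrite !(eq_sym _ (f j)).
      by do 5![case: (_ == _)].
  have CT : forall n, n \in C.
    apply: (@pinned_closed (idx j0) _ (a j0)); first by rewrite !inE eqxx.
    move=> aa; case: (split_ordP aa) => [l ->|j ->].
      by have [j <-] := cut l; have [? ? _ _] := jC j.
    by have [_ _] := jC j.
  have : (#|C| <= 4)%N.
    by rewrite cardsE card_size.
  rewrite (eq_card (B := predT)) => [|n]; last by rewrite CT.
  by rewrite card_option card_ord; lia.
have uncutE l : (forall j, idx j != l) -> src e (edge_l l) = x /\ tgt e (edge_l l) = y.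
  move=> un; have H n := etrans (esym (slope_uncut n un)) (slopeE l n).
  have lab := nl (edge_l l); rewrite /incidence in H.
  have sx : src e (edge_l l) = x.
    have := H x; rewrite eqxx (eq_sym y) (negPf xy); case: (eqVneq (src _ _) x) => // _.
    by case: (_ == _).
  split=> //; have := H (tgt e (edge_l l)); rewrite sx eqxx; case: (eqVneq y _) => // _.
  by case: (_ == _).
have cutE j : exists zb : node * bool, reversed_shape x y zb.1 zb.2 j.
  have H n := etrans (esym (slope_idx j n)) (slopeE (idx j) n).
  have [[ax cy bf]|[b_y fx ac]] := four_points (nl _) (nl _) xy H.
    by exists (tgt e (edge_t j), false).
  by exists (src e (edge_t j), true).
have /choice[zb zbP] := cutE.
(* The vertices x, y and z_j contain the ends of all edges, so they are all the k + 2 vertices and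
   must be pairwise distinct. *)
pose Z : {set node} := [set (zb j).1 | j : 'I_k]%SET.
have CT : forall n, n \in (x |: (y |: Z))%SET.
  apply: (@pinned_closed (rshift m 0) _ x); first by rewrite !inE eqxx.
  have zZ j : (zb j).1 \in Z by apply/imsetP; exists j.
  move=> a _; case: (split_ordP a) => [l ->|j ->].
    have [/forallP un|] := boolP [forall j, idx j != l].
      by have [-> ->] := uncutE l un; rewrite !inE !eqxx orbT.
    rewrite negb_forall => /existsP[j]; rewrite negbK => /eqP <-.
    have := zbP j; rewrite /reversed_shape; case: ifP => _ [-> -> _ _];
      by rewrite !in_setU1 zZ !eqxx !orbT.
  have := zbP j; rewrite /reversed_shape; case: ifP => _ [_ _ -> ->];
    by rewrite !in_setU1 zZ !eqxx !orbT.
have : #|(x |: (y |: Z))%SET| = k.+2.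
  rewrite (eq_card (B := predT)) => [|n]; last by rewrite CT.
  by rewrite card_option card_ord.
have Zk : (#|Z| <= k)%N by rewrite (leq_trans (leq_imset_card _ _)) // card_ord.
rewrite !cardsU1 => cE.
have [xZ yZ cZ] : [/\ x \notin (y |: Z)%SET, y \notin Z & #|Z| = k].
  move: (x \notin _) (y \notin _) #|Z| cE Zk => [] [] n E nk;
    [split=> //; lia|lia|lia|lia].
exists x, y, (fun j => (zb j).1), (fun j => (zb j).2); split=> //.
- split=> [i j E|j].
    have /imset_injP injz : #|[set (zb j).1 | j : 'I_k]%SET| == #|'I_k|.
      by rewrite -/Z cZ card_ord.
    exact: (injz i j).
  have zZ : (zb j).1 \in Z by apply/imsetP; exists j.
  split; apply/eqP => E; first by move: xZ; rewrite in_setU1 -E zZ orbT.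
  by move: yZ; rewrite -E zZ.
- move=> n; have := CT n; rewrite !in_setU1 => /or3P[/eqP|/eqP|/imsetP[j _]] E.
  + by constructor 1.
  + by constructor 2.
  + by constructor 3; exists j.
Qed.

End ExtensionShape.

(** * Charts and topology of the toric manifold *)

Lemma orbit_space_compact (E : topologicalType) (Z : set E) (orb : E -> set E) :
  compact Z -> compact [set: orbit_space Z orb].
Proof.
move=> cZ F PF _.
(* The filter on the quotient is pulled back to [E], where the compactness of [Z] applies. *)
pose G : set_system E := fun S => exists2 B, F B &
  forall z : Z, B (orbit_proj orb z) -> S (set_val z).
have PG : ProperFilter G.
  split.
    move=> [B FB] B0; have [x Bx] := filter_ex FB.
    have [z zx] := orbit_proj_surj x.
    by apply: (B0 z); rewrite zx.
  split.
  - by exists setT => //; exact: filterT.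
  - move=> S S' [B FB BS] [B' FB' BS']; exists (B `&` B'); first exact: filterI.
    by move=> z [/BS ? /BS' ?].
  - by move=> S S' SS' [B FB BS]; exists B => // z /BS/SS'.
have [q [Zq cq]] : Z `&` cluster G !=set0.
  by apply: cZ; exists setT => [|z _]; [exact: filterT|exact: set_val_in].
have [z zq] : exists z : Z, set_val z = q.
  by exists (SigSub (mem_set Zq)); rewrite set_valE.
exists (orbit_proj orb z); split=> // B U FB nU.
have : nbhs z (@orbit_proj E Z orb @^-1` U) by apply: orbit_proj_continuous.
rewrite nbhsE => -[_ [[W oW <-] Wz] WU].
have [||_ [[z' Bz' <-] Wz']] := cq [set set_val z' | z' in [set z' : Z | B (orbit_proj orb z')]] W.
- by exists B => // z' Bz'; exists z'.
- by rewrite -zq; apply: open_nbhs_nbhs.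
by exists (orbit_proj orb z'); split=> //; exact: WU.
Qed.

(** Points told apart by some [f i] are separated in [Y]; the remaining pairs share a chart and are
    separated in [F]. *)
Lemma hausdorff_charts (X F : topologicalType) (A : set (chart X F)) (I : Type)
    (Y : topologicalType) (f : I -> X -> Y) :
  hausdorff_space F -> hausdorff_space Y -> (forall i, continuous (f i)) ->
  A `<=` @top_chart X F ->
  (forall x y, (forall i, f i x = f i y) -> exists2 c, A c & cdom c x /\ cdom c y) ->
  hausdorff_space X.
Proof.
move=> hF hY cf tA com p q cpq.
have fpq i : f i p = f i q.
  apply: hY => U V nU nV.
  have [x [Ux Vx]] := cpq _ _ (cf i p U nU) (cf i q V nV).
  by exists (f i x).
have [c /tA[_ _ cK cc _] [cp cq]] := com _ _ fpq.
have cE : cfwd c p = cfwd c q.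
  apply: hF => U V nU nV.
  have [x [Ux Vx]] := cpq _ _ (cc p cp U nU) (cc q cq V nV).
  by exists (cfwd c x).
by rewrite -(cK p cp) cE cK.
Qed.

Lemma open_forall_gt0 (T : topologicalType) (R : realType) (I : finType)
    (P : pred I) (f : I -> T -> R) : (forall i, P i -> continuous (f i)) ->
  open [set x | forall i, P i -> 0 < f i x].
Proof.
move=> cf; rewrite openE => x Ux; rewrite /interior.
near=> y => i; move: i; near: y; apply: filter_forall => i.
have [Pi|] := boolP (P i); last by move=> _; apply: nearW.
have : nbhs x [set y | 0 < f i y].
  have /continuousP/(_ _ (@open_gt R 0)) := cf i Pi.
  by rewrite openE; apply; rewrite /= Ux.
by apply: filterS => y.
Unshelve. all: by end_near. Qed.

Lemma smooth_on_id (R : realType) a b (U : set 'M[R]_(a, b)) :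
  open U -> smooth_on U (fun x : 'M[R]_(a, b) => x).
Proof. by move=> oU; apply/(smooth_on_mx _ oU) => i j; exact: smooth_on_coord. Qed.

Lemma smooth_continuous (R : realType) (V W : normedModType R) (f : V -> W) :
  smooth_on setT f -> continuous f.
Proof. by move=> sf x; exact: smooth_on_continuous sf I. Qed.

Section ToricCharts.
Variables (R : realType) (m k : nat) (w : 'M[int]_(k, m)) (mu : 'cV[R]_k).
Variable idx : 'I_k -> 'I_(m + 1).
Notation N := (simplex_normals m).
Notation v := (col_mx N w).
Notation lam := (col_mx (simplex_offsets R m) mu).
Notation d := (m + 1 + k)%N.
Hypothesis idxI : injective idx.
Hypothesis wE : forall j, row j w = - row (idx j) N.
Let c j := mu j 0 + simplex_offsets R m (idx j) 0.
Hypothesis c01 : forall j, 0 < c j < 1.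
Hypothesis cc1 : forall i j, i != j -> 1 < c i + c j.
Notation edge_l := (@edge_l m k).
Notation edge_t := (@edge_t m k).
Variable e : extension d k.+1.
Hypothesis eT : extends_torus_action R v e.
Notation Z := (level_set v lam).
Notation orb := (ext_orbit e).
Notation V := 'M[R]_(d, 4).
Notation F := 'M[R]_(m, 4).

Lemma quarticE (q : V) a : quartic q a = qabs (row a q) ^+ 4.
Proof. by rewrite /quartic -qabs_sqr -exprM. Qed.

Lemma quartic_ge0 (q : V) a : 0 <= quartic q a.
Proof. by rewrite sqr_ge0. Qed.

Lemma quartic_gt0 (q : V) a : (0 < quartic q a) = (row a q != 0).
Proof. by rewrite lt_def quartic_ge0 andbT sqrf_eq0 sqnorm_eq0. Qed.

Lemma quartic_ext_act h (q : V) a : Sp1 h -> quartic (ext_act e h q) a = quartic q a.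
Proof. by move=> h1; rewrite /quartic sqnorm_ext_act. Qed.

Lemma level_set_act h (q : V) : Sp1 h -> Z q -> Z (ext_act e h q).
Proof.
move=> h1 /(level_setP _ wE)[q4 qc]; apply/(level_setP _ wE); split=> [|j].
  by under eq_bigr do rewrite quartic_ext_act //.
by rewrite !quartic_ext_act.
Qed.

Lemma smooth_on_quartic (U : set V) a : open U -> smooth_on U (fun q : V => quartic q a).
Proof.
move=> oU; apply: smooth_on_exp => //; apply: smooth_on_sqnorm => //.
by apply: smooth_on_row => //; exact: smooth_on_id.
Qed.

Lemma compact_level_set : compact Z.
Proof.
have cq a : continuous (fun q : V => quartic q a).
  by apply: smooth_continuous; apply: (smooth_on_quartic _ openT).
apply: bounded_closed_compact_mx.
  have lb : Z `<=` [set q | `|q| <= 2].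
    move=> q /(level_setP _ wE)[q4 qc].
    have l4 l : quartic q (edge_l l) <= 4.
      rewrite -q4 (bigD1 l) //= lerDl; apply: sumr_ge0 => i _; exact: quartic_ge0.
    have a4 a : quartic q a <= 4.
      case: (split_ordP a) => [l ->|j ->]; first exact: l4.
      have /andP[_ c1] := c01 j; have := quartic_ge0 q (edge_l (idx j)).
      by have := qc j; rewrite -/(edge_t j) -/(c j); lra.
    apply: mx_norm_le => // i b.
    have r2 : sqnorm (row i q) <= 2.
      rewrite -(@ler_pXn2r _ 2) ?nnegrE ?sqnorm_ge0 //.
      by rewrite (_ : 2 ^+ 2 = 4 :> R) ?a4 //; ring.
    have : q i b ^+ 2 <= sqnorm (row i q).
      rewrite /sqnorm big_ord1 (bigD1 b) //= mxE lerDl.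
      by apply: sumr_ge0 => j _; exact: sqr_ge0.
    move=> b2; rewrite -(@ler_pXn2r _ 2) ?nnegrE // real_normK ?num_real //.
    by rewrite expr2; lra.
  exists 2; split=> [|M M2 q /lb q2]; first exact: num_real.
  by apply: le_trans q2 (ltW M2).
rewrite (_ : Z = (fun q => \sum_l quartic q (edge_l l)) @^-1` [set 4] `&`
    \bigcap_j (fun q => quartic q (edge_l (idx j)) + quartic q (edge_t j)) @^-1` [set 4 * c j]).
  apply: closedI.
    apply: closed_comp; last exact: closed_eq.
    move=> q _; apply: (smooth_continuous (f := fun q => \sum_l quartic q (edge_l l))).
    by apply: (smooth_on_sum _ openT) => l; exact: (smooth_on_quartic _ openT).
  apply: closed_bigI => j _; apply: closed_comp; last exact: closed_eq.
  move=> q _; apply: (smooth_continuous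
    (f := fun q => quartic q (edge_l (idx j)) + quartic q (edge_t j))).
  by apply: (smooth_on_add openT); exact: (smooth_on_quartic _ openT).
apply/seteqP; split=> [q /(level_setP _ wE)[q4 qc]|q [q4 qc]].
  by split=> // j _; exact: qc.
by apply/(level_setP _ wE); split=> // j; exact: (qc j).
Qed.

Lemma toric_second_countable : @second_countable (toric_manifold v lam e).
Proof.
apply: quotient_second_countable => q q' Zq Zq' /ext_orbitP[h h1 q'E].
exists (ext_act e h); split=> // [|p Zp]; first exact: continuous_ext_act.
split; first exact: level_set_act.
by apply/esym/ext_orbitP; exists h.
Qed.

Section Chart.
Variables (l0 : 'I_(m + 1)) (o : option 'I_k).
Hypothesis l0o : forall j, o = Some j -> l0 != idx j.
Notation S := (pinned idx l0 o).

Definition other_l (r : 'I_m) : 'I_(m + 1) :=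
  cast_ord (esym (addn1 m)) (lift (cast_ord (addn1 m) l0) r).

Lemma other_l_inj : injective other_l.
Proof. by move=> r r' /cast_ord_inj/lift_inj. Qed.

Lemma other_l_neq r : other_l r != l0.
Proof.
apply/eqP => /(congr1 (cast_ord (addn1 m))); rewrite cast_ordKV => /eqP.
by rewrite eq_sym (negPf (neq_lift _ _)).
Qed.

Lemma other_lP l : l = l0 \/ exists r, l = other_l r.
Proof.
have [r rE|E] := unliftP (cast_ord (addn1 m) l0) (cast_ord (addn1 m) l).
  right; exists r; apply: (@cast_ord_inj _ _ (addn1 m)).
  by rewrite cast_ordKV.
by left; exact: (cast_ord_inj E).
Qed.

Lemma sum_other_l (G : 'I_(m + 1) -> R) : \sum_l G l = G l0 + \sum_r G (other_l r).
Proof.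
rewrite (bigD1 l0) //=; congr (_ + _).
rewrite -(big_imset (h := other_l) (A := predT)) => [|r r' _ _ /other_l_inj//].
apply: eq_bigl => l; apply/idP/imsetP => [|[r _ ->]]; last exact: other_l_neq.
by case: (other_lP l) => [->|[r ->] _]; [rewrite eqxx|exists r].
Qed.

(** The m coordinates outside [pinned l0 o]; at a vertex on the cut [j] the place of the coordinate
    [idx j] is taken by t_j. *)
Definition free_edge (r : 'I_m) : 'I_d :=
  if o is Some j then if other_l r == idx j then edge_t j else edge_l (other_l r)
  else edge_l (other_l r).

Lemma free_edge_pinned r : free_edge r \notin S.
Proof.
rewrite /free_edge; case oE: o => [j|].
  case: eqP => [_|/eqP rj]; first by rewrite mem_pinned_t eqxx.
  by rewrite mem_pinned_l negb_or other_l_neq.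
by rewrite mem_pinned_l orbF other_l_neq.
Qed.

Lemma free_edge_inj : injective free_edge.
Proof.
rewrite /free_edge => r r'; case: o => [j|].
  case: eqP => [rj|_]; case: eqP => [r'j|_] /eqP; rewrite ?edge_lt //.
  - by move=> _; apply: other_l_inj; rewrite rj r'j.
  - by rewrite eq_sym edge_lt.
  by rewrite (inj_eq (@lshift_inj _ _)) => /eqP/other_l_inj.
by move=> /lshift_inj/other_l_inj.
Qed.

Lemma free_edgeP a : a \in S \/ exists r, a = free_edge r.
Proof.
case: (split_ordP a) => [l ->|j ->].
  rewrite mem_pinned_l; case: (other_lP l) => [->|[r ->]]; first by left; rewrite eqxx.
  rewrite /free_edge; case oE: o => [j|]; last by right; exists r.
  case: (eqVneq (other_l r) (idx j)) => rj; first by left; rewrite orbT.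
  by right; exists r; rewrite (negPf rj).
rewrite mem_pinned_t; case: eqP => [oj|]; last by left.
right; case: (other_lP (idx j)) => [E|[r rE]]; first by have := l0o oj; rewrite E eqxx.
by exists r; rewrite /free_edge oj -rE eqxx.
Qed.

(* |q_a|^4 on the level set as a function of the free coordinates u *)
Definition level_r (u : F) (r : 'I_m) : R :=
  if (if o is Some j then other_l r == idx j else false)
  then 4 * (if o is Some j then c j else 0) - sqnorm (row r u) ^+ 2
  else sqnorm (row r u) ^+ 2.

Definition level_l (u : F) (l : 'I_(m + 1)) : R :=
  if [pick r | other_l r == l] is Some r then level_r u r
  else 4 - \sum_r level_r u r.

Definition level_of (u : F) (a : 'I_d) : R :=
  match fintype.split a with
  | inl l => level_l u l
  | inr j => 4 * c j - level_l u (idx j)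
  end.

Lemma level_other u r : level_of u (edge_l (other_l r)) = level_r u r.
Proof.
rewrite /level_of (unsplitK (inl _)) /level_l.
by case: pickP => [r' /eqP/other_l_inj ->//|/(_ r)]; rewrite eqxx.
Qed.

Lemma level_base u : level_of u (edge_l l0) = 4 - \sum_r level_r u r.
Proof.
rewrite /level_of (unsplitK (inl _)) /level_l.
by case: pickP => [r' |//]; rewrite (negPf (other_l_neq r')).
Qed.

Lemma level_t u j : level_of u (edge_t j) = 4 * c j - level_of u (edge_l (idx j)).
Proof. by rewrite /level_of (unsplitK (inl _)) (unsplitK (inr _)). Qed.

Lemma level_free u r : level_of u (free_edge r) = sqnorm (row r u) ^+ 2.
Proof.
rewrite /free_edge; case oE: o => [j|]; last by rewrite level_other /level_r oE.
case: eqP => rj; last by rewrite level_other /level_r oE; case: eqP.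
by rewrite level_t -rj level_other /level_r oE rj eqxx subKr.
Qed.

Lemma level_of_unique u q : Z q ->
  (forall r, sqnorm (row r u) ^+ 2 = quartic q (free_edge r)) ->
  forall a, level_of u a = quartic q a.
Proof.
move=> /(level_setP _ wE)[q4 qc] uq.
have El r : level_of u (edge_l (other_l r)) = quartic q (edge_l (other_l r)).
  have := uq r; rewrite level_other /free_edge /level_r; case: o => [j|] //.
  by case: eqP => // -> ->; rewrite -(qc j) addrK.
have Ea l : level_of u (edge_l l) = quartic q (edge_l l).
  case: (other_lP l) => [->|[r ->]] //.
  rewrite level_base -q4 sum_other_l; under [X in _ - X]eq_bigr do rewrite -level_other El.
  by rewrite addrK.
move=> a; case: (split_ordP a) => [l ->|j ->]; first exact: Ea.
by rewrite -/(edge_t j) level_t Ea -(qc j) addrC addKr.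
Qed.

Definition section_of (u : F) : V := \matrix_a
  if [pick r | free_edge r == a] is Some r then row r u
  else (level_of u a `^ 4^-1) *: qone R.

Lemma section_free u r : row (free_edge r) (section_of u) = row r u.
Proof.
rewrite rowK; case: pickP => [r' /eqP/free_edge_inj ->//|/(_ r)].
by rewrite eqxx.
Qed.

Lemma section_pinned u a : a \in S ->
  row a (section_of u) = (level_of u a `^ 4^-1) *: qone R.
Proof.
move=> aS; rewrite rowK; case: pickP => // r /eqP ra.
by have := free_edge_pinned r; rewrite ra aS.
Qed.

Definition chart_range : set F := [set u | forall a, a \in S -> 0 < level_of u a].

Lemma smooth_level a : smooth_on setT (level_of^~ a).
Proof.
have sr r : smooth_on setT (level_r^~ r).
  have s4 : smooth_on setT (fun u : F => sqnorm (row r u) ^+ 2).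
    apply: (smooth_on_exp _ openT); apply: (smooth_on_sqnorm openT).
    by apply: (smooth_on_row openT); exact: (smooth_on_id openT).
  case E : (if o is Some j then other_l r == idx j else false);
    under eq_fun do rewrite /level_r E; last exact: s4.
  by apply: (smooth_on_sub openT) => //; exact: (smooth_on_cst _ openT).
have sl l : smooth_on setT (level_l^~ l).
  case E : [pick r | other_l r == l] => [i|]; under eq_fun do rewrite /level_l E.
    exact: sr.
  apply: (smooth_on_sub openT); first exact: (smooth_on_cst _ openT).
  exact: (smooth_on_sum _ openT).
case E : (fintype.split a) => [l|j]; under eq_fun do rewrite /level_of E.
  exact: sl.
by apply: (smooth_on_sub openT) => //; exact: (smooth_on_cst _ openT).
Qed.

Lemma open_chart_range : open chart_range.
Proof.
apply: (@open_forall_gt0 _ R _ (mem S) (fun a u => level_of u a)) => a _.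
exact: smooth_continuous (smooth_level a).
Qed.

Lemma smooth_section : smooth_on chart_range section_of.
Proof.
have oD := open_chart_range; apply: (smooth_on_rows oD) => a.
case: (free_edgeP a) => [aS|[r ->]]; last first.
  under eq_fun do rewrite section_free.
  by apply: (smooth_on_row oD); exact: smooth_on_id.
under eq_fun do rewrite section_pinned //.
apply: (smooth_on_scale oD); last exact: smooth_on_cst.
apply: (smooth_on_comp_real oD (smooth_on_powR _)) => [|u]; last exact.
by apply: smooth_on_subset (smooth_level a).
Qed.

Lemma quartic_section u a : chart_range u -> quartic (section_of u) a = level_of u a.
Proof.
move=> Du; case: (free_edgeP a) => [aS|[r ->]]; last by rewrite level_free /quartic section_free.
rewrite /quartic section_pinned // sqnormZ sqnorm1 mulr1 -exprM.
rewrite -powR_mulrn ?powR_ge0 // -powRrM mulVf ?pnatr_eq0 // powRr1 // ltW //.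
exact: Du.
Qed.

Lemma section_level u : chart_range u -> Z (section_of u).
Proof.
move=> Du; apply/(level_setP _ wE); split.
  under eq_bigr do rewrite quartic_section //.
  rewrite sum_other_l level_base; under [X in _ + X]eq_bigr do rewrite level_other.
  by rewrite subrK.
by move=> j; rewrite !quartic_section // level_t addrC subrK.
Qed.

Lemma section_support u : chart_range u -> support_on S (section_of u).
Proof. by move=> Du a aS; rewrite -quartic_gt0 quartic_section //; exact: Du. Qed.

Lemma support_act h (q : V) : Sp1 h -> support_on S q -> support_on S (ext_act e h q).
Proof. by move=> h1 Sq a aS; rewrite -quartic_gt0 quartic_ext_act // quartic_gt0 Sq. Qed.

Definition positive_on (q : V) := forall a, a \in S -> exists2 r, 0 < r & row a q = r *: qone R.

Lemma positive_unique (q q' : V) : positive_on q -> positive_on q' -> orb q = orb q' -> q = q'.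
Proof.
move=> pq pq' /ext_orbitP[h h1 q'E]; rewrite q'E.
apply/esym/(spanning_rigid (pinned_spanning idxI wE eT l0o) h1) => //.
by rewrite -q'E.
Qed.

(** [g] applies the smooth gauge that makes the pinned coordinates positive and reads off the free
    ones; rigidity makes it invariant, and the level equations return the pinned coordinates from
    the free ones. The last clause serves to compute transitions. *)
Lemma toric_slice (z0 : Z) : exists g : V -> F,
  [/\ let ch := slice_chart orb (support_on S) g section_of z0 in
      [/\ toric_charts v lam e ch, cimg ch = chart_range,
        forall z : Z, cdom ch (orbit_proj orb z) <-> support_on S (set_val z) &
        forall z : Z, support_on S (set_val z) ->
          cfwd ch (orbit_proj orb z) = g (set_val z)],
      forall q, Z q -> support_on S q -> chart_range (g q) /\ orb (section_of (g q)) = orb q &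
      forall q, Z q -> support_on S q -> positive_on q ->
        g q = \matrix_r row (free_edge r) q].
Proof.
have [G [sG GP]] := gauge_exists R (pinned_spanning idxI wE eT l0o) (card_pinned idxI l0o).
pose gq (q : V) := ext_act e (G q) q.
pose g (q : V) : F := \matrix_r row (free_edge r) (gq q).
have gE q r : row r (g q) = row (free_edge r) (gq q) by rewrite rowK.
have oO : open (support_on S : set V) by exact: open_support_on.
have oD := open_chart_range.
have orbG q : support_on S q -> orb (gq q) = orb q.
  by move=> /GP[h1 _]; apply/esym/ext_orbitP; exists (G q).
have pG q : support_on S q -> positive_on (gq q).
  move=> Sq a aS; have [_ GS] := GP q Sq; exists (qabs (row a q)); last exact: GS.
  by rewrite qabs_gt0 Sq.
have gqE q : support_on S q -> positive_on q -> gq q = q.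
  by move=> Sq pq; apply: positive_unique => //; [exact: pG|exact: orbG].
have satO q q' : Z q -> Z q' -> orb q = orb q' -> support_on S q -> support_on S q'.
  by move=> _ _ /ext_orbitP[h h1 ->]; exact: support_act.
have sg : smooth_on (support_on S) g.
  apply: (smooth_on_rows oO) => r; under eq_fun do rewrite rowK row_ext_act.
  have sn b : smooth_on (support_on S) (fun q => at_node (G q) b).
    case: b => [i|] /=; last exact: smooth_on_cst.
    exact: (smooth_on_row oO).
  apply: (smooth_on_qmul oO); last exact: (smooth_on_qconj oO).
  apply: (smooth_on_qmul oO) => //; apply: (smooth_on_row oO); exact: smooth_on_id.
have ginv q q' : Z q -> Z q' -> orb q = orb q' -> support_on S q -> g q = g q'.
  move=> Zq Zq' qq Sq; have Sq' := satO _ _ Zq Zq' qq Sq.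
  suff E : gq q = gq q' by rewrite /g E.
  by apply: positive_unique; [exact: pG|exact: pG|rewrite !orbG].
have sectE q : Z q -> support_on S q -> chart_range (g q) /\ section_of (g q) = gq q.
  move=> Zq Sq; have [h1 GS] := GP q Sq; have Zg : Z (gq q) by exact: level_set_act.
  have lE a : level_of (g q) a = quartic (gq q) a.
    by apply: level_of_unique => // r; rewrite rowK.
  have Dg : chart_range (g q).
    by move=> a aS; rewrite lE quartic_gt0; exact: support_act.
  split=> //; apply/row_matrixP => a.
  case: (free_edgeP a) => [aS|[r ->]]; last by rewrite section_free rowK.
  rewrite section_pinned // lE quartic_ext_act // quarticE -powR_mulrn ?qabs_ge0 //.
  by rewrite -powRrM mulfV ?pnatr_eq0 // powRr1 ?qabs_ge0 // -GS.
have psect u : chart_range u -> positive_on (section_of u).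
  move=> Du a aS; exists (level_of u a `^ 4^-1); last exact: section_pinned.
  by apply: powR_gt0; exact: Du.
have gsect u : chart_range u -> [/\ Z (section_of u), support_on S (section_of u) & g (section_of u) = u].
  move=> Du; have Ss := section_support Du.
  split=> //; first exact: section_level.
  apply/row_matrixP => r; rewrite gE gqE ?section_free //; exact: psect.
have gO q : Z q -> support_on S q -> chart_range (g q) /\ orb (section_of (g q)) = orb q.
  by move=> Zq Sq; have [Dg ->] := sectE q Zq Sq; split=> //; exact: orbG.
exists g; split=> //; last first.
  by move=> q Zq Sq pq; apply/row_matrixP => r; rewrite gE gqE // rowK.
split.
- exact: (slice_chart_quotient z0 oO oD satO sg ginv smooth_section gsect gO).
- exact: (slice_cimg z0 satO ginv gsect gO).
- move=> z; exact: (slice_cdom g section_of z0 satO).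
- move=> z; exact: (slice_cfwd section_of z0 ginv).
Qed.

End Chart.

(** If t_j0 = 0, then |q_(idx j0)|^4 = 4 c_j0 < 4, so a second simplex coordinate is nonzero;
    another vanishing t_j would push the sum beyond 4, as c_j0 + c_j > 1. If no t_j vanishes, any
    nonzero simplex coordinate serves as [l0]. *)
Lemma support_cover (q : V) : Z q -> exists l0 o,
  (forall j, o = Some j -> l0 != idx j) /\ support_on (pinned idx l0 o) q.
Proof.
move=> /(level_setP _ wE)[q4 qc].
have [/existsP[j0 /eqP t0]|] := boolP [exists j, row (edge_t j) q == 0].
  have X0 : quartic q (edge_t j0) = 0.
    by apply/eqP; rewrite eq_le quartic_ge0 andbT leNgt quartic_gt0 t0 eqxx.
  have Xj := qc j0; rewrite X0 addr0 in Xj.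
  have /andP[c0 c1] := c01 j0.
  have [l /andP[lj l0]] : exists l, (l != idx j0) && (row (edge_l l) q != 0).
    apply/existsP; rewrite -[X in is_true X]negbK negb_exists; apply/negP => /forallP H.
    have := q4; rewrite (bigD1 (idx j0)) //= big1 => [|l lj].
      by rewrite addr0 Xj -/(c j0); lra.
    have := H l; rewrite lj /= negbK => /eqP ql; apply/eqP.
    by rewrite eq_le quartic_ge0 andbT leNgt quartic_gt0 ql eqxx.
  exists l, (Some j0); split=> [j [<-]//|a]; case: (split_ordP a) => [l' ->|j ->].
    rewrite mem_pinned_l => /orP[/eqP -> //|/eqP ->].
    by rewrite -quartic_gt0 Xj mulr_gt0.
  rewrite mem_pinned_t => jj; apply/eqP => tj.
  have Xt : quartic q (edge_t j) = 0.
    by apply/eqP; rewrite eq_le quartic_ge0 andbT leNgt quartic_gt0 tj eqxx.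
  have Xi := qc j; rewrite Xt addr0 in Xi.
  have ij : j0 != j by apply: contra jj => /eqP ->.
  have := q4; rewrite (bigD1 (idx j0)) //= (bigD1 (idx j)) /=; last first.
    by rewrite (inj_eq idxI) eq_sym.
  have : 0 <= \sum_(i | (i != idx j0) && (i != idx j)) quartic q (edge_l i).
    by apply: sumr_ge0 => i _; exact: quartic_ge0.
  have := cc1 ij; rewrite Xi Xj -/(c j) -/(c j0); lra.
rewrite negb_exists => /forallP t0.
have [l l0] : exists l, row (edge_l l) q != 0.
  apply/existsP; rewrite -[X in is_true X]negbK negb_exists; apply/negP => /forallP H.
  have := q4; rewrite big1 => [|l _]; first by move/eqP; rewrite eq_sym pnatr_eq0.
  have := H l; rewrite negbK => /eqP ql; apply/eqP.
  by rewrite eq_le quartic_ge0 andbT leNgt quartic_gt0 ql eqxx.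
exists l, None; split=> // a; case: (split_ordP a) => [l' ->|j ->].
  by rewrite mem_pinned_l orbF => /eqP ->.
by move=> _; exact: t0.
Qed.

Lemma toric_common_chart (x y : toric_manifold v lam e) :
  (forall a, sqnorm (row a (set_val (repr x))) = sqnorm (row a (set_val (repr y)))) ->
  exists2 ch, toric_charts v lam e ch & cdom ch x /\ cdom ch y.
Proof.
move=> xy; have [l0 [cut_edge [l0o Sx]]] := support_cover (set_val_in (repr x)).
have [g [[chA _ chD _] _ _]] := toric_slice l0o (repr x).
eexists; first exact: chA.
have := chD (repr x); have := chD (repr y); rewrite !orbit_proj_repr => cy cx.
split; first exact/cx.
by apply/cy => a aS; rewrite -sqnorm_gt0 -xy sqnorm_gt0 Sx.
Qed.

(** The norms of the coordinates are continuous and invariant; points with equal norms share a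
    chart, as its domain only asks which coordinates vanish. *)
Lemma toric_hausdorff : hausdorff_space (toric_manifold v lam e).
Proof.
apply: (@hausdorff_charts _ _ (toric_charts v lam e) 'I_d R
  (fun a x => sqnorm (row a (set_val (repr x))))).
- exact: norm_hausdorff.
- exact: norm_hausdorff.
- move=> a; apply: orbit_space_continuous => z.
  rewrite (_ : _ \o _ = (fun q : V => sqnorm (row a q)) \o (@set_val V Z)).
    apply: continuous_comp; first exact: set_val_continuous.
    apply: (smooth_continuous (f := fun q : V => sqnorm (row a q))).
    apply: (smooth_on_sqnorm openT); apply: (smooth_on_row openT).
    exact: (smooth_on_id openT).
  apply/funext => z' /=; have := orb_repr orb z'.
  by move/ext_orbitP => [h h1 ->]; rewrite sqnorm_ext_act.
- by move=> ch [].
- exact: toric_common_chart.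
Qed.

Lemma toric_smooth_manifold : smooth_manifold (toric_charts v lam e).
Proof.
apply: quotient_manifold.
- exact: toric_hausdorff.
- exact: toric_second_countable.
by move=> x; have [|ch Ach [cx _]] := @toric_common_chart x x; last by exists ch.
Qed.

Lemma toric_compact : compact [set: toric_manifold v lam e].
Proof. exact: orbit_space_compact compact_level_set. Qed.

End ToricCharts.

(** * Charts of the projective space *)

Section ProjectiveSpace.
Variables (R : realType) (m : nat).
Notation E := 'M[R]_(m.+1, 4).
Notation F := 'M[R]_(m, 4).
Notation orb := (@scalar_orbit R m.+1).
Notation sphere := (@unit_sphere R m.+1).

Lemma row_lscale n h (q : 'M[R]_(n, 4)) i : row i (lscale h q) = qmul h (row i q).
Proof. by rewrite rowK. Qed.

Lemma lscaleM n h h' (q : 'M[R]_(n, 4)) :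
  lscale (qmul h h') q = lscale h (lscale h' q).
Proof. by apply/row_matrixP => i; rewrite !row_lscale qmulA. Qed.

Lemma lscale1 n (q : 'M[R]_(n, 4)) : lscale (qone R) q = q.
Proof. by apply/row_matrixP => i; rewrite row_lscale qmul1q. Qed.

Lemma sqnorm_lscale n h (q : 'M[R]_(n, 4)) : sqnorm (lscale h q) = sqnorm h * sqnorm q.
Proof.
rewrite !(sqnorm_row (lscale h q)) (sqnorm_row q) mulr_sumr.
by apply: eq_bigr => i _; rewrite row_lscale sqnormM.
Qed.

Lemma scalar_orbitP n (q q' : 'M[R]_(n, 4)) : scalar_orbit q = scalar_orbit q' <->
  exists2 h, sqnorm h = 1 & q' = lscale h q.
Proof.
split=> [E|[h h1 ->]].
  have : scalar_orbit q' q' by exists (qone R); [exact: sqnorm1|exact: lscale1].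
  by rewrite -E => -[h h1 <-]; exists h.
apply/seteqP; split=> _ [g g1 <-].
  exists (qmul g (qconj h)); first by rewrite /= sqnormM sqnorm_conj g1 h1 mulr1.
  by rewrite -lscaleM mulV_unitK.
exists (qmul g h); first by rewrite /= sqnormM g1 h1 mulr1.
by rewrite lscaleM.
Qed.

Lemma continuous_lscale h : continuous (lscale h : E -> E).
Proof.
apply: smooth_continuous; apply: (smooth_on_rows openT) => i.
under eq_fun do rewrite row_lscale.
apply: (smooth_on_qmul openT); first exact: (smooth_on_cst _ openT).
by apply: (smooth_on_row openT); exact: (smooth_on_id openT).
Qed.

Lemma sphere_act (q q' : E) : sphere q -> sphere q' -> orb q = orb q' ->
  exists phi : E -> E, [/\ continuous phi, phi q = q' &
    forall p, sphere p -> sphere (phi p) /\ orb (phi p) = orb p].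
Proof.
move=> q1 q'1 /scalar_orbitP[h h1 q'E]; exists (lscale h).
split=> // [|p p1]; first exact: continuous_lscale.
split; first by rewrite /unit_sphere /= sqnorm_lscale h1 p1 mulr1.
by apply/esym/scalar_orbitP; exists h.
Qed.

Lemma sqnorm_coord_le (q : E) i j : `|q i j| ^+ 2 <= sqnorm q.
Proof.
rewrite real_normK ?num_real // /sqnorm (bigD1 i) //= (bigD1 j) //= -addrA lerDl.
apply: addr_ge0; first by apply: sumr_ge0 => j' _; exact: sqr_ge0.
by apply: sumr_ge0 => i' _; apply: sumr_ge0 => j' _; exact: sqr_ge0.
Qed.

Lemma compact_sphere : compact sphere.
Proof.
apply: bounded_closed_compact_mx.
  exists 1; split=> [|M M1 q q1]; first exact: num_real.
  apply: le_trans (ltW M1); apply: mx_norm_le => // i j.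
  rewrite -(@ler_pXn2r _ 2) ?nnegrE // expr1n.
  by apply: le_trans (sqnorm_coord_le _ _ _) _; rewrite q1.
rewrite (_ : sphere = (@sqnorm R m.+1 4) @^-1` [set 1]) //.
apply: closed_comp; last exact: closed_eq.
move=> q _; apply: (smooth_continuous (f := @sqnorm R m.+1 4)).
by apply: (smooth_on_sqnorm openT); exact: (smooth_on_id openT).
Qed.

Lemma HP_compact : compact [set: HP R m].
Proof. exact: orbit_space_compact compact_sphere. Qed.

Section Chart.
Variables (i : 'I_m.+1) (delta : R) (f : bool).
Hypothesis delta0 : 0 < delta.

Definition flip (b : bool) (p : 'rV[R]_4) := if b then qconj p else p.

Lemma sqnorm_flip b p : sqnorm (flip b p) = sqnorm p.
Proof. by case: b; rewrite //= sqnorm_conj. Qed.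

Lemma flipK b : involutive (flip b).
Proof. by case: b => p; rewrite /= ?qconjK. Qed.

Lemma flipZ b r p : flip b (r *: p) = r *: flip b p.
Proof. by case: b; rewrite //= qconjZ. Qed.

(** Dividing by the direction of q_i instead of q_i itself gives |coord|^2 = (1 - |q_i|^2) / delta
    on the sphere, so the open unit ball of the chart is |q_i|^2 > 1 - delta, the piece to be
    removed when delta = 1 - c_j. *)
Definition affine_coord (q : E) : F := \matrix_r ((delta `^ (2^-1))^-1 *:
  flip f (qmul (qconj (qdir (row i q))) (row (lift i r) q))).

Definition affine_range : set F := [set u | 0 < 1 - delta * sqnorm u].

Definition affine_section (u : F) : E := \matrix_l
  if unlift i l is Some r then (delta `^ (2^-1)) *: flip f (row r u)
  else (1 - delta * sqnorm u) `^ (2^-1) *: qone R.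

Definition affine_domain : set E := [set q | row i q != 0].

Let d1 : delta `^ (2^-1) != 0.
Proof. by rewrite gt_eqF // powR_gt0. Qed.

Let d2 : (delta `^ (2^-1)) ^+ 2 = delta.
Proof. by rewrite -powR_mulrn ?powR_ge0 // -powRrM mulVf ?pnatr_eq0 // powRr1 // ltW. Qed.

Lemma sqnorm_affine q : sphere q -> affine_domain q ->
  delta * sqnorm (affine_coord q) = 1 - sqnorm (row i q).
Proof.
move=> q1 qi; have : \sum_l sqnorm (row l q) = 1 by rewrite -sqnorm_row.
rewrite (bigD1_ord i) //= => <-; rewrite [RHS]addrAC subrr add0r sqnorm_row mulr_sumr.
apply: eq_bigr => r _; rewrite rowK sqnormZ sqnorm_flip sqnormM sqnorm_conj.
by rewrite sqnorm_dir // mul1r exprVn d2 mulVKf // gt_eqF.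
Qed.

Lemma affine_section_i u : row i (affine_section u) =
  (1 - delta * sqnorm u) `^ (2^-1) *: qone R.
Proof. by rewrite rowK unlift_none. Qed.

Lemma affine_section_lift u r : row (lift i r) (affine_section u) =
  (delta `^ (2^-1)) *: flip f (row r u).
Proof. by rewrite rowK liftK. Qed.

Lemma qdir_real (r : R) : 0 < r -> qdir (r *: qone R) = qone R.
Proof.
move=> r0; have rq : r *: qone R != 0.
  by rewrite -sqnorm_gt0 sqnormZ sqnorm1 mulr1 exprn_gt0.
by rewrite qdirE // qabs_real ?(ltW r0) // scalerA mulVf ?scale1r // gt_eqF.
Qed.

Lemma affine_sectionP u : affine_range u -> [/\ sphere (affine_section u),
  affine_domain (affine_section u) & affine_coord (affine_section u) = u].
Proof.
move=> u1; have p0 : 0 < (1 - delta * sqnorm u) `^ (2^-1) by exact: powR_gt0.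
split.
- rewrite /unit_sphere /= sqnorm_row (bigD1_ord i) //= affine_section_i sqnormZ sqnorm1.
  rewrite mulr1 -powR_mulrn ?powR_ge0 // -powRrM mulVf ?pnatr_eq0 // powRr1 ?(ltW u1) //.
  under eq_bigr do rewrite affine_section_lift sqnormZ d2 sqnorm_flip.
  by rewrite -mulr_sumr -sqnorm_row subrK.
- by rewrite /affine_domain /= affine_section_i -sqnorm_gt0 sqnormZ sqnorm1 mulr1 exprn_gt0.
apply/row_matrixP => r; rewrite rowK affine_section_i qdir_real // qconj1 qmul1q.
by rewrite affine_section_lift flipZ flipK scalerA mulVf // scale1r.
Qed.

Lemma qdirM (h p : 'rV[R]_4) : sqnorm h = 1 -> qdir (qmul h p) = qmul h (qdir p).
Proof. by move=> h1; rewrite /qdir sqnormM h1 mul1r qmulZr. Qed.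

Lemma affine_coord_lscale h q : sqnorm h = 1 -> affine_coord (lscale h q) = affine_coord q.
Proof.
move=> h1; apply/row_matrixP => r; rewrite !rowK qdirM // qconjM -qmulA.
by rewrite unit_VmulK.
Qed.

Lemma affine_coordP q : sphere q -> affine_domain q ->
  affine_range (affine_coord q) /\ orb (affine_section (affine_coord q)) = orb q.
Proof.
move=> q1 qi; have sE := sqnorm_affine q1 qi.
have rE : 1 - delta * sqnorm (affine_coord q) = sqnorm (row i q) by rewrite sE subKr.
split; first by rewrite /affine_range /= rE sqnorm_gt0.
apply/scalar_orbitP; exists (qdir (row i q)); first exact: sqnorm_dir.
apply/row_matrixP => l; rewrite row_lscale; case: (unliftP i l) => [r ->|->].
  rewrite affine_section_lift rowK flipZ flipK scalerA mulfV // scale1r.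
  by rewrite unit_mulVK // sqnorm_dir.
by rewrite affine_section_i rE -/(qabs _) qmulr_real -qabs_dir.
Qed.

Lemma open_affine_domain : open affine_domain.
Proof.
rewrite (_ : affine_domain = (fun q : E => sqnorm (row i q)) @^-1` [set t | 0 < t]).
  have : continuous (fun q : E => sqnorm (row i q)).
    apply: smooth_continuous; apply: (smooth_on_sqnorm openT).
    by apply: (smooth_on_row openT); exact: (smooth_on_id openT).
  by move/continuousP/(_ _ (@open_gt R 0)).
by apply/seteqP; split=> q /=; rewrite sqnorm_gt0.
Qed.

Lemma smooth_range : smooth_on setT (fun u : F => 1 - delta * sqnorm u).
Proof.
apply: (smooth_on_sub openT); first exact: (smooth_on_cst _ openT).
apply: (smooth_on_mul openT); first exact: (smooth_on_cst _ openT).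
by apply: (smooth_on_sqnorm openT); exact: (smooth_on_id openT).
Qed.

Lemma open_affine_range : open affine_range.
Proof.
by have /continuousP/(_ _ (@open_gt R 0)) := smooth_continuous smooth_range.
Qed.

Lemma smooth_flip (V : normedModType R) (U : set V) b (g : V -> 'rV[R]_4) : open U ->
  smooth_on U g -> smooth_on U (fun x => flip b (g x)).
Proof. by case: b => //= oU; exact: smooth_on_qconj. Qed.

Lemma affine_chart (z0 : sphere) : exists ch : chart (HP R m) F,
  [/\ HP_charts ch, cimg ch = affine_range,
    forall z : sphere, cdom ch (orbit_proj orb z) <-> affine_domain (set_val z) &
    forall z : sphere, affine_domain (set_val z) ->
      cfwd ch (orbit_proj orb z) = affine_coord (set_val z)].
Proof.
have oO := open_affine_domain; have oD := open_affine_range.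
have satO q q' : sphere q -> sphere q' -> orb q = orb q' -> affine_domain q -> affine_domain q'.
  move=> _ _ /scalar_orbitP[h h1 ->]; rewrite /affine_domain /= row_lscale.
  by rewrite -!sqnorm_gt0 sqnormM h1 mul1r.
have ginv q q' : sphere q -> sphere q' -> orb q = orb q' -> affine_domain q ->
    affine_coord q = affine_coord q'.
  by move=> _ _ /scalar_orbitP[h h1 ->]; rewrite affine_coord_lscale.
have sr l : smooth_on affine_domain (fun q : E => row l q).
  by apply: smooth_on_row => //; exact: smooth_on_id.
have sg : smooth_on affine_domain affine_coord.
  apply: (smooth_on_rows oO) => r; under eq_fun do rewrite rowK.
  apply: (smooth_on_scale oO); first exact: smooth_on_cst.
  apply: (smooth_flip _ oO); apply: (smooth_on_qmul oO) => //.
  by apply: (smooth_on_qconj oO); exact: (smooth_on_qdir oO).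
have ss : smooth_on affine_range affine_section.
  apply: (smooth_on_rows oD) => l; case: (unliftP i l) => [r ->|->].
    under eq_fun do rewrite affine_section_lift.
    apply: (smooth_on_scale oD); first exact: smooth_on_cst.
    apply: (smooth_flip _ oD); apply: (smooth_on_row oD); exact: smooth_on_id.
  under eq_fun do rewrite affine_section_i.
  apply: (smooth_on_scale oD); last exact: smooth_on_cst.
  apply: (smooth_on_comp_real oD (smooth_on_powR _)) => [|u]; last exact.
  by apply: smooth_on_subset smooth_range.
exists (slice_chart orb affine_domain affine_coord affine_section z0); split.
- exact: (slice_chart_quotient z0 oO oD satO sg ginv ss affine_sectionP affine_coordP).
- exact: (slice_cimg z0 satO ginv affine_sectionP affine_coordP).
- move=> z; exact: (slice_cdom affine_coord affine_section z0 satO).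
- move=> z; exact: (slice_cfwd affine_section z0 ginv).
Qed.

End Chart.
End ProjectiveSpace.

Lemma compact_hausdorff_homeomorphic (X Y : topologicalType) (f : X -> Y) :
  compact [set: X] -> hausdorff_space Y -> continuous f ->
  injective f -> (forall y, exists x, f x = y) -> homeomorphic Y X.
Proof.
move=> cX hY cf fI fS; have /choice[g gP] := fS.
exists g, f; split=> //; last by move=> x; apply: fI; rewrite gP.
apply/continuous_closedP => B cB.
have -> : g @^-1` B = f @` B.
  apply/seteqP; split=> [y By|_ [x Bx <-]]; first by exists (g y).
  by rewrite /preimage /= (_ : g (f x) = x) //; apply: fI; rewrite gP.
apply: compact_closed => //; apply: continuous_compact; first exact: continuous_subspaceT.
exact: subclosed_compact cB cX _.
Qed.

(** * Blowing up *)

Section RadialRoot.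
Variable R : realType.
Implicit Types p : 'rV[R]_4.

Lemma qabs_sqrt n l (x : 'M[R]_(n, l)) : qabs x = Num.sqrt (sqnorm x).
Proof. by rewrite /qabs powR12_sqrt ?sqnorm_ge0. Qed.

(* The radial map with |root p| ^ 4 = 4 |p| ^ 2, between the coordinates of the
   level set and those of the unit sphere. *)
Definition root p : 'rV[R]_4 := (Num.sqrt 2 / Num.sqrt (qabs p)) *: p.
Definition unroot p : 'rV[R]_4 := (qabs p / 2) *: p.

Lemma root0 : root 0 = 0. Proof. by rewrite /root scaler0. Qed.

Lemma sqnorm_root p : sqnorm (root p) = 2 * qabs p.
Proof.
rewrite /root sqnormZ expr_div_n !sqr_sqrtr ?qabs_ge0 // -qabs_sqr expr2.
have [->|p0] := eqVneq (qabs p) 0; first by rewrite !mulr0.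
by rewrite mulrA divfK.
Qed.

Lemma qabsZ (r : R) p : 0 <= r -> qabs (r *: p) = r * qabs p.
Proof. by move=> r0; rewrite -qmul_real qabsM qabs_real. Qed.

Lemma rootK p : unroot (root p) = p.
Proof.
have [->|p0] := eqVneq p 0; first by rewrite root0 /unroot scaler0.
have a0 : 0 < qabs p by rewrite qabs_gt0.
have s0 : 0 < Num.sqrt (qabs p) by rewrite sqrtr_gt0.
have aE : qabs p = Num.sqrt (qabs p) ^+ 2 by rewrite sqr_sqrtr // ltW.
have s2 : Num.sqrt 2 ^+ 2 = 2 :> R by rewrite sqr_sqrtr.
rewrite /unroot {1}/root qabsZ; last by rewrite divr_ge0 // sqrtr_ge0.
rewrite /root scalerA -[RHS]scale1r; congr (_ *: _).
set s := Num.sqrt (qabs p) in s0 aE *; set t := Num.sqrt 2 in s2 *.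
have -> : t / s * qabs p / 2 * (t / s) = t ^+ 2 / 2.
  by rewrite aE; field; rewrite gt_eqF.
by rewrite s2 mulfV ?pnatr_eq0.
Qed.

Lemma unrootK p : root (unroot p) = p.
Proof.
have [->|p0] := eqVneq p 0; first by rewrite /unroot scaler0 root0.
have a0 : 0 < qabs p by rewrite qabs_gt0.
have s2 : Num.sqrt 2 ^+ 2 = 2 :> R by rewrite sqr_sqrtr.
rewrite /root /unroot qabsZ ?divr_ge0 ?qabs_ge0 //.
have -> : qabs p / 2 * qabs p = (qabs p / Num.sqrt 2) ^+ 2.
  by rewrite expr_div_n s2 expr2 mulrAC.
have t0 : 0 < Num.sqrt 2 :> R by rewrite sqrtr_gt0.
rewrite sqrtr_sqr ger0_norm ?divr_ge0 ?qabs_ge0 ?sqrtr_ge0 //.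
rewrite scalerA -[RHS]scale1r; congr (_ *: _).
set t := Num.sqrt 2 in s2 t0 *.
have -> : t / (qabs p / t) * (qabs p / 2) = t ^+ 2 / 2.
  by field; rewrite !gt_eqF.
by rewrite s2 mulfV ?pnatr_eq0.
Qed.

Lemma root_mul X p Y : sqnorm X = 1 -> sqnorm Y = 1 ->
  root (qmul (qmul X p) (qconj Y)) = qmul (qmul X (root p)) (qconj Y).
Proof.
move=> X1 Y1; rewrite /root !qabsM qabs_conj (qabs_unit X1) (qabs_unit Y1).
by rewrite mul1r mulr1 qmulZr qmulZl.
Qed.

Lemma root_inj : injective root.
Proof. exact: can_inj rootK. Qed.

Lemma continuous_qabs n l : continuous (@qabs R n l).
Proof.
move=> x; rewrite (_ : @qabs R n l = Num.sqrt \o @sqnorm R n l).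
  apply: continuous_comp; last exact: sqrt_continuous.
  apply: (smooth_continuous (f := @sqnorm R n l)).
  apply: (smooth_on_sum _ openT) => i; apply: (smooth_on_sum _ openT) => j.
  by apply: (smooth_on_exp _ openT); exact: (smooth_on_coord _ _ openT).
by apply/funext => y; rewrite /= qabs_sqrt.
Qed.

Lemma continuous_root : continuous root.
Proof.
move=> p; have [->|p0] := eqVneq p 0; last first.
  have c : {for p, continuous (fun p => Num.sqrt 2 / Num.sqrt (qabs p) : R)}.
    apply: continuousM; first exact: cst_continuous.
    apply: continuousV; first by rewrite gt_eqF // sqrtr_gt0 qabs_gt0.
    by apply: continuous_comp; [exact: continuous_qabs|exact: sqrt_continuous].
  by apply: (continuousZ c); exact: cvg_id.
(* At 0 the scaling factor blows up; continuity comes from |root p|^2 = 2 |p|. *)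
have bound p' i j : `|root p' i j| <= Num.sqrt (2 * qabs p').
  rewrite -sqnorm_root -sqrtr_sqr ler_wsqrtr // -real_normK ?num_real //.
  rewrite real_normK ?num_real // (ord1 i) /sqnorm big_ord1 (bigD1 j) //= lerDl.
  by apply: sumr_ge0 => j' _; exact: sqr_ge0.
suff : root @ nbhs (0 : 'rV[R]_4) --> (0 : 'rV[R]_4) by rewrite /continuous_at root0.
apply/cvg_ballP => eps eps0.
have c : {for (0 : 'rV[R]_4), continuous (fun p => Num.sqrt (2 * qabs p) : R)}.
  apply: continuous_comp; last exact: sqrt_continuous.
  by apply: continuousM; [exact: cst_continuous|exact: continuous_qabs].
have q0 : qabs (0 : 'rV[R]_4) = 0.
  by rewrite qabs_sqrt (eqP (_ : sqnorm _ == 0)) ?sqrtr0 // sqnorm_eq0.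
have nb : \forall p' \near (0 : 'rV[R]_4), ball (0 : R) eps (Num.sqrt (2 * qabs p')).
  by move: c; rewrite /prop_for /continuous_at /= q0 mulr0 sqrtr0 => /cvg_ballP/(_ _ eps0).
near=> p'; split=> // i j.
have : ball (0 : R) eps (Num.sqrt (2 * qabs p')) by near: p'.
rewrite /ball /= !sub0r !normrN mxE ger0_norm ?sqrtr_ge0 // sub0r normrN.
by apply: le_lt_trans; exact: bound.
Unshelve. all: by end_near. Qed.

End RadialRoot.

Section OrientedShape.
Variables (R : realType) (m k : nat) (w : 'M[int]_(k, m)).
Variable idx : 'I_k -> 'I_(m + 1).
Notation N := (simplex_normals m).
Notation v := (col_mx N w).
Notation d := (m + 1 + k)%N.
Hypothesis idxI : injective idx.
Hypothesis wE : forall j, row j w = - row (idx j) N.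
Notation edge_l := (@edge_l m k).
Notation edge_t := (@edge_t m k).
Notation node := (option 'I_k.+1).
Variable e : extension d k.+1.
Hypothesis eT : extends_torus_action R v e.

(* Conjugating all coordinates reverses the edges; this reduces the position of
   the trivial factor None to two cases. *)
Definition osrc (f : bool) a := if f then tgt e a else src e a.
Definition otgt (f : bool) a := if f then src e a else tgt e a.

Lemma flip_row_act f h (q : 'M[R]_(d, 4)) a : flip f (row a (ext_act e h q)) =
  qmul (qmul (at_node h (osrc f a)) (flip f (row a q))) (qconj (at_node h (otgt f a))).
Proof. by rewrite row_ext_act; case: f => //=; rewrite !qconjM qconjK qmulA. Qed.

Definition oriented_edges f (x y z : node) (b : bool) j : Prop := if b
  then [/\ osrc f (edge_l (idx j)) = z, otgt f (edge_l (idx j)) = y,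
           osrc f (edge_t j) = z & otgt f (edge_t j) = x]
  else [/\ osrc f (edge_l (idx j)) = x, otgt f (edge_l (idx j)) = z,
           osrc f (edge_t j) = y & otgt f (edge_t j) = z].

(** The vertex [None] is x, y or some z_j. Reversal exchanges x with y and negates [b], which leaves
    two positions for [None]: at y, or at a z_j of the form x -> z_j <- y. *)
Lemma oriented_shape : (0 < k -> 1 < m)%N ->
  exists (f : bool) (x y : node) (z : 'I_k -> node) (b : 'I_k -> bool),
  [/\ [/\ x != None, y = None \/ (exists2 j, z j = None & ~~ b j) & x != y],
      injective z, forall j, z j != x /\ z j != y,
      forall l, (forall j, idx j != l) ->
        osrc f (edge_l l) = x /\ otgt f (edge_l l) = y &
      forall j, oriented_edges f x y (z j) (b j) j].
Proof.
move=> km; have [x [y [z [b [xy [zI zxy] nodes unc cutE]]]]] := extension_shape idxI wE eT km.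
have straight : x != None -> y = None \/ (exists2 j, z j = None & ~~ b j) ->
    exists (f : bool) (x y : node) (z : 'I_k -> node) (b : 'I_k -> bool),
  [/\ [/\ x != None, y = None \/ (exists2 j, z j = None & ~~ b j) & x != y],
      injective z, forall j, z j != x /\ z j != y,
      forall l, (forall j, idx j != l) ->
        osrc f (edge_l l) = x /\ otgt f (edge_l l) = y &
      forall j, oriented_edges f x y (z j) (b j) j].
  by move=> xN yN; exists false, x, y, z, b.
have flipped : y != None -> x = None \/ (exists2 j, z j = None & b j) ->
    exists (f : bool) (x y : node) (z : 'I_k -> node) (b : 'I_k -> bool),
  [/\ [/\ x != None, y = None \/ (exists2 j, z j = None & ~~ b j) & x != y],
      injective z, forall j, z j != x /\ z j != y,
      forall l, (forall j, idx j != l) ->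
        osrc f (edge_l l) = x /\ otgt f (edge_l l) = y &
      forall j, oriented_edges f x y (z j) (b j) j].
  move=> yN xN; exists true, y, x, z, (negb \o b); split=> //.
  - split=> //; last by rewrite eq_sym.
    by case: xN => [|[j zj bj]]; [left|right; exists j; rewrite //= negbK].
  - by move=> j; have [? ?] := zxy j.
  - by move=> l /unc[].
  - move=> j; have := cutE j; rewrite /reversed_shape /oriented_edges /=.
    by case: (b j) => -[].
case: (nodes None) => [Nx|Ny|[j Nj]].
- by apply: flipped; [rewrite Nx eq_sym|left].
- by apply: straight; [rewrite Ny|left].
have [zx zy] := zxy j; rewrite -Nj in zx zy; case bj: (b j).
  by apply: flipped; [rewrite eq_sym|right; exists j].
by apply: straight; [rewrite eq_sym|right; exists j; rewrite ?bj].
Qed.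

End OrientedShape.

(** * The toric manifold as a collapse of projective space *)

Section ToricBlowUp.
Variables (R : realType) (m k : nat) (w : 'M[int]_(k, m)) (mu : 'cV[R]_k).
Variable idx : 'I_k -> 'I_(m + 1).
Notation N := (simplex_normals m).
Notation v := (col_mx N w).
Notation lam := (col_mx (simplex_offsets R m) mu).
Notation d := (m + 1 + k)%N.
Hypothesis idxI : injective idx.
Hypothesis wE : forall j, row j w = - row (idx j) N.
Let c j := mu j 0 + simplex_offsets R m (idx j) 0.
Hypothesis c01 : forall j, 0 < c j < 1.
Hypothesis cc1 : forall i j, i != j -> 1 < c i + c j.
Notation edge_l := (@edge_l m k).
Notation edge_t := (@edge_t m k).
Notation node := (option 'I_k.+1).
Variable e : extension d k.+1.
Hypothesis eT : extends_torus_action R v e.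
Notation Z := (level_set v lam).
Notation orb := (ext_orbit e).
Notation V := 'M[R]_(d, 4).
Notation E := 'M[R]_(m.+1, 4).
Notation sphere := (@unit_sphere R m.+1).
Notation H := 'rV[R]_4.

Section Psi.
Variables (f : bool) (x y : node) (z : 'I_k -> node) (b : 'I_k -> bool).
Hypothesis xN : x != None.
Hypothesis yN : y = None \/ (exists2 j, z j = None & ~~ b j).
Hypothesis xy : x != y.
Hypothesis zI : injective z.
Hypothesis zxy : forall j, z j != x /\ z j != y.
Hypothesis uncE : forall l, (forall j, idx j != l) ->
  osrc e f (edge_l l) = x /\ otgt e f (edge_l l) = y.
Hypothesis cutE : forall j, oriented_edges idx e f x y (z j) (b j) j.

Definition hp_coord (l : 'I_(m + 1)) : 'I_m.+1 := cast_ord (addn1 m) l.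

Lemma hp_coord_inj : injective hp_coord. Proof. exact: cast_ord_inj. Qed.

Lemma hp_coord_surj i : exists l, hp_coord l = i.
Proof. by exists (cast_ord (esym (addn1 m)) i); rewrite /hp_coord cast_ordKV. Qed.

Lemma sum_hp_coord (G : 'I_m.+1 -> R) : \sum_l G (hp_coord l) = \sum_i G i.
Proof.
rewrite [RHS](reindex hp_coord) //; exists (cast_ord (esym (addn1 m))) => i _.
  by rewrite /hp_coord cast_ordK.
by rewrite /hp_coord cast_ordKV.
Qed.

Definition centre j : 'I_m.+1 := hp_coord (idx j).

(** On [core], the nonnegative t_j with 4 |q_centre|^2 + t_j^4 = 4 c_j; it vanishes exactly on the
    boundary sphere of the ball [j]. *)
Definition neck j (q : E) : R :=
  Num.sqrt (Num.sqrt (4 * (c j - sqnorm (row (centre j) q)))).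

Definition psi (q : E) : V := \matrix_a
  match fintype.split a with
  | inl l => flip f (root (row (hp_coord l) q))
  | inr j => neck j q *: qone R
  end.

Definition core : set E := [set q | sphere q /\ forall j, sqnorm (row (centre j) q) <= c j].

Lemma psi_l q l : flip f (row (edge_l l) (psi q)) = root (row (hp_coord l) q).
Proof. by rewrite rowK (unsplitK (inl l)) flipK. Qed.

Lemma psi_t q j : row (edge_t j) (psi q) = neck j q *: qone R.
Proof. by rewrite rowK (unsplitK (inr j)). Qed.

Lemma flip_real (r : R) : flip f (r *: qone R) = r *: qone R.
Proof. by case: f; rewrite //= qconjZ qconj1. Qed.

Lemma quartic_psi_l q l : quartic (psi q) (edge_l l) = 4 * sqnorm (row (hp_coord l) q).
Proof.
rewrite /quartic -(sqnorm_flip f) psi_l sqnorm_root exprMn qabs_sqr.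
by congr (_ * _); ring.
Qed.

Lemma neck4 q j : core q -> neck j q ^+ 4 = 4 * (c j - sqnorm (row (centre j) q)).
Proof.
move=> [_ qc]; rewrite /neck (exprM _ 2 2) !sqr_sqrtr ?sqrtr_ge0 //.
by rewrite mulr_ge0 // subr_ge0 qc.
Qed.

Lemma psi_level q : core q -> Z (psi q).
Proof.
move=> qK; have [q1 qc] := qK; apply/(level_setP _ wE); split=> [|j].
  under eq_bigr do rewrite quartic_psi_l.
  by rewrite -mulr_sumr (sum_hp_coord (fun i => sqnorm (row i q))) -sqnorm_row q1 mulr1.
rewrite quartic_psi_l /quartic psi_t sqnormZ sqnorm1 mulr1 -exprM neck4 //.
by rewrite -/(c j) /centre; ring.
Qed.

Lemma continuous_psi : continuous psi.
Proof.
move=> q; apply: continuous_mx => {q} a i q.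
case aE : (fintype.split a) => [l|j].
  have -> : (fun q => psi q a i) = (fun p : H => flip f p 0 i) \o (@root R) \o (row (hp_coord l)).
    by apply/funext => q' /=; rewrite mxE aE.
  apply: continuous_comp.
    apply: (smooth_continuous (f := fun q : E => row (hp_coord l) q)).
    by apply: (smooth_on_row openT); exact: (smooth_on_id openT).
  apply: continuous_comp; first exact: continuous_root.
  apply: (smooth_continuous (f := fun p : H => flip f p 0 i)).
  have /(smooth_on_rV4 openT) : smooth_on setT (fun p : H => flip f p).
    by apply: (smooth_flip _ openT); exact: (smooth_on_id openT).
  exact.
have -> : (fun q => psi q a i) =
    (fun t : R => t * qone R 0 i) \o Num.sqrt \o Num.sqrt \o
    (fun q : E => 4 * (c j - sqnorm (row (centre j) q))).
  by apply/funext => q' /=; rewrite mxE aE mxE.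
apply: continuous_comp.
  apply: (smooth_continuous (f := fun q : E => 4 * (c j - sqnorm (row (centre j) q)))).
  apply: (smooth_on_mul openT); first exact: (smooth_on_cst _ openT).
  apply: (smooth_on_sub openT); first exact: (smooth_on_cst _ openT).
  apply: (smooth_on_sqnorm openT); apply: (smooth_on_row openT).
  exact: (smooth_on_id openT).
apply: continuous_comp; first exact: sqrt_continuous.
apply: continuous_comp; first exact: sqrt_continuous.
exact: mulrr_continuous.
Qed.

Definition node_value (X Y : H) (W : 'I_k -> H) (n : node) : H :=
  if n == x then X else if n == y then Y else
  if [pick j | z j == n] is Some j then W j else qone R.

Lemma node_value_x X Y W : node_value X Y W x = X.
Proof. by rewrite /node_value eqxx. Qed.

Lemma node_value_y X Y W : node_value X Y W y = Y.
Proof. by rewrite /node_value eqxx eq_sym (negPf xy). Qed.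

Lemma node_value_z X Y W j : node_value X Y W (z j) = W j.
Proof.
rewrite /node_value; have [/negPf -> /negPf ->] := zxy j.
by case: pickP => [i /eqP/zI ->//|/(_ j)]; rewrite eqxx.
Qed.

Lemma node_value_exists X Y W : sqnorm X = 1 -> sqnorm Y = 1 ->
  (forall j, sqnorm (W j) = 1) -> (y = None -> Y = qone R) ->
  (forall j, z j = None -> W j = qone R) ->
  exists2 h, @Sp1 R k.+1 h &
    [/\ at_node h x = X, at_node h y = Y & forall j, at_node h (z j) = W j].
Proof.
move=> X1 Y1 W1 yY zW.
have nv1 n : sqnorm (node_value X Y W n) = 1.
  rewrite /node_value; case: ifP => _ //; case: ifP => _ //.
  by case: pickP => [j _|_]; rewrite ?W1 ?sqnorm1.
have nvN : node_value X Y W None = qone R.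
  rewrite /node_value eq_sym (negPf xN); case: ifP => [/eqP yE|_]; first exact: yY.
  by case: pickP => [j /eqP/zW|].
exists (\matrix_i node_value X Y W (Some i)) => [i|]; first by rewrite rowK.
have nE n : at_node (\matrix_i node_value X Y W (Some i)) n = node_value X Y W n.
  by case: n => [i|]; rewrite /= ?rowK ?nvN.
split=> [||j]; rewrite nE ?node_value_x ?node_value_y ?node_value_z //.
Qed.

(* W j is the value of the group element at the vertex z j; X and Y determine it
   unless the coordinate edge_t j vanishes. *)
Definition neck_action X Y (W : 'I_k -> H) (q q' : E) : Prop :=
  [/\ [/\ sqnorm X = 1, sqnorm Y = 1, forall j, sqnorm (W j) = 1,
          y = None -> Y = qone R & forall j, z j = None -> W j = qone R],
      forall l, (forall j, idx j != l) ->
        row (hp_coord l) q' = qmul (qmul X (row (hp_coord l) q)) (qconj Y),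
      forall j, row (centre j) q' =
        qmul (qmul (if b j then W j else X) (row (centre j) q))
             (qconj (if b j then Y else W j)) &
      forall j, neck j q != 0 -> W j = if b j then X else Y].

(** [root] commutes with multiplication by unit quaternions on both sides, so the group equations
    for [psi q] descend to [q]. The equation of the edge t_j, between nonnegative reals, says that
    [h] agrees at its two ends unless t_j = 0. *)
Lemma psi_orbitP q q' : orb (psi q) = orb (psi q') <->
  exists X Y W, neck_action X Y W q q'.
Proof.
split=> [/ext_orbitP[h h1 hE]|[X [Y [W [[X1 Y1 W1 yY zW] uq cq nW]]]]].
  have rowE a : flip f (row a (psi q')) = qmul (qmul (at_node h (osrc e f a))
      (flip f (row a (psi q)))) (qconj (at_node h (otgt e f a))).
    by rewrite hE flip_row_act.
  have n1 n := at_node_Sp1 n h1.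
  exists (at_node h x), (at_node h y), (fun j => at_node h (z j)); split=> //.
  - by split=> [//|//|//|yE|j zE]; rewrite ?yE ?zE.
  - move=> l un; apply: root_inj; rewrite root_mul // -!psi_l rowE.
    by have [-> ->] := uncE un.
  - move=> j; apply: root_inj; rewrite root_mul -?psi_l ?rowE; do ?by case: ifP.
    by have := cutE j; rewrite /oriented_edges; case: (b j) => -[-> -> _ _].
  move=> j n0; have := rowE (edge_t j); rewrite !psi_t !flip_real qmulr_real qmulZl.
  move=> tE; have nn : neck j q' = neck j q.
    have := congr1 (@qabs R 1 4) tE; rewrite qabs_real ?sqrtr_ge0 // qabsZ ?sqrtr_ge0 //.
    by rewrite qabsM qabs_conj !qabs_unit // !mulr1.
  move: tE; rewrite nn => /(scalerI n0) tE.
  have {tE} : at_node h (osrc e f (edge_t j)) = at_node h (otgt e f (edge_t j)).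
    by rewrite -[RHS]qmul1q tE mulV_unitK.
  by have := cutE j; rewrite /oriented_edges; case: (b j) => -[_ _ -> ->].
have [h h1 [hx hy hz]] := node_value_exists X1 Y1 W1 yY zW.
apply/ext_orbitP; exists h => //; apply/row_matrixP => a.
apply: (can_inj (flipK f)); rewrite flip_row_act.
have nn j : neck j q' = neck j q.
  by rewrite /neck cq !sqnormM sqnorm_conj; case: (b j); rewrite ?W1 ?X1 ?Y1 mul1r mulr1.
case: (split_ordP a) => [l ->|j ->].
  rewrite -/(edge_l l) !psi_l.
  have [/forallP un|] := boolP [forall j, idx j != l].
    by rewrite uq // root_mul //; have [-> ->] := uncE un; rewrite hx hy.
  rewrite negb_forall => /existsP[j]; rewrite negbK => /eqP <-.
  rewrite -/(centre j) cq root_mul; do ?by case: ifP.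
  by have := cutE j; rewrite /oriented_edges; case: (b j) => -[-> -> _ _]; rewrite ?hx ?hy hz.
rewrite -/(edge_t j) !psi_t !flip_real qmulr_real qmulZl nn.
have [->|n0] := eqVneq (neck j q) 0; first by rewrite !scale0r.
have := cutE j; rewrite /oriented_edges; have := nW j n0.
by case: (b j) => WE -[_ _ -> ->]; rewrite ?hx ?hy hz WE unit_mulV.
Qed.

Definition delta j := 1 - c j.

Lemma delta01 j : 0 < delta j < 1.
Proof. by have /andP[? ?] := c01 j; rewrite /delta; apply/andP; split; lra. Qed.

Lemma centre_inj : injective centre.
Proof. by move=> i j /hp_coord_inj/idxI. Qed.

(** Two different coordinates would already exceed the total norm 1, as c_i + c_j > 1. *)
Lemma one_neck i j (q : E) : sphere q -> c i <= sqnorm (row (centre i) q) ->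
  c j <= sqnorm (row (centre j) q) -> i = j.
Proof.
move=> q1 ci cj; apply/eqP; apply/negPn/negP => ij.
have : sqnorm q = 1 by [].
rewrite sqnorm_row (bigD1 (centre i)) //= (bigD1 (centre j)) /=; last first.
  by rewrite (inj_eq centre_inj) eq_sym.
have : 0 <= \sum_(l | (l != centre i) && (l != centre j)) sqnorm (row l q).
  by apply: sumr_ge0 => l _; exact: sqnorm_ge0.
have := cc1 ij; lra.
Qed.

Lemma neck_eq0 q j : core q -> (neck j q == 0) = (sqnorm (row (centre j) q) == c j).
Proof.
move=> qK; rewrite -[LHS](expf_eq0 _ 4) neck4 // mulf_eq0 pnatr_eq0 /= subr_eq0.
by rewrite eq_sym.
Qed.

Let coord j := affine_coord (centre j) (delta j) (z j == None).

(* The Hopf fibre through a boundary point of the ball around the centre j; the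
   conjugation in the chart j is there because the vertex z j may carry the
   trivial group. *)
Lemma hopf_neck j q q' : core q -> core q' ->
  sqnorm (row (centre j) q) = c j -> sqnorm (row (centre j) q') = c j ->
  scalar_orbit (coord j q) (coord j q') <-> exists X Y W, neck_action X Y W q q'.
Proof.
move=> qK q'K qj q'j; have [q1 _] := qK; have [q'1 _] := q'K.
have /andP[c0 _] := c01 j; have /andP[de0 _] := delta01 j.
have row0 : row (centre j) q != 0 by rewrite -sqnorm_gt0 qj.
have row0' : row (centre j) q' != 0 by rewrite -sqnorm_gt0 q'j.
have neckj i : neck i q != 0 -> i != j.
  by apply: contra => /eqP ->; rewrite neck_eq0 // qj.
have neck_other i : i != j -> neck i q != 0.
  apply: contra; rewrite neck_eq0 // => /eqP qi; apply/eqP.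
  by apply: (one_neck q1); rewrite ?qi ?qj.
pose D := qdir (row (centre j) q); pose D' := qdir (row (centre j) q').
have D1 : sqnorm D = 1 by rewrite sqnorm_dir.
have D'1 : sqnorm D' = 1 by rewrite sqnorm_dir.
have aa : qabs (row (centre j) q') = qabs (row (centre j) q) by rewrite /qabs qj q'j.
have qE : row (centre j) q = qabs (row (centre j) q) *: D by exact: qabs_dir.
have q'E : row (centre j) q' = qabs (row (centre j) q) *: D' by rewrite -aa; exact: qabs_dir.
have s0 : (delta j `^ (2^-1))^-1 != 0 by rewrite invr_eq0 gt_eqF // powR_gt0.
have coordP : scalar_orbit (coord j q) (coord j q') <-> exists2 h, sqnorm h = 1 &
    forall i, i != centre j -> flip (z j == None) (qmul (qconj D') (row i q')) =
      qmul h (flip (z j == None) (qmul (qconj D) (row i q))).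
  split=> [[h h1 hE]|[h h1 hE]]; exists h => //.
    move=> i ij; have [r ->|ii] := unliftP (centre j) i; last by rewrite ii eqxx in ij.
    have := congr1 (row r) hE; rewrite row_lscale !rowK qmulZr.
    by move=> /(scalerI s0).
  by apply/row_matrixP => r; rewrite row_lscale !rowK qmulZr -hE // eq_sym neq_lift.
rewrite coordP; split=> [[h h1 hE]|[X [Y [W [[X1 Y1 W1 yY zW] uq cq nW]]]]].
  (* Only the neck [j] vanishes, so [X] and [Y] determine every other W_i; the value [U] at z_j is
     free unless z_j is the trivial vertex. *)
  have allW (X Y U : H) : sqnorm X = 1 -> sqnorm Y = 1 -> sqnorm U = 1 ->
      (y = None -> Y = qone R) -> (z j = None -> U = qone R) ->
      (forall i, i != j -> z i = None -> ~~ b i -> Y = qone R) ->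
      (forall i, i != centre j -> row i q' = qmul (qmul X (row i q)) (qconj Y)) ->
      row (centre j) q' = qmul (qmul (if b j then U else X) (row (centre j) q))
             (qconj (if b j then Y else U)) ->
      exists X Y W, neck_action X Y W q q'.
    move=> X1 Y1 U1 yY zU zY others own.
    exists X, Y, (fun i => if i == j then U else if b i then X else Y).
    split=> [|l un|i|i /neckj/negPf ->//].
    - split=> // i; first by case: ifP => // _; case: ifP.
      case: (eqVneq i j) => [->|ij zi]; first exact: zU.
      case: yN => [yE|[i' zi' bi']]; first by have [_] := zxy i; rewrite zi yE eqxx.
      have <- : i' = i by apply: zI; rewrite zi zi'.
      by rewrite (negPf bi'); apply: (zY i) => //; rewrite (zI (etrans zi (esym zi'))).
    - apply: others; apply/eqP => /hp_coord_inj lE.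
      by have := un j; rewrite lE eqxx.
    case: (eqVneq i j) => [->//|ij]; rewrite others ?(inj_eq centre_inj) //.
    by case: (b i).
  (* If z_j carries a group factor, Y = 1 works: the value at z_j accounts for the change of
     direction of q_centre, and the other coordinates undergo a left multiplication. *)
  have [zj|zj] := eqVneq (z j) None; last first.
    rewrite (negPf zj) /= in hE.
    pose X := qmul D' (qmul h (qconj D)).
    have X1 : sqnorm X = 1 by rewrite !sqnormM sqnorm_conj h1 D1 D'1 !mulr1.
    have others i : i != centre j -> row i q' = qmul (qmul X (row i q)) (qconj (qone R)).
      move=> ij; rewrite qconj1 qmulq1 /X -!qmulA -hE //.
      by rewrite unit_mulVK.
    clearbody X; case bj: (b j).
      apply: (allW X (qone R) (qmul D' (qconj D))) => //; rewrite ?sqnorm1 //.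
      - by rewrite sqnormM sqnorm_conj D1 D'1 mulr1.
      - by move=> zE; rewrite zE eqxx in zj.
      - by rewrite bj qconj1 qmulq1 q'E {2}qE qmulZr mulV_unitK.
    apply: (allW X (qone R) (qmul (qconj D') (qmul X D))) => //; rewrite ?sqnorm1 //.
    - by rewrite !sqnormM sqnorm_conj X1 D1 D'1 !mulr1.
    - by move=> zE; rewrite zE eqxx in zj.
    rewrite bj q'E {2}qE qmulZr qmulZl [qconj (qmul (qconj D') _)]qconjM qconjK.
    by rewrite unit_mulVK // sqnormM X1 D1 mulr1.
  (* If z_j is the trivial vertex, [X] is forced by q_centre and the free element is [Y], acting
     from the right; the conjugated chart turns this into left multiplication by [h]. *)
  have bj : ~~ b j.
    case: yN => [yE|[i zi bi]]; last by rewrite (zI (etrans zj (esym zi))).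
    by have [_] := zxy j; rewrite zj yE eqxx.
  rewrite zj eqxx /= in hE.
  pose X := qmul D' (qconj D).
  have X1 : sqnorm X = 1 by rewrite sqnormM sqnorm_conj D1 D'1 mulr1.
  apply: (allW X h (qone R)) => //; rewrite ?sqnorm1 //.
  - by move=> yE; have [_] := zxy j; rewrite zj yE eqxx.
  - by move=> i ij zi; rewrite (zI (etrans zi (esym zj))) eqxx in ij.
  - move=> i ij; have := congr1 (@qconj R) (hE i ij).
    rewrite qconjK qconjM qconjK => pE.
    by rewrite /X -(qmulA D' (qconj D)) -(qmulA D' (qmul _ _)) -pE unit_mulVK.
  by rewrite (negPf bj) qconj1 qmulq1 q'E {2}qE qmulZr mulV_unitK.
have othersW i : i != j -> W i = if b i then X else Y.
  by move=> /neck_other; exact: nW.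
have others i : i != centre j -> row i q' = qmul (qmul X (row i q)) (qconj Y).
  have [l <-] := hp_coord_surj i => lj.
  have [/forallP un|] := boolP [forall j, idx j != l]; first exact: uq.
  rewrite negb_forall => /existsP[i']; rewrite negbK => /eqP il.
  rewrite -il in lj *; rewrite -/(centre i') cq othersW; first by case: (b i').
  by apply: contra lj => /eqP ->.
have [zj|zj] := eqVneq (z j) None; last first.
  have YE : Y = qone R.
    case: yN => [/yY//|[i zi bi]].
    have ij : i != j by apply: contra zj => /eqP <-; rewrite zi.
    by have := othersW i ij; rewrite (negPf bi) => <-; exact: zW.
  exists (qmul (qconj D') (qmul X D)).
    by rewrite !sqnormM sqnorm_conj X1 D1 D'1 !mulr1.
  move=> i ij /=; rewrite others // YE qconj1 qmulq1 -!qmulA.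
  by rewrite unit_mulVK.
have bj : ~~ b j.
  case: yN => [yE|[i zi bi]]; last by rewrite (zI (etrans zj (esym zi))).
  by have [_] := zxy j; rewrite zj yE eqxx.
have WE := zW j zj; have := cq j; rewrite (negPf bj) WE qconj1 qmulq1 qE q'E.
rewrite qmulZr => /(scalerI (_ : _ != 0)) XE.
have {XE}D'E : D' = qmul X D by apply: XE; rewrite gt_eqF // qabs_gt0.
exists Y => // i ij /=; rewrite others // D'E !qconjM !qconjK -!qmulA.
by congr qmul; congr qmul; rewrite unit_VmulK.
Qed.

Section Collapsing.
Variables (z0 : Z) (ch : 'I_k -> chart (HP R m) 'M[R]_(m, 4)).
Notation proj := (@orbit_proj _ sphere (@scalar_orbit R m.+1)).
Hypothesis chP : forall j, [/\ HP_charts (ch j), cimg (ch j) = affine_range (delta j),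
  forall s : sphere, cdom (ch j) (proj s) <-> affine_domain (centre j) (set_val s) &
  forall s : sphere, affine_domain (centre j) (set_val s) ->
    cfwd (ch j) (proj s) = coord j (set_val s)].

Lemma sqnorm_cfwd j (s : sphere) : cdom (ch j) (proj s) ->
  delta j * sqnorm (cfwd (ch j) (proj s)) = 1 - sqnorm (row (centre j) (set_val s)).
Proof.
have [_ _ cd cf] := chP j; move=> /cd sd; rewrite cf // sqnorm_affine //.
  by have /andP[] := delta01 j.
exact: (set_val_in s).
Qed.

Lemma coord_ballP j (s : sphere) :
  coord_ball ch j (proj s) <-> c j < sqnorm (row (centre j) (set_val s)).
Proof.
have [_ _ cd _] := chP j; have /andP[de0 _] := delta01 j; have /andP[c0 _] := c01 j.
split=> [[sd s1]|cs].
  have := sqnorm_cfwd sd; move: s1; rewrite -(ltr_pM2l de0) mulr1 /delta; lra.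
have sd : cdom (ch j) (proj s).
  by apply/cd; rewrite /affine_domain /= -sqnorm_gt0; apply: lt_trans cs.
split=> //; rewrite -(ltr_pM2l de0) sqnorm_cfwd // mulr1 /delta; lra.
Qed.

Lemma coord_cballP j (s : sphere) :
  coord_cball ch j (proj s) <-> c j <= sqnorm (row (centre j) (set_val s)).
Proof.
have [_ _ cd _] := chP j; have /andP[de0 _] := delta01 j; have /andP[c0 _] := c01 j.
split=> [[sd s1]|cs].
  have := sqnorm_cfwd sd; move: s1; rewrite -(ler_pM2l de0) mulr1 /delta; lra.
have sd : cdom (ch j) (proj s).
  by apply/cd; rewrite /affine_domain /= -sqnorm_gt0; apply: lt_le_trans cs.
split=> //; rewrite -(ler_pM2l de0) sqnorm_cfwd // mulr1 /delta; lra.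
Qed.

Lemma coord_sphereP j (s : sphere) :
  coord_sphere ch j (proj s) <-> sqnorm (row (centre j) (set_val s)) = c j.
Proof.
split=> [[sd s1]|sc].
  by have := sqnorm_cfwd sd; rewrite s1 /delta; lra.
have [sd s1] : coord_cball ch j (proj s) by apply/coord_cballP; rewrite sc.
split=> //; apply/eqP; rewrite eq_le s1 /= leNgt; apply/negP => lt1.
by have : coord_ball ch j (proj s) by []; move/coord_ballP; rewrite sc ltxx.
Qed.

Notation complement := (~` \bigcup_j coord_ball ch j).
Notation fibre := (hopf_fibre ch).

Lemma complementP (s : sphere) : complement (proj s) <-> core (set_val s).
Proof.
split=> [cs|[_ qc] [j _ /coord_ballP]]; last by rewrite ltNge qc.
split=> [|j]; first exact: (set_val_in s).
by rewrite leNgt; apply/negP => lt; apply: cs; exists j => //; exact/coord_ballP.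
Qed.

Lemma cball_disjoint i j : i != j -> coord_cball ch i `&` coord_cball ch j = set0.
Proof.
move=> ij; apply/seteqP; split=> // p [ci cj].
have [s sp] := orbit_proj_surj p; rewrite -sp in ci cj.
move/coord_cballP: ci; move/coord_cballP: cj => cj ci.
by move/eqP: ij; apply; exact: one_neck (set_val_in s) ci cj.
Qed.

(** If all necks are nonzero the action equations force Y = 1 and reduce to the left scalar action,
    that is, to equality in HP^m; if the neck [j] vanishes, both points lie on the sphere [j] and
    [hopf_neck] applies. *)
Lemma fibreP (s s' : sphere) : core (set_val s) -> core (set_val s') ->
  fibre (proj s) (proj s') <-> orb (psi (set_val s)) = orb (psi (set_val s')).
Proof.
set q := set_val s; set q' := set_val s' => qK q'K.
have cfE j (t : sphere) : coord_sphere ch j (proj t) -> cfwd (ch j) (proj t) = coord j (set_val t).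
  by have [_ _ cd cf] := chP j => -[/cd sd _]; exact: cf.
rewrite psi_orbitP; split=> [[/orbit_projP/scalar_orbitP[X X1 qE]|[j [sj s'j]]]|].
- rewrite -/q -/q' in qE; have {}qE : q = lscale X q' by [].
  pose U := qconj X.
  have U1 : sqnorm U = 1 by rewrite sqnorm_conj.
  have rE i : row i q' = qmul U (row i q) by rewrite qE row_lscale unit_VmulK.
  exists U, (qone R), (fun j => if b j then U else qone R); split=> //.
  + split=> // [|j|j zj]; first exact: sqnorm1.
      by case: (b j); rewrite ?sqnorm1.
    case: yN => [yE|[i zi bi]]; first by have [_] := zxy j; rewrite zj yE eqxx.
    by rewrite (zI (etrans zj (esym zi))) (negPf bi).
  + by move=> l _; rewrite rE qconj1 qmulq1.
  + by move=> j; rewrite rE; case: (b j); rewrite qconj1 qmulq1.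
- rewrite (cfE _ _ sj) (cfE _ _ s'j) => sc.
  exact: ((hopf_neck qK q'K ((coord_sphereP _ _).1 sj) ((coord_sphereP _ _).1 s'j)).1 sc).
move=> naction.
have [/existsP[j /eqP nj]|] := boolP [exists j, neck j q == 0].
  have qj : sqnorm (row (centre j) q) = c j by apply/eqP; rewrite -neck_eq0 // nj.
  have q'j : sqnorm (row (centre j) q') = c j.
    have [X [Y [W [[X1 Y1 W1 _ _] _ cq _]]]] := naction.
    rewrite cq !sqnormM sqnorm_conj qj; case: (b j);
      by rewrite ?X1 ?Y1 W1 mul1r mulr1.
  have [sj s'j] := conj ((coord_sphereP j s).2 qj) ((coord_sphereP j s').2 q'j).
  right; exists j; first by split.
  rewrite !cfE //.
  exact/(hopf_neck qK q'K qj q'j).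
rewrite negb_exists => /forallP n0; left; apply/orbit_projP/esym/scalar_orbitP.
have [X [Y [W [[X1 Y1 W1 yY zW] uq cq nW]]]] := naction.
have WE j := nW j (n0 j).
have YE : Y = qone R.
  by case: yN => [/yY//|[j zj bj]]; have := WE j; rewrite (negPf bj) => <-; exact: zW.
exists X => //; apply/row_matrixP => i; rewrite row_lscale -/q -/q'.
have [l <-] := hp_coord_surj i.
have [/forallP un|] := boolP [forall j, idx j != l].
  by rewrite uq // YE qconj1 qmulq1.
rewrite negb_forall => /existsP[j]; rewrite negbK => /eqP <-.
by rewrite -/(centre j) cq WE YE; case: (b j); rewrite qconj1 qmulq1.
Qed.

Lemma fibre_complement p p' : complement p -> fibre p p' -> complement p'.
Proof.
move=> cp [->//|[j [_ [p'd p'1]] _]] [i _ [p'i p'i1]].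
have [ij|/cball_disjoint E] := eqVneq i j.
  by move: p'i1; rewrite ij p'1 ltxx.
by rewrite -[False]/(set0 p') -E; split; split=> //; rewrite ?p'1 // ltW.
Qed.

Lemma fibre_eq p p' : complement p -> complement p' -> fibre p p' -> fibre p = fibre p'.
Proof.
have [s <-] := orbit_proj_surj p; have [s' <-] := orbit_proj_surj p'.
move=> cs cs' ss'; have qK := (complementP s).1 cs; have q'K := (complementP s').1 cs'.
have oE := (fibreP qK q'K).1 ss'.
apply/seteqP; split=> p'' ff.
  have := fibre_complement cs ff.
  have [t tE] := orbit_proj_surj p''; rewrite -tE in ff * => ct.
  have tK := (complementP t).1 ct; apply/(fibreP q'K tK).
  by rewrite -oE; exact/(fibreP qK tK).
have := fibre_complement cs' ff.
have [t tE] := orbit_proj_surj p''; rewrite -tE in ff * => ct.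
have tK := (complementP t).1 ct; apply/(fibreP qK tK).
by rewrite oE; exact/(fibreP q'K tK).
Qed.

Lemma psi_surj (p : V) : Z p -> exists2 q, core q & orb (psi q) = orb p.
Proof.
move=> Zp; pose t j := flip f (row (edge_t j) p).
pose u j : H := if t j == 0 then qone R else qdir (t j).
have u1 j : sqnorm (u j) = 1.
  by rewrite /u; case: eqVneq => [_|t0]; rewrite ?sqnorm1 // sqnorm_dir.
have tE j : t j = qabs (t j) *: u j.
  rewrite /u; case: eqVneq => [->|t0]; last exact: qabs_dir.
  by rewrite qabs_sqrt (eqP (_ : sqnorm _ == 0)) ?sqnorm_eq0 // sqrtr0 scale0r.
pose val n := node_value (qone R) (qone R) (fun j => if b j then qconj (u j) else u j) n.
have val1 n : sqnorm (val n) = 1.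
  rewrite /val /node_value; do 2![case: ifP => _; first exact: sqnorm1].
  by case: pickP => [j _|_]; [case: ifP; rewrite ?sqnorm_conj|rewrite sqnorm1].
(* [val] cancels the directions u_j of all t_j but need not be 1 at the trivial vertex. Multiplying
   all values on the left by the inverse of [val None] repairs this and keeps every t_j real, since
   real numbers are central. *)
pose h : 'M[R]_(k.+1, 4) := \matrix_i qmul (qconj (val None)) (val (Some i)).
have hE n : at_node h n = qmul (qconj (val None)) (val n).
  by case: n => [i|]; rewrite /= ?rowK // unit_Vmul.
have h1 : Sp1 h by move=> i; rewrite rowK sqnormM sqnorm_conj !val1 mulr1.
pose p' := ext_act e h p.
have Zp' : Z p' by exact: level_set_act.
have p't j : row (edge_t j) p' = qabs (row (edge_t j) p) *: qone R.
  apply: (can_inj (flipK f)); rewrite flip_real flip_row_act !hE -/(t j) tE.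
  have -> : qabs (row (edge_t j) p) = qabs (t j) by rewrite /qabs sqnorm_flip.
  have E : qmul (qmul (val (osrc e f (edge_t j))) (u j)) (qconj (val (otgt e f (edge_t j)))) = qone R.
    have := cutE j; rewrite /oriented_edges /val; case bj: (b j) => -[_ _ -> ->].
      by rewrite node_value_x node_value_z bj unit_Vmul // qconj1 qmulq1.
    by rewrite node_value_y node_value_z bj qmul1q unit_mulV.
  rewrite qmulZr qmulZl; congr (_ *: _).
  rewrite qconjM qconjK !qmulA -(qmulA (qconj (val None)) _ (u j)) -(qmulA _ (qmul _ (u j))).
  by rewrite E qmulq1 unit_Vmul.
pose q : E := \matrix_i unroot (flip f (row (edge_l (cast_ord (esym (addn1 m)) i)) p')).
have qE l : row (hp_coord l) q = unroot (flip f (row (edge_l l) p')).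
  by rewrite rowK /hp_coord cast_ordK.
have nE l : 4 * sqnorm (row (hp_coord l) q) = quartic p' (edge_l l).
  rewrite qE /unroot sqnormZ qabs_sqrt sqnorm_flip expr_div_n sqr_sqrtr ?sqnorm_ge0 //.
  by rewrite /quartic; field.
have [p4 pc] := (level_setP _ wE _).1 Zp'.
have q1 : sphere q.
  rewrite /unit_sphere /= sqnorm_row -(sum_hp_coord (fun i => sqnorm (row i q))).
  apply: (mulfI (_ : 4 != 0 :> R)); first by rewrite pnatr_eq0.
  by rewrite mulr_sumr; under eq_bigr do rewrite nE; rewrite p4 mulr1.
have qK : core q.
  split=> // j; rewrite -(ler_pM2l (_ : 0 < 4)) // nE -/(c j).
  by have := pc j; have := quartic_ge0 p' (edge_t j); rewrite -/(c j); lra.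
exists q => //; apply/esym/ext_orbitP; exists h => //; apply/row_matrixP => a.
case: (split_ordP a) => [l ->|j ->].
  apply: (can_inj (flipK f)); rewrite -/(edge_l l) psi_l qE unrootK //.
rewrite -/(edge_t j) psi_t p't; congr (_ *: _).
apply/eqP; rewrite -(@eqrXn2 _ 4) ?sqrtr_ge0 ?qabs_ge0 // neck4 //.
rewrite mulrBr nE -/(c j); have := pc j.
rewrite /quartic p't sqnormZ sqnorm1 mulr1 -exprM => <-.
by rewrite addrC addKr.
Qed.

(** Two representatives are chosen, of the collapsed point and then of the resulting quaternionic
    line; [from_collapseE] shows independence of both. *)
Definition from_collapse (p : collapse ch) : toric_manifold v lam e :=
  orbit_proj orb (insubd z0 (psi (set_val (repr (set_val (repr p)))))).

Lemma from_collapseE (r : (complement : set (HP R m))) (s : sphere) : set_val r = proj s ->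
  from_collapse (orbit_proj fibre r) = orbit_proj orb (insubd z0 (psi (set_val s))).
Proof.
move=> rE; have cy := set_val_in r; rewrite rE in cy.
have sK := (complementP s).1 cy.
rewrite /from_collapse; set r' := repr (orbit_proj fibre r); set s' := repr (set_val r').
have cy' := set_val_in r'; rewrite -(orbit_proj_repr (set_val r')) -/s' in cy'.
have s'K := (complementP s').1 cy'.
apply/orbit_projP; rewrite !set_val_insubd; [|exact: psi_level|exact: psi_level].
apply/(fibreP s'K sK); rewrite -rE /s' orbit_proj_repr.
have /orbit_projP -> : orbit_proj fibre r' = orbit_proj fibre r.
  by rewrite /r' orbit_proj_repr.
by left.
Qed.

Lemma from_collapse_continuous : continuous from_collapse.
Proof.
apply: orbit_space_continuous => r U.
rewrite /= (from_collapseE (esym (orbit_proj_repr (set_val r)))).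
set s := repr (set_val r) => nU.
have cy : complement (proj s) by rewrite orbit_proj_repr; exact: set_val_in.
have sK := (complementP s).1 cy.
have : nbhs (insubd z0 (psi (set_val s)) : set_type Z) (@orbit_proj _ Z orb @^-1` U).
  by apply: orbit_proj_continuous.
rewrite nbhsE => -[_ [[W oW <-] Ws] WU].
rewrite /preimage /= set_val_insubd in Ws; last exact: psi_level.
(* [psi] is continuous on the sphere and not defined on HP^m; openness of the projection carries the
   neighbourhood down. *)
have oO : open (proj @` (set_val @^-1` (psi @^-1` W))).
  apply: open_orbit_proj; first exact: sphere_act.
  by move/continuousP: continuous_psi; exact.
suff : nbhs r ((from_collapse \o orbit_proj fibre) @^-1` U) by [].
rewrite nbhsE; exists (set_val @^-1` (proj @` (set_val @^-1` (psi @^-1` W)))).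
  split; first exact: open_set_val.
  by exists s => //; rewrite /s orbit_proj_repr.
move=> r' [s' Ws' s'E] /=; rewrite (from_collapseE (esym s'E)); apply: WU => /=.
rewrite set_val_insubd //; apply: psi_level; apply/complementP.
by rewrite s'E; exact: set_val_in.
Qed.

Lemma open_coord_ball j : open (coord_ball ch j).
Proof.
have [[[od _ _ cf _] _ _] _ _ _] := chP j.
rewrite openE => p [pd p1]; apply: filterI; first by move: od; rewrite openE; exact.
have oB : open [set u : 'M[R]_(m, 4) | sqnorm u < 1].
  have : continuous (@sqnorm R m 4).
    by apply: smooth_continuous; apply: (smooth_on_sqnorm openT); exact: (smooth_on_id openT).
  by move/continuousP/(_ _ (@open_lt R 1)).
have nb : nbhs (cfwd (ch j) p) [set u : 'M[R]_(m, 4) | sqnorm u < 1].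
  by move: oB; rewrite openE; apply.
exact: (cf p pd _ nb).
Qed.

Lemma collapse_homeomorphic : homeomorphic (toric_manifold v lam e) (collapse ch).
Proof.
apply: (@compact_hausdorff_homeomorphic _ _ from_collapse).
- apply: orbit_space_compact; apply: (subclosed_compact _ (@HP_compact R m)) => //.
  apply: open_closedC; apply: bigcup_open => j _; exact: open_coord_ball.
- exact: (toric_hausdorff idxI wE c01 cc1 eT).
- exact: from_collapse_continuous.
- move=> x1 x2.
  have [y1 <-] := orbit_proj_surj x1; have [y2 <-] := orbit_proj_surj x2.
  have [s1 s1E] := orbit_proj_surj (set_val y1).
  have [s2 s2E] := orbit_proj_surj (set_val y2).
  rewrite (from_collapseE (esym s1E)) (from_collapseE (esym s2E)) => /orbit_projP.
  have c1 := set_val_in y1; have c2 := set_val_in y2; rewrite -s1E -s2E in c1 c2.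
  have K1 := (complementP s1).1 c1; have K2 := (complementP s2).1 c2.
  rewrite !set_val_insubd; [|exact: psi_level|exact: psi_level].
  move/(fibreP K1 K2)/(fibre_eq c1 c2); rewrite s1E s2E => fE.
  exact/orbit_projP.
move=> t; have [p <-] := orbit_proj_surj t.
have [q qK qE] := psi_surj (set_val_in p).
have [s sE] : exists s : sphere, set_val s = q.
  by exists (SigSub (mem_set qK.1)); rewrite set_valE.
have cs : complement (proj s) by apply/complementP; rewrite sE.
have [r rE] : exists r : (complement : set (HP R m)), set_val r = proj s.
  by exists (SigSub (mem_set cs)); rewrite set_valE.
exists (orbit_proj fibre r); rewrite (from_collapseE rE); apply/orbit_projP.
by rewrite set_val_insubd ?sE //; exact: psi_level.
Qed.

End Collapsing.

(** The coordinate points of HP^m; those at the [centre j] are the origins of the charts [ch j] and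
    the points blown up. *)
Definition axis_point (i : 'I_m.+1) : E := \matrix_l if l == i then qone R else 0.

Lemma axis_point_sphere i : sphere (axis_point i).
Proof.
rewrite /unit_sphere /= sqnorm_row (bigD1 i) //= rowK eqxx sqnorm1 big1 ?addr0 //.
by move=> l /negPf li; rewrite rowK li; apply/eqP; rewrite sqnorm_eq0.
Qed.

Lemma psi_blow_up (z0 : Z) : exists p : 'I_k -> HP R m,
  injective p /\ blow_up (@HP_charts R m) p (toric_manifold v lam e).
Proof.
have [s sE] : exists s : 'I_m.+1 -> sphere, forall i, set_val (s i) = axis_point i.
  exists (fun i => SigSub (mem_set (axis_point_sphere i))) => i.
  by rewrite set_valE.
have de0 j : 0 < delta j by have /andP[] := delta01 j.
have /choice[ch chP] j := affine_chart (centre j) (z j == None) (de0 j) (s ord0).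
exists (fun j => orbit_proj _ (s (centre j))); split.
  move=> i j /orbit_projP/scalar_orbitP[h h1]; rewrite !sE => /(congr1 (row (centre j))).
  rewrite row_lscale !rowK eqxx; case: eqP => [/centre_inj -> //|_].
  rewrite qmulq0 => /(congr1 (@sqnorm R 1 4)); rewrite sqnorm1.
  have -> : sqnorm (0 : H) = 0 by apply/eqP; rewrite sqnorm_eq0.
  by move/eqP; rewrite oner_eq0.
have sd j : affine_domain (centre j) (set_val (s (centre j))).
  by rewrite /affine_domain /= sE rowK eqxx -sqnorm_gt0 sqnorm1.
exists ch; split.
- by move=> j; have [] := chP j.
- move=> j; have [_ _ cd cf] := chP j; split; first exact/cd.
  rewrite cf //; apply/row_matrixP => r; rewrite rowK sE !rowK.
  rewrite [lift _ _ == _]eq_sym (negPf (neq_lift _ _)) qmulq0 row0.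
  rewrite (_ : flip _ 0 = 0) ?scaler0 //.
  by rewrite -(scale0r (0 : H)) flipZ !scale0r.
- move=> j; have [_ -> _ _] := chP j => y' /= y1; have /andP[_ d1] := delta01 j.
  rewrite /affine_range /= subr_gt0; apply: le_lt_trans d1.
  by rewrite ler_piMr // ltW.
- by move=> i j; exact: cball_disjoint.
- exact: collapse_homeomorphic.
Qed.

End Psi.

Lemma toric_blow_up (z0 : Z) : (0 < k -> 1 < m)%N ->
  exists p : 'I_k -> HP R m,
    injective p /\ blow_up (@HP_charts R m) p (toric_manifold v lam e).
Proof.
move=> km.
have [f [x [y [z [b [[xN yN xy] zI zxy uncE cutE]]]]]] := oriented_shape idxI wE eT km.
exact: (psi_blow_up xN yN xy zI zxy uncE cutE).
Qed.

End ToricBlowUp.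

(** * The volume form over a segment *)

Section Determinants.
Variable R : realType.

(** The matrix determinant lemma: the bordered matrix [M] is factored once with its upper left block
    as pivot and once with the lower right one. *)
Lemma det_rank1_update n (phi a : R) (u : 'rV[R]_n) : phi != 0 ->
  \det (phi%:M + a *: (u^T *m u)) =
  phi ^+ n * (1 + a / phi * (u *m u^T) 0 0).
Proof.
move=> phi0.
pose M : 'M[R]_(1 + n) := block_mx 1%:M (- a *: u) u^T phi%:M.
transitivity (\det M).
  have -> : M = block_mx 1%:M 0 u^T 1%:M *m
      block_mx 1%:M (- a *: u) 0 (phi%:M + a *: (u^T *m u)).
    rewrite mulmx_block !mul1mx !mul0mx !mulmx1 !addr0; congr block_mx.
    by rewrite -scalemxAr scaleNr addrC addrK.
  by rewrite det_mulmx det_lblock det_ublock !det1 !mul1r.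
have -> : M = block_mx 1%:M (- (a / phi) *: u) 0 1%:M *m
    block_mx (1%:M + (a / phi) *: (u *m u^T)) 0 u^T phi%:M.
  rewrite mulmx_block !mul1mx !mul0mx !add0r; congr block_mx.
    by rewrite -scalemxAl scaleNr addrK.
  by rewrite mul_mx_scalar scalerA mulrN mulrC divfK.
rewrite det_mulmx det_ublock det_lblock !det1 !mul1r det_scalar mulrC.
by rewrite [X in \det X]mx11_scalar det_scalar1 !mxE eqxx.
Qed.

Lemma complete_basis n (u : 'rV[R]_n.+1) : u != 0 ->
  exists2 B : 'M[R]_n.+1, B \in unitmx & row 0 B = u.
Proof.
move=> u0; pose e0 : 'rV[R]_n.+1 := delta_mx 0 0.
have e0f : e0 *m (\matrix_i u) = u by rewrite -rowE rowK.
have [|B uB e0B] := @complete_unitmx R 1 n.+1 e0 (\matrix_i u).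
  by rewrite e0f !rank_rV u0 /e0; congr nat_of_bool; apply/esym/eqP => /rowP/(_ 0)/eqP;
    rewrite !mxE !eqxx oner_eq0.
by exists B => //; rewrite rowE -/e0 -e0B.
Qed.

End Determinants.

Section VolumeForm.
Variables (R : realType) (X : topologicalType).
Notation F := 'rV[R]_4.
Variable A : set (chart X F).
Hypothesis manA : smooth_manifold A.
Variables c0 c1 : chart X F.
Hypothesis Ac0 : A c0.
Hypothesis Ac1 : A c1.
Hypothesis cover : forall x, cdom c0 x \/ cdom c1 x.
Hypothesis jacobian1 : forall u (v : 'I_4 -> F), overlap c0 c1 u ->
  \det (\matrix_(i, j) ('D_(v j) (transition c0 c1) u) 0 i) =
  \det (\matrix_(i, j) v j 0 i).

Definition chart_coord (c : chart X F) (i : 'I_4) (x : X) : R := cfwd c x 0 i.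

(** Where both charts are defined the choice is immaterial by the Jacobian hypothesis, so near each
    point the form is a single wedge of coordinate differentials. *)
Definition volume_form : form_field R X F 4 := fun c y v =>
  dwedge (fun i => chart_coord (if `[< cdom c0 (cbwd c y) >] then c0 else c1) i \o cbwd c) y v.

Lemma smooth_chart_coord c i : A c -> smooth_fun A (cdom c) (chart_coord c i).
Proof.
move=> Ac c' Ac'; have [_ _ tA _ sA] := manA.
have tc := tA _ Ac; have tc' := tA _ Ac'.
have := sA _ _ Ac' Ac => /(smooth_on_mx _ (open_overlap tc' tc))/(_ 0 i).
apply: smooth_on_subset => y [yc cy]; exists (cbwd c' y); last by have [] := cbwdK tc' yc.
by have [] := cbwdK tc' yc.
Qed.

Lemma dwedge_coord c ch y v : A c -> A ch -> cimg c y -> cdom ch (cbwd c y) ->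
  dwedge (fun i => chart_coord ch i \o cbwd c) y v =
  \det (\matrix_(i, j) ('D_(v j) (transition c ch) y) 0 i).
Proof.
move=> Ac Ach yc chy; have [_ _ tA _ sA] := manA.
have yo : overlap c ch y.
  by have [d E] := cbwdK (tA _ Ac) yc; exists (cbwd c y).
rewrite /dwedge; congr (\det _); apply/matrixP => i j; rewrite !mxE.
rewrite (derive_mx (smooth_on_derivable (sA _ _ Ac Ach) yo)) mxE.
by congr ('D_ _ _ _).
Qed.

Lemma dwedge_coord_agree c y v : A c -> cimg c y ->
  cdom c0 (cbwd c y) -> cdom c1 (cbwd c y) ->
  dwedge (fun i => chart_coord c1 i \o cbwd c) y v =
  dwedge (fun i => chart_coord c0 i \o cbwd c) y v.
Proof.
move=> Ac yc y0 y1; have [_ _ tA _ sA] := manA.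
have tc := tA _ Ac; have tc0 := tA _ Ac0; have tc1 := tA _ Ac1.
have [d E] := cbwdK tc yc.
have yo : overlap c c0 y by exists (cbwd c y).
have uo : overlap c0 c1 (transition c c0 y) by exists (cbwd c y).
rewrite (dwedge_coord _ Ac Ac0) // -(jacobian1 _ uo) /dwedge.
congr (\det _); apply/matrixP => i j; rewrite !mxE.
rewrite (smooth_fun_transition manA (v j) _ (smooth_chart_coord i Ac1) Ac Ac0) //; last by case: tc1.
rewrite (derive_mx (smooth_on_derivable (sA _ _ Ac0 Ac1) uo)) mxE.
by congr ('D_ _ _ _).
Qed.

Lemma volume_form_exact : locally_exact A volume_form.
Proof.
have [_ _ tA _ sA] := manA.
have [t0 t1] : top_chart c0 /\ top_chart c1 by split; exact: tA.
move=> x; have [x0|x1] := cover x.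
  exists (cdom c0), unit, [:: tt], (fun=> 1), (fun=> chart_coord c0).
  split=> //; first by case: t0.
    by move=> _ l; exact: smooth_chart_coord.
  move=> c y v Ac yc /= y0; rewrite big_seq1 mul1r /volume_form.
  by rewrite (_ : `[< _ >] = true) //; exact/asboolP.
exists (cdom c1), unit, [:: tt], (fun=> 1), (fun=> chart_coord c1).
split=> //; first by case: t1.
  by move=> _ l; exact: smooth_chart_coord.
move=> c y v Ac yc /= y1; rewrite big_seq1 mul1r /volume_form.
by case: asboolP => // y0; rewrite dwedge_coord_agree.
Qed.

Lemma volume_form_plectic : plectic_form A volume_form.
Proof.
have [_ _ tA _ sA] := manA.
have [dform closed] := locally_exact_closed manA volume_form_exact.
split=> // c y u Ac yc H; apply/eqP; rewrite -[_ == _]negbK; apply/negP => u0.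
have [d E] := cbwdK (tA _ Ac) yc.
have [ch [Ach chy WE]] : exists ch, [/\ A ch, cdom ch (cbwd c y) &
    forall v, volume_form c y v =
      \det (\matrix_(i, j) ('D_(v j) (transition c ch) y) 0 i)].
  exists (if `[< cdom c0 (cbwd c y) >] then c0 else c1); rewrite /volume_form.
  case: asboolP => y0; split=> //.
  - by move=> v; exact: dwedge_coord.
  - by have [] := cover (cbwd c y).
  - move=> v; apply: dwedge_coord => //.
    by have [] := cover (cbwd c y).
have yo : overlap c ch y by exists (cbwd c y).
have uo : overlap ch c (transition c ch y) by exists (cbwd c y).
have TT : transition ch c (transition c ch y) = y.
  by rewrite /transition /=; case: (tA _ Ach) => _ _ ->.
have LK v : 'D_('D_v (transition c ch) y) (transition ch c) (transition c ch y) = v.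
  exact: (derive_transitionK manA Ac Ach).
have LK' v : 'D_('D_v (transition ch c) (transition c ch y)) (transition c ch) y = v.
  by have := derive_transitionK manA Ach Ac v uo; rewrite TT.
pose Lu := 'D_u (transition c ch) y.
have Lu0 : Lu != 0.
  apply: contra u0 => /eqP E0; rewrite -(LK u) -/Lu E0.
  by rewrite derive0.
(* The image of [u] in the chart [ch] is completed to a basis; its other members, pulled back to
   [c], turn the value of the form into the nonzero determinant of [B]. *)
have [B uB B0] := complete_basis Lu0.
pose v j := 'D_(row (lift ord0 j) B) (transition ch c) (transition c ch y).
have := congr1 (fun h => h v) H; rewrite /interior_product WE.
rewrite (_ : \matrix_(i, j) _ = B^T).
  by move/eqP; rewrite det_tr; apply/negP; move: uB; rewrite unitmxE unitfE.
apply/matrixP => i j; rewrite !mxE; case: (unliftP ord0 j) => [l ->|->] /=.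
  by rewrite LK' mxE.
by have := congr1 (fun r : 'rV[R]_4 => r 0 i) B0; rewrite mxE => ->.
Qed.

End VolumeForm.

(** * The Jacobian of the transition over a segment *)

Section InversionJacobian.
Variable R : realType.
Notation F := 'rV[R]_4.

Definition inv_factor (u : F) : R :=
  (4 - sqnorm u ^+ 2) `^ (4^-1) * (sqnorm u) `^ (- 2^-1).

Definition inv_domain : set F := [set u | 0 < sqnorm u /\ 0 < 4 - sqnorm u ^+ 2].

Lemma smooth_sqnorm : smooth_on setT (@sqnorm R 1 4).
Proof. by apply: (smooth_on_sqnorm openT); exact: (smooth_on_id openT). Qed.

Lemma smooth_cosqnorm : smooth_on setT (fun u : F => 4 - sqnorm u ^+ 2).
Proof.
apply: (smooth_on_sub openT); first exact: (smooth_on_cst _ openT).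
by apply: (smooth_on_exp _ openT); exact: smooth_sqnorm.
Qed.

Lemma open_inv_domain : open inv_domain.
Proof.
apply: openI.
  by have /continuousP/(_ _ (@open_gt R 0)) := smooth_continuous smooth_sqnorm.
by have /continuousP/(_ _ (@open_gt R 0)) := smooth_continuous smooth_cosqnorm.
Qed.

Lemma smooth_inv_factor : smooth_on inv_domain inv_factor.
Proof.
have oD := open_inv_domain; apply: (smooth_on_mul oD).
  apply: (smooth_on_comp_real oD (smooth_on_powR _)) => [|u []//].
  exact: smooth_on_subset smooth_cosqnorm.
apply: (smooth_on_comp_real oD (smooth_on_powR _)) => [|u []//].
exact: smooth_on_subset smooth_sqnorm.
Qed.

Lemma inv_factor_gt0 u : inv_domain u -> 0 < inv_factor u.
Proof. by move=> [s0 s4]; rewrite mulr_gt0 // powR_gt0. Qed.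

Lemma inv_factor4 u : inv_domain u ->
  inv_factor u ^+ 4 * sqnorm u ^+ 2 = 4 - sqnorm u ^+ 2.
Proof.
move=> [s0 s4]; rewrite /inv_factor exprMn.
have -> : (4 - sqnorm u ^+ 2) `^ (4^-1) ^+ 4 = 4 - sqnorm u ^+ 2.
  by rewrite -powR_mulrn ?powR_ge0 // -powRrM mulVf ?pnatr_eq0 // powRr1 // ltW.
have -> : (sqnorm u) `^ (- 2^-1) ^+ 4 = (sqnorm u ^+ 2)^-1.
  rewrite powRN exprVn (exprM _ 2 2); congr (_ ^+ _)^-1.
  by rewrite -powR_mulrn ?powR_ge0 // -powRrM mulVf ?pnatr_eq0 // powRr1 // ltW.
by rewrite divfK // expf_neq0 // gt_eqF.
Qed.

Lemma derive_sqnorm (u w : F) : 'D_w (@sqnorm R 1 4) u = 2 * (u *m w^T) 0 0.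
Proof.
have dc j : derivable (fun u : F => u 0 j) u w.
  by have /derivable_mxP := @derivable_id _ _ u w; exact.
have -> : @sqnorm R 1 4 = \sum_j ((fun u : F => u 0 j) * (fun u : F => u 0 j)).
  apply/funext => x; rewrite fct_sumE /sqnorm big_ord1.
  by apply: eq_bigr => j _; rewrite expr2.
rewrite derive_sum => [|j]; last exact: derivableM.
rewrite mxE mulr_sumr; apply: eq_bigr => j _.
rewrite deriveM // derive_coord mxE /GRing.scale /=; ring.
Qed.

(** Implicit differentiation of P^4 s^2 = 4 - s^2 with s = |u|^2, where 1 + P^4 = 4 / s^2. *)
Lemma derive_inv_factor u w : inv_domain u ->
  'D_w inv_factor u = - 4 / (sqnorm u ^+ 3 * inv_factor u ^+ 3) * (u *m w^T) 0 0.
Proof.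
move=> Du; have [s0 s4] := Du; have P0 := inv_factor_gt0 Du; have PE := inv_factor4 Du.
have dP : derivable inv_factor u w := smooth_on_derivable smooth_inv_factor Du.
have ds : derivable (@sqnorm R 1 4) u w := smooth_on_derivable smooth_sqnorm I.
have sE := derive_sqnorm u w.
have : 'D_w (inv_factor ^+ 4 * @sqnorm R 1 4 ^+ 2) u = 'D_w (cst 4 - @sqnorm R 1 4 ^+ 2) u.
  apply: near_eq_derive.
  have : nbhs u inv_domain by move: open_inv_domain; rewrite openE; apply.
  by apply: filterS => x /inv_factor4.
rewrite deriveM; [|exact: derivableX|exact: derivableX].
rewrite deriveB; [|exact: derivable_cst|exact: derivableX].
rewrite !deriveX // derive_cst sE /GRing.scale /=.
move: ('D_w _ u) ((u *m w^T) 0 0) => Pw uw.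
rewrite !exprfctE /= => E.
have s0' : sqnorm u != 0 by rewrite gt_eqF.
have P0' : inv_factor u != 0 by rewrite gt_eqF.
move: (inv_factor u) (sqnorm u) s0' P0' PE E => P s s0' P0' PE E.
have {}E : s ^+ 3 * P ^+ 3 * Pw = - 4 * uw.
  have : s * (P ^+ 4 * (2 * s ^+ 1 * (2 * uw)) + s ^+ 2 * (4 * P ^+ 3 * Pw)) =
      s * (0 - 2 * s ^+ 1 * (2 * uw)) by rewrite E.
  have : (P ^+ 4 * s ^+ 2) * uw = (4 - s ^+ 2) * uw by rewrite PE.
  by move=> E1 E2; lra.
apply: (mulfI (_ : s ^+ 3 * P ^+ 3 != 0)); first by rewrite mulf_neq0 ?expf_neq0.
by rewrite E mulrA mulrCA mulfV ?mulr1 // mulf_neq0 ?expf_neq0.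
Qed.

(* The map u |-> P(u) conj(u), with |P(u) conj(u)|^4 + |u|^4 = 4, preserves the
   Lebesgue measure and the orientation of R^4. *)
Lemma inversion_jacobian (T : F -> F) u (w : 'I_4 -> F) : inv_domain u ->
  (\forall x \near u, T x = inv_factor x *: qconj x) -> (forall v, derivable T u v) ->
  \det (\matrix_(i, j) ('D_(w j) T u) 0 i) = \det (\matrix_(i, j) w j 0 i).
Proof.
move=> Du TE dT; have [s0 s4] := Du; have P0 := inv_factor_gt0 Du.
set P := inv_factor u in P0 *; set s := sqnorm u in s0 s4 *.
have PE : P ^+ 4 * s ^+ 2 = 4 - s ^+ 2 := inv_factor4 Du.
pose a := - 4 / (s ^+ 3 * P ^+ 3).
(* Conjugation, of determinant -1. The derivative of [T] is C (P + a u^T u), and the second factor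
   has determinant (P^4 s^2 - 4) / s^2 = -1. *)
pose C : 'rV[R]_4 := \row_i (if i == 0 then 1 else -1).
pose W : 'M[R]_4 := \matrix_(i, j) w j 0 i.
have dP v : derivable inv_factor u v := smooth_on_derivable smooth_inv_factor Du.
have DT j i : ('D_(w j) T u) 0 i = C 0 i * (a * (u *m (w j)^T) 0 0 * u 0 i + P * w j 0 i).
  rewrite (derive_mx (dT (w j))) mxE.
  have dc : derivable (fun x : F => x 0 i) u (w j).
    by have /derivable_mxP := @derivable_id _ _ u (w j); exact.
  transitivity ('D_(w j) (C 0 i \*o (inv_factor * (fun x : F => x 0 i))) u).
    apply: near_eq_derive; apply: filterS TE => x ->.
    by rewrite !mxE /=; case: (i == 0); rewrite !(mul1r, mulN1r) ?mulrN.
  rewrite deriveMl; last exact: derivableM.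
  rewrite deriveM // derive_coord derive_inv_factor // /GRing.scale /= -/P -/s -/a.
  by ring.
have -> : \matrix_(i, j) ('D_(w j) T u) 0 i =
    diag_mx C *m (P%:M + a *: (u^T *m u)) *m W.
  apply/matrixP => i j; rewrite -mulmxA mul_diag_mx mxE DT [RHS]mxE; congr (_ * _).
  rewrite mulmxDl mul_scalar_mx -scalemxAl -mulmxA [RHS]mxE [(P *: W) _ _]mxE.
  have -> : (a *: (u^T *m (u *m W))) i j = a * (u 0 i * (u *m W) 0 j).
    by rewrite [LHS]mxE; congr (_ * _); rewrite [LHS]mxE big_ord1 [u^T _ _]mxE.
  have -> : (u *m W) 0 j = (u *m (w j)^T) 0 0.
    by rewrite [LHS]mxE [RHS]mxE; apply: eq_bigr => l _; rewrite !mxE.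
  by rewrite [W _ _]mxE; ring.
rewrite !det_mulmx det_rank1_update ?gt_eqF // det_diag.
have uu : (u *m u^T) 0 0 = s.
  by rewrite mxE /s /sqnorm big_ord1; apply: eq_bigr => l _; rewrite mxE expr2.
have -> : \prod_i C 0 i = -1.
  rewrite !big_ord_recl big_ord0 !mxE /=; ring.
rewrite uu /a (_ : -1 * _ = 1) ?mul1r //.
have s0' : s != 0 by rewrite gt_eqF.
have P0' : P != 0 by rewrite gt_eqF.
have -> : -1 * (P ^+ 4 * (1 + -4 / (s ^+ 3 * P ^+ 3) / P * s)) =
    (4 - P ^+ 4 * s ^+ 2) / s ^+ 2 by field; rewrite s0' P0'.
by rewrite PE opprB addrCA subrr addr0 mulfV // expf_neq0.
Qed.

End InversionJacobian.

Section ToricLine.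
Variables (R : realType) (w : 'M[int]_(0, 1)) (mu : 'cV[R]_0).
Notation v := (col_mx (simplex_normals 1) w).
Notation lam := (col_mx (simplex_offsets R 1) mu).
Variable e : extension (1 + 1 + 0) 1.
Hypothesis eT : extends_torus_action R v e.
Notation Z := (level_set v lam).
Notation orb := (ext_orbit e).
Notation V := 'M[R]_(1 + 1 + 0, 4).
Notation F := 'M[R]_(1, 4).
Notation edge_l := (@edge_l 1 0).

(** The map out of the empty type through which the results on k cuts apply to k = 0. *)
Let idx : 'I_0 -> 'I_(1 + 1) := fun j => lshift 1 0.

Let idxI : injective idx. Proof. by case. Qed.
Let wE j : row j w = - row (idx j) (simplex_normals 1). Proof. by case: j. Qed.
Let c01 (j : 'I_0) : 0 < mu j 0 + simplex_offsets R 1 (idx j) 0 < 1. Proof. by case: j. Qed.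
Let cc1 (i j : 'I_0) : i != j -> 1 < mu i 0 + simplex_offsets R 1 (idx i) 0 +
  (mu j 0 + simplex_offsets R 1 (idx j) 0).
Proof. by case: i. Qed.

Lemma line_edges (a : 'I_(1 + 1 + 0)) : exists l, a = edge_l l.
Proof. by case: (split_ordP a) => [l ->|[]//]; exists l. Qed.

Lemma line_pinned l a : a \in pinned idx l None -> a = edge_l l.
Proof.
by have [l' ->] := line_edges a; rewrite mem_pinned_l orbF => /eqP ->.
Qed.

Lemma line_support l (q : V) : support_on (pinned idx l None) q <-> row (edge_l l) q != 0.
Proof.
split=> [Sq|q0 a /line_pinned -> //]; apply: Sq.
by rewrite mem_pinned_l eqxx.
Qed.

Lemma line_vertex (l : 'I_(1 + 1)) : (forall j : 'I_0, None = Some j -> l != idx j). Proof. by []. Qed.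

Lemma line_other (l l' : 'I_(1 + 1)) (r : 'I_1) : l != l' -> other_l l r = l'.
Proof.
move=> ll'; case: (other_lP l l') => [E|[r' ->]]; first by rewrite E eqxx in ll'.
by rewrite (ord1 r) (ord1 r').
Qed.

Lemma line_level (q : V) (l l' : 'I_(1 + 1)) : Z q -> l != l' ->
  quartic q (edge_l l) = 4 - quartic q (edge_l l').
Proof.
move=> /(level_setP _ wE)[q4 _] ll'; rewrite -q4 (sum_other_l l) big_ord1.
by rewrite (line_other _ ll') addrK.
Qed.

Lemma line_range l (u : F) : chart_range mu idx l None u <-> 0 < 4 - sqnorm u ^+ 2.
Proof.
have lE : level_of mu idx l None u (edge_l l) = 4 - sqnorm u ^+ 2.
  by rewrite level_base big_ord1 /level_r row_id.
split=> [/(_ (edge_l l))|u4 a /line_pinned ->]; rewrite lE //.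
by apply; rewrite mem_pinned_l eqxx.
Qed.

(* One of the two end points of the edges is None, so the group acts on both
   coordinates by multiplication from the same side. *)
Lemma line_swap (q : V) l l' (t : R) (u : F) : l != l' -> u != 0 ->
  row (edge_l l) q = t *: qone R -> row (edge_l l') q = u ->
  exists2 h, Sp1 h & row (edge_l l) (ext_act e h q) = t *: qconj (qdir u) /\
    row (edge_l l') (ext_act e h q) = qabs u *: qone R.
Proof.
move=> ll' u0 ql ql'.
have [x [y [z [b [xy _ nodes unc _]]]]] := extension_shape idxI wE eT (fun h => ltac:(by [])).
have act (h : 'M[R]_(1, 4)) i : row (edge_l i) (ext_act e h q) =
    qmul (qmul (at_node h x) (row (edge_l i) q)) (qconj (at_node h y)).
  by rewrite row_ext_act; have [|-> ->] := unc i; first by case.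
have d1 : sqnorm (qdir u) = 1 by rewrite sqnorm_dir.
have uE : u = qabs u *: qdir u by exact: qabs_dir.
have some n : n != None -> exists i : 'I_1, n = Some i by case: n => // i _; exists i.
case: (nodes None) => [xN|yN|[[]//]].
  have [|i yE] := some y; first by rewrite xN eq_sym.
  exists (\matrix_(_ < 1) qdir u); first by move=> j; rewrite rowK.
  rewrite !act -xN yE /= rowK !qmul1q ql ql' qmul_real; split=> //.
  by rewrite [X in qmul X _]uE qmulZl unit_mulV.
have [|i xE] := some x; first by rewrite yN.
exists (\matrix_(_ < 1) qconj (qdir u)); first by move=> j; rewrite rowK sqnorm_conj.
rewrite !act -yN xE /= rowK qconj1 !qmulq1 ql ql' qmulr_real; split=> //.
by rewrite [X in qmul _ X]uE qmulZr unit_Vmul.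
Qed.

Lemma line_plectic (z0 : Z) : exists omega : form_field R (toric_manifold v lam e) F 4,
  plectic_form (toric_charts v lam e) omega.
Proof.
have manM := toric_smooth_manifold idxI wE c01 cc1 eT.
pose l0 : 'I_(1 + 1) := lshift 1 0; pose l1 : 'I_(1 + 1) := rshift 1 0.
have l01 : l0 != l1 by [].
have l10 : l1 != l0 by [].
have [g0 [[]]] := toric_slice idxI wE eT (@line_vertex l0) z0.
set ch0 := slice_chart _ _ _ _ _ => A0 im0 dom0 fwd0 _ pos0; clearbody ch0.
have [g1 [[]]] := toric_slice idxI wE eT (@line_vertex l1) z0.
set ch1 := slice_chart _ _ _ _ _ => A1 im1 dom1 fwd1 _ pos1; clearbody ch1.
exists (volume_form ch0 ch1); apply: volume_form_plectic => //.
  move=> p; have [z <-] := orbit_proj_surj p.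
  have [z00|z00] := eqVneq (row (edge_l l0) (set_val z)) 0; last first.
    by left; apply/dom0/line_support.
  right; apply/dom1/line_support; rewrite -quartic_gt0.
  rewrite (line_level (set_val_in z) l10) /quartic z00.
  by rewrite (eqP (_ : sqnorm _ == 0)) ?sqnorm_eq0 // expr0n subr0.
have lift (q : V) : Z q -> exists z : Z, set_val z = q.
  by move=> Zq; exists (SigSub (mem_set Zq)); rewrite set_valE.
have [_ _ tA _ sA] := manM.
have oO := open_overlap (tA _ A0) (tA _ A1).
(* The section over [u] has [u] on the edge l1 and a positive fourth root on l0. [line_swap] moves
   along the orbit to a point that is positive on l1, and the chart [ch1] reads off its coordinate
   on l0. *)
have TE u : overlap ch0 ch1 u -> inv_domain u /\
    transition ch0 ch1 u = inv_factor u *: qconj u.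
  move=> uo; have Du : chart_range mu idx l0 None u.
    by rewrite -im0; case: uo => p [p0 _] <-; exists p.
  have u4 := (line_range _ _).1 Du.
  have [z zE] : exists z : Z, set_val z = section_of mu idx l0 None u.
    exact: (lift _ (section_level wE (@line_vertex l0) Du)).
  have Sz := section_support (@line_vertex l0) Du.
  have freeE l l' r : l != l' -> free_edge idx l None r = edge_l l'.
    by move=> ll'; rewrite /free_edge (line_other _ ll').
  have row1 : row (edge_l l1) (set_val z) = u.
    rewrite zE -(freeE l0 l1 0) // section_free; exact: row_id.
  pose t := (4 - sqnorm u ^+ 2) `^ 4^-1.
  have row0 : row (edge_l l0) (set_val z) = t *: qone R.
    rewrite zE section_pinned; last by rewrite mem_pinned_l eqxx.
    by rewrite level_base big_ord1 /level_r row_id.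
  have pz : cbwd ch0 u = orbit_proj orb z.
    have gz : cfwd ch0 (orbit_proj orb z) = u.
      rewrite fwd0; last by rewrite zE.
      rewrite pos0; [|exact: set_val_in|by rewrite zE|].
        by apply/row_matrixP => r; rewrite rowK zE section_free.
      move=> a /line_pinned ->; exists t; last exact: row0.
      exact: powR_gt0.
    rewrite -[in LHS]gz; have [_ _ K _ _] := tA _ A0; apply: K.
    by apply/dom0; rewrite zE.
  have u0 : u != 0.
    have : cdom ch1 (cbwd ch0 u).
      by case: uo => p [p0 p1] <-; have [_ _ K _ _] := tA _ A0; rewrite (K p p0).
    by rewrite pz => /dom1/line_support; rewrite row1.
  split; first by split=> //; rewrite sqnorm_gt0.
  have [h h1 [r0 r1]] := line_swap l01 u0 row0 row1.
  have Zh : Z (ext_act e h (set_val z)) by apply: level_set_act => //; exact: set_val_in.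
  have [z' z'E] : exists z' : Z, set_val z' = ext_act e h (set_val z).
    exact: lift.
  have zz' : orbit_proj orb z = orbit_proj orb z'.
    by apply/orbit_projP/ext_orbitP; exists h.
  rewrite /transition /= -/(cbwd ch0 u) pz zz'.
  have Sz' : support_on (pinned idx l1 None) (set_val z').
    apply/line_support; rewrite z'E r1 -sqnorm_gt0 sqnormZ sqnorm1 mulr1.
    by rewrite exprn_gt0 // qabs_gt0.
  rewrite fwd1 // pos1 //; last 2 first.
  - exact: set_val_in.
  - by move=> a /line_pinned ->; exists (qabs u); rewrite ?qabs_gt0 // z'E.
  apply/row_matrixP => r; rewrite rowK (freeE l1 l0) // z'E r0 row_id.
  by rewrite /inv_factor /qdir qconjZ scalerA.
move=> u y uo; have [Du _] := TE u uo.
apply: inversion_jacobian => //.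
  have : nbhs u (overlap ch0 ch1) by move: oO; rewrite openE; apply.
  by apply: filterS => x /TE[].
by move=> y'; exact: (smooth_on_derivable (sA _ _ A0 A1) uo).
Qed.

End ToricLine.

(** The coordinates are nonnegative reals with |q_a|^4 equal to 4 times the slack of [x] in the
    inequality [a]. The point obtained serves as the default in the charts and in the map from the
    collapse. *)
Lemma level_set_nonempty (R : realType) (m k : nat) (w : 'M[int]_(k, m))
    (mu : 'cV[R]_k) (idx : 'I_k -> 'I_(m + 1)) (x : 'cV[R]_m) :
  (forall j, row j w = - row (idx j) (simplex_normals m)) ->
  polyhedron (col_mx (simplex_normals m) w) (col_mx (simplex_offsets R m) mu) x ->
  exists z : level_set (col_mx (simplex_normals m) w) (col_mx (simplex_offsets R m) mu),
    True.
Proof.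
move=> wE Px.
have b0 l : 0 <= bary x l.
  by have := Px (lshift k l); rewrite map_col_mx mul_col_mx !col_mxEu subr_ge0.
have bc j : bary x (idx j) <= mu j 0 + simplex_offsets R m (idx j) 0.
  have := Px (rshift (m + 1) j); rewrite map_col_mx mul_col_mx !col_mxEd /bary.
  have -> : (map_mx intr w *m x) j 0 = - (map_mx intr (simplex_normals m) *m x) (idx j) 0.
    rewrite !mxE -sumrN; apply: eq_bigr => i _; rewrite !mxE.
    have := congr1 (fun r : 'rV[int]_m => r 0 i) (wE j); rewrite !mxE => ->.
    by rewrite mulrNz mulNr.
  by rewrite addrC lerD2r.
pose rho (a : 'I_(m + 1 + k)) : R := match fintype.split a with
  | inl l => bary x l
  | inr j => mu j 0 + simplex_offsets R m (idx j) 0 - bary x (idx j) end.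
have rho0 a : 0 <= rho a.
  by rewrite /rho; case: (fintype.split a) => [l|j]; rewrite ?b0 // subr_ge0 bc.
pose q : 'M[R]_(m + 1 + k, 4) := \matrix_a ((4 * rho a) `^ 4^-1 *: qone R).
have qE a : quartic q a = 4 * rho a.
  rewrite /quartic rowK sqnormZ sqnorm1 mulr1 -exprM -powR_mulrn ?powR_ge0 //.
  by rewrite -powRrM mulVf ?pnatr_eq0 // powRr1 // mulr_ge0.
have Zq : level_set (col_mx (simplex_normals m) w) (col_mx (simplex_offsets R m) mu) q.
  apply/(level_setP _ wE); split=> [|j].
    under eq_bigr do rewrite qE /rho (unsplitK (inl _)).
    by rewrite -mulr_sumr sum_bary mulr1.
  by rewrite !qE /rho (unsplitK (inl _)) (unsplitK (inr _)) -mulrDr addrC subrK.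
by exists (SigSub (mem_set Zq)).
Qed.

Theorem theorem5p7 (R : realType) (m k : nat)
    (w : 'M[int]_(k, m)) (mu : 'cV[R]_k)
    (v := col_mx (simplex_normals m) w)
    (lam := col_mx (simplex_offsets R m) mu)
    (Delta := polyhedron (simplex_normals m) (simplex_offsets R m))
    (P := polyhedron v lam) :
  (0 < m)%N ->
  (* the cutting hyperplanes <x, w_j> = mu_j are parallel to facets of Delta *)
  (forall j, exists i, row j w = row i (simplex_normals m) \/
                       row j w = - row i (simplex_normals m)) ->
  (* the pieces <x, w_j> >= mu_j cut off from Delta are pairwise disjoint *)
  (forall i j, i != j -> Delta
     `&` [set x | mu i 0 <= (map_mx intr w *m x) i 0]
     `&` [set x | mu j 0 <= (map_mx intr w *m x) j 0] = set0) ->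
  delzant P ->
  ([set F | facet P F] #= `I_(m + k + 1))%card ->
  (exists e : extension (m + 1 + k) k.+1, extends_torus_action R v e) /\
  forall e : extension (m + 1 + k) k.+1, extends_torus_action R v e ->
    [/\ smooth_manifold (toric_charts v lam e),
        exists p : 'I_k -> HP R m,
          injective p /\ blow_up (@HP_charts R m) p (toric_manifold v lam e) &
        exists omega : form_field R (toric_manifold v lam e) 'M[R]_(m, 4) 4,
          plectic_form (toric_charts v lam e) omega].
Proof.
case: m => [//|m] in w v lam Delta P *; move=> _ par disj del cardF.
have [idx /= [idxI wE c01 cc1 km]] := cut_structure par disj del cardF.
have [_ _ [[X [/(_ 0) PX _]] _] _] := del.
have [z0 _] := level_set_nonempty wE PX.
split; first by exists (standard_extension idx); exact: standard_extends.
move=> e eT; have manM := toric_smooth_manifold idxI wE c01 cc1 eT.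
split=> //; first exact: (toric_blow_up idxI wE c01 cc1 eT z0).
(* The dimension is m + 1 here. In dimension 1 there are no cuts, by [km], and the polytope is a
   segment; from dimension 2 on the real dimension is at least 8 and the generic form exists. *)
case: m => [|m] in w v lam Delta P par disj del cardF idx idxI wE c01 cc1 km X PX z0 e eT manM *.
  case: k => [|k] in w mu v lam Delta P par disj del cardF idx idxI wE c01 cc1 km PX z0 e eT manM *.
    exact: line_plectic.
  by have := km isT.
apply: exists_plectic manM _ _; last by lia.
exact: (toric_compact wE c01).
Qed.
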